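(* Let $n\ge 1$, let $f,g,u,v\in\mathrm{Sym}(\mathbb{C}^n)\cap H(\mathbb{C}^n)$, and write $\varphi=f+\overline{g}$ and $\psi=u+\overline{v}$. Let $h\in L^2(\mathbb{C}^n,d\mu)$. Then $T_\varphi T_\psi=T_h$ if and only if $$h(z)=u(z)\overline{g(z)}+f(z)u(z)+\overline{g(z)}\,\overline{v(z)}+v^*(\overline{z}-\partial_z)f(z)$$ for (almost every) $z\in\mathbb{C}^n$.
   Context: $dV$ is Lebesgue measure on $\mathbb{C}^n$ and $d\mu(z)=\pi^{-n}e^{-|z|^2}dV(z)$. For $z,w\in\mathbb{C}^n$, $z\cdot w=\sum_k z_kw_k$ (bilinear) and $|z|^2=z\cdot\overline{z}$. $H(\mathbb{C}^n)$ is the space of entire functions and $F^2=L^2(\mathbb{C}^n,d\mu)\cap H(\mathbb{C}^n)$ is the Fock space, with reproducing kernel $K_z(w)=e^{w\cdot\overline{z}}$. $\mathrm{Sym}(\mathbb{C}^n)$ is the set of complex measurable functions $u$ such that for every $c>0$ the function $u(z)e^{-c|z|^2}$ is essentially bounded. Toeplitz operators: $T_\varphi=PM_\varphi$, where $M_\varphi$ is multiplication by $\varphi$ and $P$ is the orthogonal projection of $L^2(\mathbb{C}^n,d\mu)$ onto $F^2$; explicitly $T_\varphi F(z)=\int_{\mathbb{C}^n}\varphi(w)F(w)e^{z\cdot\overline{w}}\,d\mu(w)$. Such operators may be unbounded; identities between Toeplitz operators and their products are understood as identities on the (dense) linear span of the kernels $K_z$, $z\in\mathbb{C}^n$, where all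 the integrals involved converge. Notation $v^*(\overline{z}-\partial_z)f(z)$: for entire $v(z)=\sum_i a_iz^i$ (multi-indices $i$), $v^*(z)=\overline{v(\overline{z})}=\sum_i\overline{a_i}z^i$, and $$v^*(\overline{z}-\partial_z)f(z)=\sum_i\overline{a_i}\,(\overline{z}-\partial_z)^if(z),\qquad (\overline{z}-\partial_z)^if(z)=\sum_{l\le i}\binom{i}{l}(-1)^{|i-l|}\,\overline{z}^{\,l}\,\partial^{i-l}f(z),$$ where $\binom{i}{l}=\prod_k\binom{i_k}{l_k}$, $l\le i$ componentwise, $|i-l|=\sum_k(i_k-l_k)$, $\partial^j=\partial_1^{j_1}\cdots\partial_n^{j_n}$, $\partial_k=\partial/\partial z_k$. *)

(* Defs.v *)
From HB Require Import structures.
From mathcomp Require Import all_boot all_order all_algebra.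
From mathcomp Require Import complex.
From mathcomp Require Import all_classical all_reals all_analysis.
From mathcomp Require Import measurable_realfun.
From mathcomp Require Import analysis.showcase.summability.

Set Implicit Arguments.
Unset Strict Implicit.
Unset Printing Implicit Defensive.

Import Order.TTheory GRing.Theory Num.Theory.
Import numFieldNormedType.Exports.

Local Open Scope classical_set_scope.
Local Open Scope complex_scope.
Local Open Scope ring_scope.

(* R[i] as a normed space over itself, so that 'rV[R[i]]_n is a normed R[i]-module and
   [differentiable], ['D_v f] on it are complex differentiability and complex directional
   derivatives. *)
#[non_forgetful_inheritance]
HB.instance Definition _ (R : realType) := GRing.ComAlgebra.copy R[i] R[i]^o.
#[non_forgetful_inheritance]
HB.instance Definition _ (R : realType) := Vector.copy R[i] R[i]^o.
#[non_forgetful_inheritance]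
HB.instance Definition _ (R : realType) := NormedModule.copy R[i] R[i]^o.

Section Pushforward.
Context d d' (T : measurableType d) (T' : measurableType d') (R : realType).
Variables (f : T -> T') (g : T' -> T).
Hypothesis mg : measurable_fun setT g.
Hypothesis fK : cancel f g.

Lemma sigma_finite_pushforward (m : set T -> \bar R) :
  sigma_finite setT m -> sigma_finite setT (pushforward m f).
Proof.
move=> [F TF Fm].
exists (fun k => g @^-1` F k).
  by rewrite -preimage_bigcup -TF preimage_setT.
move=> k; have [mFk Fk] := Fm k; split.
  by rewrite -[X in measurable X]setTI; exact: mg.
rewrite /pushforward (_ : f @^-1` _ = F k)//.
by apply/seteqP; split => x /=; rewrite fK.
Qed.
End Pushforward.

(* The instance of sigma-finiteness that the library builds for \x is shadowed by the one for
   subprobabilities, so that it is not inferred. *)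
Lemma sigma_finite_product d d' (T : measurableType d) (T' : measurableType d') (R : realType)
    (m : {sigma_finite_measure set T -> \bar R}) (m' : {sigma_finite_measure set T' -> \bar R}) :
  sigma_finite setT (m \x m')%E.
Proof.
have /sigma_finiteP[F [TF ndF Foo]] := sigma_finiteT m.
have /sigma_finiteP[G [TG ndG Goo]] := sigma_finiteT m'.
exists (fun n => F n `*` G n).
  rewrite -setXTT TF TG predeqE => -[x y]; split.
    move=> [/= [k _ Fkx] [l _ Gly]]; exists (maxn k l) => //; split.
    - by move: x Fkx; exact/subsetPset/ndF/leq_maxl.
    - by move: y Gly; exact/subsetPset/ndG/leq_maxr.
  by move=> [k _ []/= ? ?]; split; exists k.
move=> k; have [? ?] := Foo k; have [? ?] := Goo k.
split; first exact: measurableX.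
by rewrite product_measure1E// lte_mul_pinfty// ge0_fin_numE.
Qed.

Section TupleMeasure.
Context d (T : measurableType d) (R : realType).

Definition tuple_cons n (x : T * n.-tuple T) : n.+1.-tuple T := [tuple of x.1 :: x.2].
Definition tuple_uncons n (t : n.+1.-tuple T) : T * n.-tuple T :=
  (tnth t ord0, [tuple of behead t]).

Lemma measurable_tuple_cons n : measurable_fun setT (@tuple_cons n).
Proof. exact: measurable_cons. Qed.

Lemma measurable_tuple_uncons n : measurable_fun setT (@tuple_uncons n).
Proof.
by apply: measurable_fun_pair; [exact: measurable_tnth|exact: measurable_behead].
Qed.

Lemma tuple_consK n : cancel (@tuple_cons n) (@tuple_uncons n).
Proof.
by case=> x t; rewrite /tuple_uncons /tuple_cons /=; congr pair; apply: val_inj.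
Qed.

Section Step.
Variables (m : {sigma_finite_measure set T -> \bar R}) (n : nat).
Variable mn : {sigma_finite_measure set (n.-tuple T) -> \bar R}.

Definition cons_measure : set (n.+1.-tuple T) -> \bar R :=
  pushforward (m \x mn)%E (@tuple_cons n).

Let cons_measure0 : cons_measure set0 = 0%E.
Proof. by rewrite /cons_measure /pushforward preimage_set0 measure0. Qed.
Let cons_measure_ge0 A : (0 <= cons_measure A)%E.
Proof. by rewrite /cons_measure /pushforward measure_ge0. Qed.
Let cons_measure_additive : semi_sigma_additive cons_measure.
Proof.
by apply: measure_semi_sigma_additive; exact: measurable_tuple_cons.
Qed.
HB.instance Definition _ := isMeasure.Build _ _ _ cons_measure
  cons_measure0 cons_measure_ge0 cons_measure_additive.

Let cons_measure_sigma_finite : sigma_finite setT cons_measure.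
Proof.
apply: (sigma_finite_pushforward (@measurable_tuple_uncons n) (@tuple_consK n)).
exact: sigma_finite_product.
Qed.
HB.instance Definition _ := Measure_isSigmaFinite.Build _ _ _ cons_measure
  cons_measure_sigma_finite.
End Step.

Fixpoint tuple_measure (m : {sigma_finite_measure set T -> \bar R}) n :
    {sigma_finite_measure set (n.-tuple T) -> \bar R} :=
  match n with
  | 0 => dirac [tuple]
  | k.+1 => cons_measure m (tuple_measure m k)
  end.
End TupleMeasure.

(* C^n is identified with (R x R)^n by real and imaginary parts of the coordinates; its
   measurable sets are the product sigma-algebra (the Borel sets) transported along this
   bijection, and lebesgueCn below is the image of the product Lebesgue measure. *)
Section ComplexSpace.
Variables (R : realType) (n : nat).
Local Notation C := R[i].
Local Notation Cn := 'rV[C]_n.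
Local Notation R' := (measurableTypeR R).

Definition of_pairs (x : n.-tuple (R' * R')) : Cn :=
  \row_k (((tnth x k).1 : R) +i* ((tnth x k).2 : R)).
Definition to_pairs (z : Cn) : n.-tuple (R' * R') :=
  [tuple ((complex.Re (z ord0 k) : R'), (complex.Im (z ord0 k) : R')) | k < n].

Lemma of_pairsK : cancel of_pairs to_pairs.
Proof.
by move=> x; apply: eq_from_tnth => k; rewrite tnth_mktuple mxE /=; case: (tnth x k).
Qed.

Lemma to_pairsK : cancel to_pairs of_pairs.
Proof. by move=> z; apply/rowP => k; rewrite mxE tnth_mktuple /=; case: (z ord0 k). Qed.

HB.instance Definition _ := Measurable.copy Cn (g_sigma_algebra_preimageType to_pairs).

Lemma measurable_of_pairs : measurable_fun setT of_pairs.
Proof.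
move=> _ _ [B mB <-]; rewrite !setTI (_ : of_pairs @^-1` _ = B)//.
by apply/seteqP; split => x /=; rewrite of_pairsK.
Qed.

Lemma measurable_to_pairs : measurable_fun setT to_pairs.
Proof. by move=> _ B mB; exists B. Qed.

End ComplexSpace.

Section Lebesgue.
Variable R : realType.

Definition lebesgue2 : set (measurableTypeR R * measurableTypeR R) -> \bar R :=
  (@lebesgue_measure R \x @lebesgue_measure R)%E.
HB.instance Definition _ := Measure.on lebesgue2.
HB.instance Definition _ := Measure_isSigmaFinite.Build _ _ _ lebesgue2
  (sigma_finite_product lebesgue_measure lebesgue_measure).

Variable n : nat.

Definition lebesgueCn : set 'rV[R[i]]_n -> \bar R :=
  pushforward (tuple_measure lebesgue2 n) (@of_pairs R n).

Let lebesgueCn0 : lebesgueCn set0 = 0%E.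
Proof. by rewrite /lebesgueCn /pushforward preimage_set0 measure0. Qed.
Let lebesgueCn_ge0 A : (0 <= lebesgueCn A)%E.
Proof. by rewrite /lebesgueCn /pushforward measure_ge0. Qed.
Let lebesgueCn_additive : semi_sigma_additive lebesgueCn.
Proof. by apply: measure_semi_sigma_additive; exact: measurable_of_pairs. Qed.
HB.instance Definition _ := isMeasure.Build _ _ _ lebesgueCn
  lebesgueCn0 lebesgueCn_ge0 lebesgueCn_additive.

Let lebesgueCn_sigma_finite : sigma_finite setT lebesgueCn.
Proof.
apply: (sigma_finite_pushforward (@measurable_to_pairs R n) (@of_pairsK R n)).
exact: sigma_finiteT.
Qed.
HB.instance Definition _ := Measure_isSigmaFinite.Build _ _ _ lebesgueCn
  lebesgueCn_sigma_finite.

End Lebesgue.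

Section Gauss.
Variables (R : realType) (n : nat).
Local Notation C := R[i].
Local Notation Cn := 'rV[C]_n.
Implicit Types (z w : Cn) (F : Cn -> C).

Definition dotC z w : C := \sum_k z ord0 k * w ord0 k.
Definition conjv z : Cn := \row_k (z ord0 k)^*.
Definition sqnormC z : R := complex.Re (dotC z (conjv z)).

Definition gauss_density z : R := (pi ^+ n)^-1 * expR (- sqnormC z).

(* dmu = pi^(-n) e^(-|z|^2) dV *)
Definition gauss : set Cn -> \bar R :=
  fun A => (\int[@lebesgueCn R n]_(z in A) (gauss_density z)%:E)%E.

Definition cmeasurable F :=
  measurable_fun setT (fun z => complex.Re (F z)) /\
  measurable_fun setT (fun z => complex.Im (F z)).

Lemma measurable_coord (k : 'I_n) : cmeasurable (fun z => z ord0 k).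
Proof.
have mk : measurable_fun setT (fun z : Cn => tnth (to_pairs z) k).
  exact: measurableT_comp (measurable_tnth k) (@measurable_to_pairs R n).
split.
- rewrite (_ : (fun z => _) = fst \o (fun z : Cn => tnth (to_pairs z) k)).
    exact: measurableT_comp measurable_fst mk.
  by apply/funext => z /=; rewrite tnth_mktuple.
- rewrite (_ : (fun z => _) = snd \o (fun z : Cn => tnth (to_pairs z) k)).
    exact: measurableT_comp measurable_snd mk.
  by apply/funext => z /=; rewrite tnth_mktuple.
Qed.

Lemma sqnormCE z : sqnormC z =
  \sum_k (complex.Re (z ord0 k) ^+ 2 + complex.Im (z ord0 k) ^+ 2).
Proof.
rewrite /sqnormC /dotC raddf_sum; apply: eq_bigr => k _.
by rewrite mxE; case: (z ord0 k) => a b /=; rewrite mulrN opprK !expr2.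
Qed.

Lemma measurable_sqnormC : measurable_fun setT sqnormC.
Proof.
rewrite (_ : sqnormC = fun z => \sum_k
  (complex.Re (z ord0 k) ^+ 2 + complex.Im (z ord0 k) ^+ 2)); last first.
  by apply/funext => z; exact: sqnormCE.
apply: measurable_sum => k; have [mRe mIm] := measurable_coord k.
by apply: measurable_funD; exact: measurable_funX.
Qed.

Lemma gauss_density_ge0 z : 0 <= gauss_density z.
Proof. by rewrite mulr_ge0 ?expR_ge0// invr_ge0 exprn_ge0// pi_ge0. Qed.

Lemma measurable_gauss_density : measurable_fun setT gauss_density.
Proof.
apply: measurable_funM => //; apply: measurableT_comp => //.
by apply: measurableT_comp => //; exact: measurable_sqnormC.
Qed.

Let gauss0 : gauss set0 = 0%E.
Proof. exact: integral_set0. Qed.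
Let gauss_ge0 A : (0 <= gauss A)%E.
Proof. by apply: integral_ge0 => z _; rewrite lee_fin gauss_density_ge0. Qed.
Let gauss_additive : semi_sigma_additive gauss.
Proof.
apply: semi_sigma_additive_nng_induced.
  by apply/measurable_EFinP; exact: measurable_gauss_density.
by move=> z; rewrite lee_fin gauss_density_ge0.
Qed.
HB.instance Definition _ := isMeasure.Build _ _ _ gauss
  gauss0 gauss_ge0 gauss_additive.

End Gauss.

Definition cexp (R : realType) (z : R[i]) : R[i] :=
  (expR (complex.Re z))%:C * (cos (complex.Im z) +i* sin (complex.Im z)).

Local Notation normc := ComplexField.Normc.normc.

Section Fock.
Variables (R : realType) (n : nat).
Local Notation C := R[i].
Local Notation Cn := 'rV[C]_n.
Local Notation V := (@lebesgueCn R n).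
Local Notation mu := (@gauss R n).
Implicit Types (z w a : Cn) (F phi f u v h : Cn -> C).

Definition entire f := forall z, differentiable f z.

Definition Sym u := cmeasurable u /\
  forall c : R, 0 < c -> exists M : R,
    {ae V, forall z, normc (u z) * expR (- c * sqnormC z) <= M}.

Definition L2 h := cmeasurable h /\ (\int[mu]_z ((normc (h z)) ^+ 2)%:E < +oo)%E.

Definition fock_kernel z w : C := cexp (dotC w (conjv z)).

Definition kernel_span F := exists m (c : 'I_m -> C) (a : 'I_m -> Cn),
  forall w, F w = \sum_j c j * fock_kernel (a j) w.

(* Rintegral is total: the value is meaningful when both parts of F are integrable. This is
   the case in toeplitz_prod_eq below when phi and psi are sums of a function and a conjugate
   of a function that are entire and in Sym, and h is in L2. *)
Definition gauss_integral F : C :=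
  Rintegral mu setT (fun w => complex.Re (F w)) +i*
  Rintegral mu setT (fun w => complex.Im (F w)).

Definition toeplitz phi F z : C :=
  gauss_integral (fun w => phi w * F w * cexp (dotC z (conjv w))).

(* T_phi T_psi = T_h on the linear span of the kernels. *)
Definition toeplitz_prod_eq phi psi h :=
  forall F, kernel_span F -> forall z, toeplitz phi (toeplitz psi F) z = toeplitz h F z.

Definition multi_index := {ffun 'I_n -> nat}.
Implicit Types i j : multi_index.

Definition mweight i : nat := (\sum_k i k)%N.

(* Complex partial derivative in the k-th coordinate. *)
Definition pderiv (k : 'I_n) f : Cn -> C := fun z => 'D_(delta_mx ord0 k) f z.

(* d_1^{j_1} ... d_n^{j_n} f *)
Definition mderiv j f : Cn -> C :=
  foldr (fun k F => iter (j k) (pderiv k) F) f (enum 'I_n).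

Definition mfact i : nat := (\prod_k (i k)`!)%N.

Definition taylor_coef v i : C := mderiv i v 0 / (mfact i)%:R.

(* (conj z - d_z)^i f(z). The multi-indices l <= i are the finite functions into
   {0, ..., |i|} that are bounded by i. *)
Definition shift_pow i f z : C :=
  \sum_(l : {ffun 'I_n -> 'I_(mweight i).+1} | [forall k, l k <= i k]%N)
    (\prod_k 'C(i k, l k))%N%:R * (-1) ^+ (\sum_k (i k - l k))%N
    * (\prod_k (conjv z ord0 k) ^+ l k)
    * mderiv [ffun k => (i k - l k)%N] f z.

(* v^*(conj z - d_z) f(z), as an unordered sum over all multi-indices. *)
Definition shift_star v f z : C :=
  @summability.sum multi_index R[i] R[i] (fun i : multi_index => (taylor_coef v i)^* * shift_pow i f z).

End Fock.

(* Main.v *)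
(** On a kernel [K_a] one has [T_psi K_a = (u + conj (v a)) K_a], by the reproducing formula
    [F z = \int F w e^(z.conj w) dmu w], valid for entire functions of subgaussian growth, and by
    its conjugate. So everything reduces to finding [S] with
    [\int S K_a e^(z.conj w) dmu w = conj (v a) f z e^(z.conj a)] for all [a] and [z]. The function
    [S w = \int f s conj (v (w - s)) e^(w.conj s) dmu s] has this property, by Fubini and two uses
    of the reproducing formula. It equals v^*(conj w - d_w) f(w): differentiating the reproducing
    formula under the integral sign gives
    [(conj w - d_w)^i f w = \int f s (conj (w - s))^i e^(w.conj s) dmu s], and the Taylor series of
    [v], which comes from expanding the exponential in the reproducing formula, may be integrated
    term by term. Conversely, an integrable function that is orthogonal to all products
    [K_a e^(z.conj w)] has a vanishing Fourier transform (take [z = - a]), hence vanishes.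

    A translation reduces the reproducing formula to [\int G dmu = G 0]. By rotation invariance of
    [mu], [G] may be replaced by its averages over the rotations by [2^N]-th roots of unity, which
    converge to [G 0] by a discrete version of Goursat's theorem, where Riemann sums take the
    place of line integrals. *)
Require Import Defs.
From HB Require Import structures.
From mathcomp Require Import all_boot all_order all_algebra.
From mathcomp Require Import complex finmap ring lra.
From mathcomp Require Import all_classical all_reals all_analysis.
From mathcomp Require Import measurable_realfun.
From mathcomp Require Import analysis.showcase.summability.

Set Implicit Arguments.
Unset Strict Implicit.
Unset Printing Implicit Defensive.

Import Order.TTheory GRing.Theory Num.Theory.
Import numFieldNormedType.Exports.

Local Open Scope classical_set_scope.
Local Open Scope complex_scope.
Local Open Scope ring_scope.

Local Notation normc := ComplexField.Normc.normc.

(** * Complex numbers and the exponential *)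

Section ComplexNumbers.
Variable R : realType.
Implicit Types (z w : R[i]) (x y : R).

(** Entire means complex differentiable at each point, so that no power series, Cauchy formula or
    higher derivative is available at the start: all of them are drawn from the reproducing formula.
    Integrability is a matter of budget. Against [mu] a measurable function is integrable if it is
    at most [M e^(c|z|^2)] with [c < 1]. Entire functions in [Sym] cost an arbitrarily small [c],
    but the kernel [e^(w.conj s)] with both variables free costs 1/2 in each, and the tails of its
    series cost more, by the factor that makes them decay geometrically. The rates 7/8, 13/16 and
    11/16 come from keeping the totals below 1. The function [S] is only shown to stay within such a
    budget, not to be square integrable, so the uniqueness argument is made for integrable
    functions. It avoids Fourier inversion: the bounded [p] such that [kappa p] is orthogonal to all
    cosines are stable under products with sines and under bounded limits, hence reach the
    indicators of half-spaces, which generate the measurable sets. *)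

Lemma normCE z : `|z| = (normc z)%:C.
Proof. by []. Qed.

Lemma cRe_conj z : complex.Re z^* = complex.Re z.
Proof. by case: z. Qed.

Lemma cIm_conj z : complex.Im z^* = - complex.Im z.
Proof. by case: z. Qed.

Lemma cReD z w : complex.Re (z + w) = complex.Re z + complex.Re w.
Proof. by case: z; case: w. Qed.

Lemma cImD z w : complex.Im (z + w) = complex.Im z + complex.Im w.
Proof. by case: z; case: w. Qed.

Lemma cReM z w : complex.Re (z * w) =
  complex.Re z * complex.Re w - complex.Im z * complex.Im w.
Proof. by case: z; case: w. Qed.

Lemma cImM z w : complex.Im (z * w) =
  complex.Re z * complex.Im w + complex.Im z * complex.Re w.
Proof. by case: z => a b; case: w => c d /=; ring. Qed.

Lemma cReN z : complex.Re (- z) = - complex.Re z.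
Proof. by case: z. Qed.

Lemma cImN z : complex.Im (- z) = - complex.Im z.
Proof. by case: z. Qed.

Lemma complexP z w : complex.Re z = complex.Re w -> complex.Im z = complex.Im w -> z = w.
Proof. by case: z => a b; case: w => c d /= -> ->. Qed.

Lemma normc_ge0 z : 0 <= normc z.
Proof. by case: z => a b /=; exact: sqrtr_ge0. Qed.

Lemma normc_sqr z : normc z ^+ 2 = complex.Re z ^+ 2 + complex.Im z ^+ 2.
Proof. by case: z => a b /=; rewrite sqr_sqrtr// addr_ge0// sqr_ge0. Qed.

Lemma normc_conj z : normc z^* = normc z.
Proof. by case: z => a b /=; rewrite sqrrN. Qed.

Lemma normc_real x : normc x%:C = `|x|.
Proof. by rewrite /= expr0n/= addr0 sqrtr_sqr. Qed.

Lemma normcD z w : normc (z + w) <= normc z + normc w.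
Proof. exact: le_normcD. Qed.

Lemma normcB z w : normc (z - w) <= normc z + normc w.
Proof. by rewrite -[normc w]normcN; exact: normcD. Qed.

Lemma normcX z k : normc (z ^+ k) = normc z ^+ k.
Proof.
elim: k => [|k IH]; first by rewrite !expr0 ComplexField.Normc.normc1.
by rewrite !exprS ComplexField.Normc.normcM IH.
Qed.

Lemma normc_prod (I : Type) (r : seq I) (P : pred I) (F : I -> R[i]) :
  normc (\prod_(k <- r | P k) F k) = \prod_(k <- r | P k) normc (F k).
Proof.
apply: (big_morph (fun z => normc z)) => [z w|]; first exact: ComplexField.Normc.normcM.
exact: ComplexField.Normc.normc1.
Qed.

Lemma normc_sum (I : Type) (r : seq I) (P : pred I) (F : I -> R[i]) :
  normc (\sum_(k <- r | P k) F k) <= \sum_(k <- r | P k) normc (F k).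
Proof.
apply: (big_ind2 (fun z x => normc z <= x)) => [|z x w y zx wy|//].
  by rewrite ComplexField.Normc.normc0.
exact: le_trans (normcD _ _) (lerD zx wy).
Qed.

Lemma normr_Re_le z : `|complex.Re z| <= normc z.
Proof.
rewrite -(ler_pXn2r (n:=2))// ?nnegrE ?normc_ge0//.
by rewrite normc_sqr -normrX ger0_norm ?sqr_ge0// lerDl sqr_ge0.
Qed.

Lemma normr_Im_le z : `|complex.Im z| <= normc z.
Proof.
rewrite -(ler_pXn2r (n:=2))// ?nnegrE ?normc_ge0//.
by rewrite normc_sqr -normrX ger0_norm ?sqr_ge0// lerDr sqr_ge0.
Qed.

Lemma normc_le_ReIm z : normc z <= `|complex.Re z| + `|complex.Im z|.
Proof.
rewrite -(ler_pXn2r (n:=2))// ?nnegrE ?normc_ge0 ?addr_ge0//.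
rewrite normc_sqr sqrrD !real_normK ?num_real//.
by rewrite addrAC lerDl mulrn_wge0// mulr_ge0//.
Qed.

Lemma cexpD z w : cexp (z + w) = cexp z * cexp w.
Proof.
rewrite /cexp cReD cImD expRD cosD sinD.
apply: complexP; rewrite !(cReM, cImM)/=.
  by ring.
by ring.
Qed.

Lemma cexp0 : cexp (0 : R[i]) = 1.
Proof. by rewrite /cexp/= expR0 cos0 sin0 mul1r. Qed.

Lemma normc_cexp z : normc (cexp z) = expR (complex.Re z).
Proof.
rewrite /cexp ComplexField.Normc.normcM normc_real ger0_norm ?expR_ge0//=.
by rewrite cos2Dsin2 sqrtr1 mulr1.
Qed.

Lemma cexp_conj z : (cexp z)^* = cexp z^*.
Proof.
apply: complexP; rewrite ?(cRe_conj, cIm_conj) /cexp !(cReM, cImM)/= ?(cRe_conj, cIm_conj) cosN sinN.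
  by ring.
by ring.
Qed.

Lemma cexp_sum (I : Type) (r : seq I) (P : pred I) (F : I -> R[i]) :
  cexp (\sum_(k <- r | P k) F k) = \prod_(k <- r | P k) cexp (F k).
Proof. exact: (big_morph _ cexpD cexp0). Qed.

End ComplexNumbers.

(** * The exponential along real segments and the error of its partial sums *)

Section ExponentialSeries.
Variable R : realType.
Implicit Types (z w : R[i]) (x s : R) (p q : R -> R[i]).

(** Only curves with a real parameter are differentiated here, and by parts, because the mean value
    theorem is applied to each part. *)
Definition is_cderive1 p q := forall s,
  is_derive s 1 (fun t => complex.Re (p t)) (complex.Re (q s)) /\
  is_derive s 1 (fun t => complex.Im (p t)) (complex.Im (q s)).

Lemma is_cderive1_cst z : is_cderive1 (fun=> z) (fun=> 0).
Proof. by move=> s; split; exact: is_derive_cst. Qed.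

Lemma is_cderive1D p q p' q' : is_cderive1 p p' -> is_cderive1 q q' ->
  is_cderive1 (fun s => p s + q s) (fun s => p' s + q' s).
Proof.
move=> hp hq s; have [pr pi] := hp s; have [qr qi] := hq s; split.
  by rewrite cReD (_ : (fun t => complex.Re _) = (fun t => complex.Re (p t)) +
    (fun t => complex.Re (q t))); [exact: is_deriveD|apply/funext => t; rewrite cReD].
by rewrite cImD (_ : (fun t => complex.Im _) = (fun t => complex.Im (p t)) +
  (fun t => complex.Im (q t))); [exact: is_deriveD|apply/funext => t; rewrite cImD].
Qed.

Lemma is_cderive1M p q p' q' : is_cderive1 p p' -> is_cderive1 q q' ->
  is_cderive1 (fun s => p s * q s) (fun s => p' s * q s + p s * q' s).
Proof.
move=> hp hq s; have [pr pi] := hp s; have [qr qi] := hq s; split.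
  rewrite (_ : (fun t => complex.Re _) = (fun t => complex.Re (p t)) *
    (fun t => complex.Re (q t)) - (fun t => complex.Im (p t)) *
    (fun t => complex.Im (q t))); last by apply/funext => t; rewrite cReM.
  by apply: is_derive_eq; rewrite cReD !cReM /GRing.scale/=; ring.
rewrite (_ : (fun t => complex.Im _) = (fun t => complex.Re (p t)) *
  (fun t => complex.Im (q t)) + (fun t => complex.Im (p t)) *
  (fun t => complex.Re (q t))); last by apply/funext => t; rewrite cImM.
by apply: is_derive_eq; rewrite cImD !cImM /GRing.scale/=; ring.
Qed.

Lemma is_cderive1_id : is_cderive1 (fun s => s%:C) (fun=> 1).
Proof.
by move=> s; split => /=; [exact: is_derive_id|exact: is_derive_cst].
Qed.

Lemma is_cderive1_cexp z : is_cderive1 (fun s => cexp (s%:C * z)) (fun s => z * cexp (s%:C * z)).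
Proof.
move=> s.
have dx (x : R) : is_derive s 1 ( *%R^~ x) x.
  rewrite (_ : *%R^~ x = (x \*: id)); last by apply/funext => t; rewrite /= mulrC.
  by apply: is_derive_eq; rewrite /GRing.scale/= mulr1.
have de (x : R) : is_derive s 1 (expR \o *%R^~ x) (x * expR (s * x)).
  by have := @is_derive1_comp R expR ( *%R^~ x) s _ _ (is_derive_expR (s * x)) (dx x); rewrite mulrC.
have dc (x : R) : is_derive s 1 (cos \o *%R^~ x) (- (x * sin (s * x))).
  by have := @is_derive1_comp R cos ( *%R^~ x) s _ _ (is_derive_cos (s * x)) (dx x); rewrite mulNr mulrC.
have ds (x : R) : is_derive s 1 (sin \o *%R^~ x) (x * cos (s * x)).
  by have := @is_derive1_comp R sin ( *%R^~ x) s _ _ (is_derive_sin (s * x)) (dx x); rewrite mulrC.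
split.
  rewrite (_ : (fun t => complex.Re _) = (expR \o *%R^~ (complex.Re z)) *
      (cos \o *%R^~ (complex.Im z))); last first.
    by apply/funext => t; rewrite /cexp/= !(cReM, cImM)/= !(mul0r, subr0, addr0).
  apply: is_derive_eq; rewrite /GRing.scale/=.
  rewrite /cexp !(cReM, cImM)/=.
  by rewrite !(mul0r, subr0, addr0); ring.
rewrite (_ : (fun t => complex.Im _) = (expR \o *%R^~ (complex.Re z)) *
    (sin \o *%R^~ (complex.Im z))); last first.
  by apply/funext => t; rewrite /cexp/= !(cReM, cImM)/= !(mul0r, subr0, addr0).
apply: is_derive_eq; rewrite /GRing.scale/=.
  rewrite /cexp !(cReM, cImM)/=.
by rewrite !(mul0r, subr0, addr0); ring.
Qed.

(** The mean value theorem fails for complex-valued curves. Applied to the two parts it gives two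
    different intermediate points, whence the factor 2. *)
Lemma is_cderive1_mean p q (K : R) : is_cderive1 p q ->
  (forall s, 0 <= s <= 1 -> normc (q s) <= K) -> normc (p 1 - p 0) <= K *+ 2.
Proof.
move=> hp hK.
have cont (f g : R -> R) : (forall s, is_derive s 1 f (g s)) -> {within `[0, 1], continuous f}.
  move=> df; apply: continuous_subspaceT => s; apply: differentiable_continuous.
  by apply/derivable1_diffP; have [] := df s.
have [c c01 Ec] := @MVT_segment R _ _ 0 1 ler01 (fun s _ => (hp s).1) (cont _ _ (fun s => (hp s).1)).
have [d d01 Ed] := @MVT_segment R _ _ 0 1 ler01 (fun s _ => (hp s).2) (cont _ _ (fun s => (hp s).2)).
apply: le_trans (normc_le_ReIm _) _.
rewrite cReD cImD cReN cImN Ec Ed subr0 !mulr1 mulr2n lerD//.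
  by apply: le_trans (normr_Re_le _) (hK _ _); move: c01; rewrite in_itv.
by apply: le_trans (normr_Im_le _) (hK _ _); move: d01; rewrite in_itv.
Qed.

Definition cexp_part M z : R[i] := \sum_(m < M) z ^+ m / m`!%:R.

Lemma is_cderive1_exp_part M z :
  is_cderive1 (fun s => cexp_part M.+1 (s%:C * z)) (fun s => z * cexp_part M (s%:C * z)).
Proof.
have dX k : is_cderive1 (fun s => (s%:C * z) ^+ k.+1)
    (fun s => (k.+1)%:R * z * (s%:C * z) ^+ k).
  elim: k => [|k IH].
    have := is_cderive1M is_cderive1_id (is_cderive1_cst z).
    by congr is_cderive1; apply/funext => s; rewrite ?expr1// expr0; ring.
  have := is_cderive1M (is_cderive1M is_cderive1_id (is_cderive1_cst z)) IH.
  by congr is_cderive1; apply/funext => s; rewrite !exprS// -!natr1; ring.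
rewrite /cexp_part; elim: M => [|M IH].
  have := is_cderive1_cst 1.
  congr is_cderive1; apply/funext => s; last by rewrite big_ord0 mulr0.
  by rewrite big_ord_recr big_ord0/= add0r expr0 fact0 divr1.
have := is_cderive1D IH (is_cderive1M (dX M) (is_cderive1_cst (M.+1`!%:R^-1))).
congr is_cderive1; apply/funext => s; first by rewrite [in RHS]big_ord_recr.
rewrite [in RHS]big_ord_recr/= mulrDr; congr (_ + _).
rewrite factS natrM mulr0 addr0.
have M0 : (M.+1)%:R != 0 :> R[i] by rewrite pnatr_eq0.
have F0 : M`!%:R != 0 :> R[i] by rewrite pnatr_eq0 -lt0n fact_gt0.
by field; rewrite F0 nat1r M0.
Qed.

(* The derivative of [s |-> cexp (- s z) * cexp_part M.+1 (s z)] reduces to the last term of the sum. *)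
Lemma cexp_part_bound M z :
  normc (cexp z - cexp_part M.+1 z) <= (normc z ^+ M.+1 / M`!%:R * expR (normc z)) *+ 2 * expR (normc z).
Proof.
pose p s := cexp (s%:C * - z) * cexp_part M.+1 (s%:C * z).
pose q (s : R) := - (z * (s%:C * z) ^+ M / M`!%:R * cexp (s%:C * - z)).
have dp : is_cderive1 p q.
  have := is_cderive1M (is_cderive1_cexp (- z)) (is_cderive1_exp_part M z).
  congr is_cderive1; apply/funext => s; rewrite /q /cexp_part big_ord_recr/=; ring.
have reb (w : R[i]) : expR (complex.Re w) <= expR (normc w).
  by rewrite ler_expR (le_trans (ler_norm _))// normr_Re_le.
have F0 : 0 < M`!%:R :> R by rewrite ltr0n fact_gt0.
have p10 : normc (p 1 - p 0) <= normc z ^+ M.+1 / M`!%:R * expR (normc z) *+ 2.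
  apply: (is_cderive1_mean dp) => s /andP[s0 s1].
  have nsz (w : R[i]) : normc (s%:C * w) <= normc w.
    by rewrite ComplexField.Normc.normcM normc_real ger0_norm// ler_piMl ?normc_ge0.
  rewrite /q normcN 3!ComplexField.Normc.normcM normcX normc_cexp.
  rewrite ComplexField.Normc.normcV.
  have -> : normc (M`!%:R : R[i]) = M`!%:R.
    by rewrite -(rmorph_nat (real_complex R)) normc_real ger0_norm// ltW.
  apply: ler_pM; rewrite ?expR_ge0// ?mulr_ge0 ?exprn_ge0 ?normc_ge0 ?invr_ge0 ?(ltW F0)//.
    rewrite ler_pM2r ?invr_gt0// exprS ler_wpM2l ?normc_ge0// lerXn2r// ?nnegrE ?normc_ge0//.
  apply: le_trans (reb _) _; rewrite ler_expR; apply: le_trans (nsz _) _.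
  by rewrite normcN.
rewrite (_ : cexp z - _ = - ((p 1 - p 0) * cexp z)); last first.
  rewrite /p !mul0r mul1r cexp0 mul1r.
  have -> : cexp_part M.+1 0 = 1 :> R[i].
    rewrite /cexp_part big_ord_recl/= expr0 fact0 divr1 big1 ?addr0// => i _.
    by rewrite expr0n/= mul0r.
  rewrite (_ : 1%:C = 1)// mul1r mulrBl mulrAC -cexpD addNr cexp0; ring.
rewrite normcN ComplexField.Normc.normcM normc_cexp.
by apply: ler_pM; rewrite ?normc_ge0 ?expR_ge0.
Qed.

Lemma cvg_cexp_part z : normc (cexp z - cexp_part M z) @[M --> \oo] --> (0 : R).
Proof.
rewrite -cvg_shiftS/=; set x := normc z.
apply: (@squeeze_cvgr _ _ _ _ (fun=> 0) (fun M =>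
    exp_coeff x M * (x * expR x *+ 2 * expR x))).
- near=> M; rewrite normc_ge0/=; apply: le_trans (cexp_part_bound M z) _.
  by rewrite -/x /exp_coeff/= exprS; rewrite le_eqVlt; apply/orP; left; apply/eqP; ring.
- exact: cvg_cst.
- rewrite -[X in _ --> X](mul0r (x * expR x *+ 2 * expR x)).
  by apply: cvgMl; exact: cvg_exp_coeff.
Unshelve. all: by end_near.
Qed.

Lemma normc_cexpB1 z : normc (cexp z - 1) <= (normc z * expR (normc z)) *+ 2.
Proof.
have := is_cderive1_mean (p := fun s => cexp (s%:C * z)) (is_cderive1_cexp z) (K := normc z * expR (normc z)).
rewrite mul1r mul0r cexp0; apply => s /andP[s0 s1].
rewrite ComplexField.Normc.normcM normc_cexp ler_wpM2l ?normc_ge0// ler_expR.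
apply: le_trans (ler_norm _) _; apply: le_trans (normr_Re_le _) _.
by rewrite ComplexField.Normc.normcM normc_real ger0_norm// ler_piMl ?normc_ge0.
Qed.

(** The derivative of [cexp (s z) - s z] in [s] is [z (cexp (s z) - 1)], which [normc_cexpB1]
    bounds. This quadratic remainder gives the complex differentiability of [cexp] and later the
    differentiation under the integral sign. *)
Lemma normc_cexpB1B z : normc (cexp z - 1 - z) <= (normc z ^+ 2 * expR (normc z)) *+ 4.
Proof.
pose p (s : R) := cexp (s%:C * z) - s%:C * z.
have dp : is_cderive1 p (fun s => z * (cexp (s%:C * z) - 1)).
  have := is_cderive1D (is_cderive1_cexp z) (is_cderive1M (is_cderive1_cst (-1))
    (is_cderive1M is_cderive1_id (is_cderive1_cst z))).
  congr is_cderive1; apply/funext => s; rewrite /p; ring.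
have := is_cderive1_mean dp (K := normc z ^+ 2 * expR (normc z) *+ 2).
rewrite -mulrnA (_ : p 1 - p 0 = cexp z - 1 - z).
  apply => s /andP[s0 s1]; rewrite ComplexField.Normc.normcM expr2 -mulrA -mulrnAr.
  rewrite ler_wpM2l ?normc_ge0//; apply: le_trans (normc_cexpB1 _) _.
  have nsz : normc (s%:C * z) <= normc z.
    by rewrite ComplexField.Normc.normcM normc_real ger0_norm// ler_piMl ?normc_ge0.
  by rewrite lerMn2r ler_pM ?normc_ge0 ?expR_ge0 ?ler_expR.
by rewrite /p mul1r mul0r cexp0; ring.
Qed.

Lemma exp_part_le x M : 0 <= x -> \sum_(m < M) x ^+ m / m`!%:R <= expR x.
Proof.
move=> x0; rewrite -(big_mkord xpredT (fun m => x ^+ m / m`!%:R)).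
apply: (nondecreasing_cvgn_le (u_ := series (exp_coeff x))); last exact: is_cvg_series_exp_coeff.
by apply: nondecreasing_series => m _ _; exact: exp_coeff_ge0.
Qed.

End ExponentialSeries.

(** * A discrete Goursat theorem and the mean value property *)

Section Cousin.
Variables (R : realType) (P : R -> R -> R -> Prop).
Hypothesis quarter : forall x y s, P x y (s / 2) -> P (x + s / 2) y (s / 2) ->
  P x (y + s / 2) (s / 2) -> P (x + s / 2) (y + s / 2) (s / 2) -> P x y s.
Hypothesis local : forall a b, exists2 d, 0 < d & forall x y s, 0 < s -> s <= d ->
  x <= a <= x + s -> y <= b <= y + s -> P x y s.

(* Bisection: a square violating [P] contains a nested sequence of violating squares, which
   shrinks to a point where [local] fails. *)
Lemma cousin_square x y s : 0 < s -> P x y s.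
Proof.
move=> s_gt0; apply: contrapT => NP.
(* Violating squares are bundled with the proof that they violate [P], so that the choice of a
   violating quarter is a total function and can be iterated. *)
pose bad := {t : R * R * R | ~ P t.1.1 t.1.2 t.2}.
have next (t : bad) : {t' : bad | [/\ (sval t').2 = (sval t).2 / 2,
    (sval t').1.1 = (sval t).1.1 \/ (sval t').1.1 = (sval t).1.1 + (sval t).2 / 2 &
    (sval t').1.2 = (sval t).1.2 \/ (sval t').1.2 = (sval t).1.2 + (sval t).2 / 2]}.
  apply: cid; case: t => -[[a b] r] /= NPt; apply: contrapT => Nt; apply: NPt.
  by apply: quarter; apply: contrapT => NQ; apply: Nt; exists (exist _ (_, _, _) NQ);
    split => /=; auto.
pose t n := sval (iter n (fun u => sval (next u)) (exist _ (x, y, s) NP : bad)).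
have tS n : [/\ (t n.+1).2 = (t n).2 / 2,
    (t n.+1).1.1 = (t n).1.1 \/ (t n.+1).1.1 = (t n).1.1 + (t n).2 / 2 &
    (t n.+1).1.2 = (t n).1.2 \/ (t n.+1).1.2 = (t n).1.2 + (t n).2 / 2].
  by rewrite /t iterS; case: (next (iter n _ _)).
have tP n : ~ P (t n).1.1 (t n).1.2 (t n).2 by rewrite /t; case: (iter n _ _).
have side n : (t n).2 = s / 2 ^+ n.
  elim: n => [|n IH]; first by rewrite expr0 divr1.
  by have [-> _ _] := tS n; rewrite IH exprSr invfM mulrA.
have side_gt0 n : 0 < (t n).2 by rewrite side divr_gt0 ?exprn_gt0.
(* One coordinate at a time: the lower ends increase, the upper ends decrease, and the supremum of
   the lower ends lies in all intervals. *)
have nested (c : R * R * R -> R) :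
    (forall n, c (t n.+1) = c (t n) \/ c (t n.+1) = c (t n) + (t n).2 / 2) ->
    exists a, forall n, c (t n) <= a <= c (t n) + (t n).2.
  move=> cS.
  have mono k n : c (t n) <= c (t (k + n)%N) /\ c (t (k + n)%N) + (t (k + n)%N).2 <= c (t n) + (t n).2.
    elim: k => [|k [IH1 IH2]]; first by rewrite add0n.
    rewrite addSn; have [eS _ _] := tS (k + n)%N; have := side_gt0 (k + n)%N.
    by case: (cS (k + n)%N) => ->; rewrite eS; lra.
  have cross n m : c (t n) <= c (t m) + (t m).2.
    have [|/ltnW] := leqP n m => /subnK <-.
      have [h _] := mono (m - n)%N n; have := side_gt0 (m - n + n)%N; lra.
    have [_ h] := mono (n - m)%N m; have := side_gt0 (n - m + m)%N; lra.
  exists (sup (range (fun n => c (t n)))) => n; apply/andP; split.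
    apply: ub_le_sup; last by exists n.
    by exists (c (t 0) + (t 0).2) => _ [m _ <-].
  by apply: ge_sup; [exists (c (t 0)), 0%N|move=> _ [m _ <-]].
have [a ha] := nested (fun u => u.1.1) (fun n => let: And3 _ h _ := tS n in h).
have [b hb] := nested (fun u => u.1.2) (fun n => let: And3 _ _ h := tS n in h).
have [d d_gt0 hd] := local a b.
have [n sn] : exists n, s / 2 ^+ n <= d.
  have [n hn] : exists n : nat, s / d < n%:R.
    by exists (Num.truncn (s / d)).+1; rewrite truncnS_gt.
  exists n; rewrite ler_pdivrMr ?exprn_gt0// mulrC -ler_pdivrMr//.
  apply: le_trans (ltW hn) _; rewrite -natrX ler_nat ltnW//; exact: ltn_expl.
by apply: (tP n); apply: hd; rewrite ?side_gt0// side.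
Qed.

End Cousin.

Section DiscreteGoursat.
Variable R : realType.
Implicit Types (x y h s e : R) (k N : nat).

(** A single complex [A] acting by multiplication encodes the Cauchy-Riemann equations. The
    increment is measured by the sum of its parts, which suits squares. *)
Definition complex_diff2 (g : R -> R -> R[i]) := forall x y, exists A : R[i], forall e, 0 < e ->
  exists2 d, 0 < d & forall x' y', `|x' - x| <= d -> `|y' - y| <= d ->
    normc (g x' y' - g x y - A * ((x' - x) +i* (y' - y))) <= e * (`|x' - x| + `|y' - y|).

Variable g : R -> R -> R[i].

(* Riemann sum, with [k] points on each side, of the integral of [g] along the boundary of a
   square of side [k * h]. Such sums are exactly additive under quartering. *)
Definition boundary_sum x y h k : R[i] := h%:C * \sum_(j < k)
  (g (x + j%:R * h) y - g (x + j%:R * h) (y + k%:R * h)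
   + 'i * (g (x + k%:R * h) (y + j%:R * h) - g x (y + j%:R * h))).

(** Quarters that share a side sample it at the same points and with opposite signs. *)
Lemma boundary_sum_quarter x y h k : let s := k%:R * h in
  boundary_sum x y h (k + k) = boundary_sum x y h k + boundary_sum (x + s) y h k +
    boundary_sum x (y + s) h k + boundary_sum (x + s) (y + s) h k.
Proof.
move=> s; rewrite /boundary_sum -!mulrDr; congr (_ * _).
rewrite big_split_ord/= -!big_split/=; apply: eq_bigr => j _.
have e1 z : z + (k + j)%:R * h = z + s + j%:R * h by rewrite natrD /s; ring.
have e2 z : z + (k + k)%:R * h = z + s + s by rewrite natrD /s; ring.
by rewrite !e1 !e2 -/s; ring.
Qed.

(** An affine function contributes nothing, for each [j] separately: its differences between
    opposite sides are [- A 'i s] and [A s], and the second is multiplied by ['i]. Only the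
    remainder is left, with four terms of size at most [2 e s] for each of [k] points of weight
    [h]. *)
Lemma boundary_sum_local A a b e d x y h k :
  (forall x' y', `|x' - a| <= d -> `|y' - b| <= d ->
    normc (g x' y' - g a b - A * ((x' - a) +i* (y' - b))) <= e * (`|x' - a| + `|y' - b|)) ->
  0 <= e -> 0 <= h -> k%:R * h <= d -> x <= a <= x + k%:R * h -> y <= b <= y + k%:R * h ->
  normc (boundary_sum x y h k) <= e * (k%:R * h) ^+ 2 *+ 8.
Proof.
move=> hA e0 h0; set s := k%:R * h => sd /andP[xa ax] /andP[yb by_].
pose r x' y' := g x' y' - g a b - A * ((x' - a) +i* (y' - b)).
have hr x' y' : x <= x' <= x + s -> y <= y' <= y + s -> normc (r x' y') <= e * s *+ 2.
  move=> /andP[x1 x2] /andP[y1 y2].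
  have lx : `|x' - a| <= s by rewrite ler_norml; apply/andP; split; lra.
  have ly : `|y' - b| <= s by rewrite ler_norml; apply/andP; split; lra.
  apply: le_trans (hA _ _ (le_trans lx sd) (le_trans ly sd)) _.
  by rewrite -mulrnAr ler_wpM2l// mulr2n lerD.
rewrite /boundary_sum ComplexField.Normc.normcM normc_real ger0_norm//.
have s0 : 0 <= s by rewrite mulr_ge0.
rewrite (_ : e * s ^+ 2 *+ 8 = h * (\sum_(j < k) e * s *+ 8)); last first.
  by rewrite sumr_const card_ord -mulr_natl /s; ring.
rewrite ler_wpM2l//; apply: le_trans (normc_sum _ _ _) _; apply: ler_sum => j _.
have js : 0 <= j%:R * h <= s.
  by rewrite mulr_ge0//= ler_wpM2r// ler_nat ltnW.
rewrite -/s; set t := j%:R * h in js *; case/andP: js => t0 ts.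
rewrite (_ : _ + _ = r (x + t) y - r (x + t) (y + s) + 'i * (r (x + s) (y + t) - r x (y + t))).
  have n1 := hr (x + t) y; have n2 := hr (x + t) (y + s).
  have n3 := hr (x + s) (y + t); have n4 := hr x (y + t).
  apply: le_trans (normcD _ _) _; rewrite ComplexField.Normc.normcM.
  have -> : normc ('i : R[i]) = 1 by rewrite /= expr0n/= add0r expr1n sqrtr1.
  rewrite mul1r (_ : e * s *+ 8 = (e * s *+ 2 + e * s *+ 2) + (e * s *+ 2 + e * s *+ 2)); last ring.
  apply: lerD; apply: le_trans (normcB _ _) _; apply: lerD; [apply: n1|apply: n2|apply: n3|apply: n4];
    apply/andP; split; lra.
rewrite /r.
have -> : (x + t - a) +i* (y + s - b) = (x + t - a) +i* (y - b) + 'i * s%:C.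
  by apply: complexP; rewrite ?(cReD, cImD, cReM, cImM)/=; ring.
have -> : (x + s - a) +i* (y + t - b) = (x - a) +i* (y + t - b) + s%:C.
  by apply: complexP; rewrite ?(cReD, cImD, cReM, cImM)/=; ring.
by ring.
Qed.

Hypothesis dg : complex_diff2 g.

Lemma discrete_goursat x y s e : 0 < s -> 0 < e ->
  exists N0, forall N, (N0 <= N)%N -> normc (boundary_sum x y (s / 2 ^+ N) (2 ^ N)) <= e.
Proof.
have pow2 (N : nat) (r : R) : (2 ^ N)%:R * (r / 2 ^+ N) = r.
  by rewrite natrX mulrC divfK// expf_neq0.
move=> s0 e0; pose e' := e / (s ^+ 2 *+ 8).
have : 0 < e' by rewrite divr_gt0// pmulrn_lgt0// exprn_gt0.
have : e' * s ^+ 2 *+ 8 = e by rewrite /e'; field; rewrite lt0r_neq0.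
move: e' => c <- c0 {e e0}.
(* The bound is proportional to the area, so that the bounds for the quarters add up to the bound
   for the square. *)
pose P x y s := exists N0, forall N, (N0 <= N)%N ->
  normc (boundary_sum x y (s / 2 ^+ N) (2 ^ N)) <= c * s ^+ 2 *+ 8.
suff : P x y s by [].
apply: cousin_square => // {x y s s0} [x y s|a b].
  move=> [N1 h1] [N2 h2] [N3 h3] [N4 h4].
  (* Level [N.+1] on the square is level [N] on its quarters, with the same step. *)
  exists (maxn (maxn N1 N2) (maxn N3 N4)).+1 => -[//|N].
  rewrite ltnS !geq_max => /andP[/andP[l1 l2] /andP[l3 l4]].
  have eh : s / 2 ^+ N.+1 = s / 2 / 2 ^+ N by rewrite exprS invfM mulrA.
  rewrite eh expnS mul2n -addnn boundary_sum_quarter pow2.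
  rewrite (_ : c * s ^+ 2 *+ 8 = c * (s / 2) ^+ 2 *+ 8 + c * (s / 2) ^+ 2 *+ 8 +
    c * (s / 2) ^+ 2 *+ 8 + c * (s / 2) ^+ 2 *+ 8); last by field.
  apply: le_trans (normcD _ _) _; apply: lerD; last exact: h4.
  apply: le_trans (normcD _ _) _; apply: lerD; last exact: h3.
  apply: le_trans (normcD _ _) _; apply: lerD; last exact: h2.
  exact: h1.
have [A hA] := dg a b; have [d d0 hd] := hA _ c0.
exists d => // x y s s0 sd xa yb; exists 0%N => N _.
by rewrite -[X in _ * X ^+ 2](pow2 N); apply: boundary_sum_local hd _ _ _ _ _;
  rewrite ?pow2// ltW// divr_gt0// exprn_gt0.
Qed.

End DiscreteGoursat.

(** * Means over roots of unity *)

Section MeanValue.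
Variable R : realType.
Implicit Types (x y e : R) (N : nat).

Definition complex_diff1 (p : R[i] -> R[i]) := forall z, exists A : R[i], forall e, 0 < e ->
  exists2 d, 0 < d & forall w, normc (w - z) <= d ->
    normc (p w - p z - A * (w - z)) <= e * normc (w - z).

Lemma complex_diff1_cexp : complex_diff1 (@cexp R).
Proof.
move=> z; exists (cexp z) => e e0.
pose K := normc (cexp z) * expR 1 *+ 4.
have K0 : 0 < K by rewrite pmulrn_lgt0// normc_cexp mulr_gt0// expR_gt0.
exists (Num.min 1 (e / K)); first by rewrite lt_min ltr01 divr_gt0.
move=> w; rewrite le_min => /andP[w1 we].
rewrite (_ : _ - _ = cexp z * (cexp (w - z) - 1 - (w - z))); last first.
  have -> : cexp w = cexp z * cexp (w - z) by rewrite -cexpD addrC subrK.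
  by ring.
rewrite ComplexField.Normc.normcM.
set u := w - z in w1 we *.
have h := normc_cexpB1B u.
apply: le_trans (ler_wpM2l (normc_ge0 _) h) _.
have -> : e * normc u = e / K * normc u * K by rewrite mulrAC divfK ?gt_eqF.
apply: (@le_trans _ _ (normc u ^+ 2 * K)).
  rewrite [leLHS](_ : _ = normc u ^+ 2 * (normc (cexp z) * expR (normc u) *+ 4)); last ring.
  rewrite ler_wpM2l ?exprn_ge0 ?normc_ge0// lerMn2r/= ler_wpM2l ?normc_ge0//.
  by rewrite ler_expR.
by rewrite expr2 ler_pM2r// ler_wpM2r ?normc_ge0.
Qed.

Lemma complex_diff1_comp p q : complex_diff1 p -> complex_diff1 q ->
  complex_diff1 (fun z => p (q z)).
Proof.
move=> dp dq z; have [A hA] := dp (q z); have [B hB] := dq z.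
exists (A * B) => e e0.
have B1 : 0 < normc B + 1 by rewrite ltr_wpDl ?normc_ge0.
have A1 : 0 < normc A + 1 by rewrite ltr_wpDl ?normc_ge0.
pose e1 := e / 2 / (normc B + 1); pose e2 := Num.min 1 (e / 2 / (normc A + 1)).
have e10 : 0 < e1 by rewrite !divr_gt0.
have e20 : 0 < e2 by rewrite lt_min ltr01 !divr_gt0.
have [d1 d10 h1] := hA _ e10; have [d2 d20 h2] := hB _ e20.
exists (Num.min d2 (d1 / (normc B + 1))); first by rewrite lt_min d20 divr_gt0.
move=> w; rewrite le_min => /andP[wd2]; rewrite ler_pdivlMr// => wd1.
have h2w := h2 _ wd2.
have n0 := normc_ge0 (w - z).
have lq : normc (q w - q z) <= normc (w - z) * (normc B + 1).
  rewrite (_ : q w - q z = (q w - q z - B * (w - z)) + B * (w - z)); last by ring.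
  apply: le_trans (normcD _ _) _; rewrite ComplexField.Normc.normcM [leRHS]mulrDr mulr1 addrC.
  rewrite lerD//; first by rewrite mulrC.
  by apply: le_trans h2w _; rewrite ler_piMl// /e2 ge_min lexx.
have h1w := h1 _ (le_trans lq wd1).
rewrite (_ : _ - _ = (p (q w) - p (q z) - A * (q w - q z)) + A * (q w - q z - B * (w - z))); last by ring.
apply: le_trans (normcD _ _) _; rewrite ComplexField.Normc.normcM.
rewrite [e in leRHS](_ : e = e1 * (normc B + 1) + (normc A + 1) * (e / 2 / (normc A + 1))); last first.
  by rewrite /e1; field; rewrite !gt_eqF.
rewrite mulrDl lerD//.
  by apply: le_trans h1w _; rewrite -mulrA ler_wpM2l ?(ltW e10)// mulrC.
rewrite -[leRHS]mulrA ler_pM ?normc_ge0//; first by rewrite lerDl.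
by apply: le_trans h2w _; rewrite ler_wpM2r// /e2 ge_min lexx orbT.
Qed.

Lemma complex_diff2_of1 p : complex_diff1 p -> complex_diff2 (fun x y => p (x +i* y)).
Proof.
move=> dp x y; have [A hA] := dp (x +i* y); exists A => e e0.
have [d d0 hd] := hA _ e0; exists (d / 2); first by rewrite divr_gt0.
move=> x' y' hx hy.
have E : x' +i* y' - (x +i* y) = (x' - x) +i* (y' - y) by [].
have le1 := normc_le_ReIm ((x' - x) +i* (y' - y)); rewrite [X in _ <= X]/= in le1.
have := hd (x' +i* y'); rewrite E; move/(_ _)/le_trans; apply.
  by apply: le_trans le1 _; rewrite [leRHS](splitr d) lerD.
by rewrite ler_wpM2l// ltW.
Qed.

Definition root_mean (p : R[i] -> R[i]) N : R[i] :=
  (2 ^- N) * \sum_(j < 2 ^ N) p (cexp (0 +i* (j%:R * (2 * pi / 2 ^+ N)))).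

Lemma cexp_2pi x y : cexp (x +i* (y + 2 * pi)) = cexp (x +i* y) :> R[i].
Proof.
rewrite /cexp/= (_ : y + 2 * pi = y + pi + pi); last by ring.
by rewrite !(cosDpi, sinDpi) !opprK.
Qed.

(* The exponential turns the circle of radius [expR x] into a vertical segment whose endpoints
   have the same image, so that the discrete Goursat theorem on squares of side [2 * pi] compares
   the means over circles whose radii differ by the factor [expR (2 * pi)]. *)
Lemma cvg_root_mean1 p : complex_diff1 p -> normc (root_mean p N - p 0) @[N --> \oo] --> (0 : R).
Proof.
move=> dp; pose g x y := p (cexp (x +i* y)).
have dg : complex_diff2 g.
  exact: (complex_diff2_of1 (complex_diff1_comp dp complex_diff1_cexp)).
pose L : R := 2 * pi; have L0 : 0 < L by rewrite mulr_gt0 ?pi_gt0.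
have gL x y : g x (y + L) = g x y by rewrite /g cexp_2pi.
pose m x N : R[i] := (2 ^- N) * \sum_(j < 2 ^ N) g x (j%:R * (L / 2 ^+ N)).
have pow2 (N : nat) : (2 ^ N)%:R * (L / 2 ^+ N) = L.
  by rewrite natrX mulrC divfK// expf_neq0.
(* In the boundary sum of the square at [(x, 0)] of side [L] the horizontal sides cancel by
   periodicity, and the vertical ones give [L 'i] times the difference of two means. *)
have step x e : 0 < e -> exists N0, forall N, (N0 <= N)%N -> normc (m (x + L) N - m x N) <= e.
  move=> e0; have Le0 : 0 < L * e by rewrite mulr_gt0.
  have [N0 h] := discrete_goursat dg x 0 L0 Le0; exists N0 => N /h.
  rewrite /boundary_sum pow2.
  have -> : (L / 2 ^+ N)%:C * (\sum_(j < 2 ^ N) (g (x + j%:R * (L / 2 ^+ N)) 0 -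
      g (x + j%:R * (L / 2 ^+ N)) (0 + L) + 'i * (g (x + L) (0 + j%:R * (L / 2 ^+ N)) -
      g x (0 + j%:R * (L / 2 ^+ N))))) = L%:C * ('i * (m (x + L) N - m x N)).
    rewrite /m -mulrBr -sumrB rmorphM fmorphV rmorphXn rmorph_nat -mulrA.
    congr (_ * _); rewrite mulrCA; congr (_ * _); rewrite mulr_sumr; apply: eq_bigr => j _.
    by rewrite gL !add0r; ring.
  rewrite 2!ComplexField.Normc.normcM normc_real gtr0_norm//.
  have -> : normc ('i : R[i]) = 1 by rewrite /= expr0n/= add0r expr1n sqrtr1.
  by rewrite mul1r ler_pM2l.
have steps k e : 0 < e -> exists N0, forall N, (N0 <= N)%N -> normc (m 0 N - m (- (k%:R * L)) N) <= e.
  elim: k e => [|k IH] e e0.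
    by exists 0%N => N _; rewrite mul0r oppr0 subrr ComplexField.Normc.normc0 ltW.
  have e20 : 0 < e / 2 by rewrite divr_gt0.
  have [N1 h1] := IH _ e20; have [N2 h2] := step (- (k.+1%:R * L)) _ e20.
  exists (maxn N1 N2) => N; rewrite geq_max => /andP[/h1 l1 /h2 l2].
  rewrite (_ : _ - _ = (m 0 N - m (- (k%:R * L)) N) + (m (- (k.+1%:R * L) + L) N - m (- (k.+1%:R * L)) N)).
    by rewrite (splitr e); apply: le_trans (normcD _ _) _; rewrite lerD.
  have -> : - (k.+1%:R * L) + L = - (k%:R * L) by rewrite -natr1; ring.
  by ring.
have [A hA] := dp 0; have [d d0 hd] := hA 1 ltr01.
(* By differentiability at the origin the mean over the circle of radius [expR (- k L)] is close to
   [p 0] as soon as this radius is at most [r]. The number [k] of circles is fixed before [N]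
   grows. *)
have limit e : 0 < e -> exists N0, forall N, (N0 <= N)%N -> normc (m 0 N - p 0) <= e.
  move=> e0; have A1 : 0 < normc A + 1 by rewrite ltr_wpDl ?normc_ge0.
  pose r := Num.min d (e / 2 / (normc A + 1)).
  have r0 : 0 < r by rewrite lt_min d0 !divr_gt0.
  have [k hk] : exists k : nat, expR (- (k%:R * L)) <= r.
    exists (Num.truncn (- ln r / L)).+1; rewrite -[leRHS]lnK ?posrE// ler_expR.
    rewrite lerNl -ler_pdivrMr//; apply: ltW; exact: truncnS_gt.
  have e20 : 0 < e / 2 by rewrite divr_gt0.
  have [N0 h0] := steps k _ e20; exists N0 => N /h0 l0.
  rewrite (_ : _ - _ = (m 0 N - m (- (k%:R * L)) N) + (m (- (k%:R * L)) N - p 0)); last by ring.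
  rewrite (splitr e); apply: le_trans (normcD _ _) _; rewrite lerD// {l0}.
  have two0 : (2 ^+ N : R[i]) != 0 by rewrite expf_neq0// pnatr_eq0.
  have -> : m (- (k%:R * L)) N - p 0 = (2 ^- N) * \sum_(j < 2 ^ N) (g (- (k%:R * L)) (j%:R * (L / 2 ^+ N)) - p 0).
    by rewrite sumrB sumr_const card_ord mulrBr -[p 0 *+ _]mulr_natl natrX mulKf.
  have n2 : normc (2 ^- N : R[i]) = 2 ^- N.
    by rewrite ComplexField.Normc.normcV normcX -(rmorph_nat (real_complex R)) normc_real ger0_norm.
  rewrite ComplexField.Normc.normcM n2 mulrC ler_pdivrMr ?exprn_gt0//.
  apply: le_trans (normc_sum _ _ _) _.
  apply: (@le_trans _ _ (\sum_(j < 2 ^ N) e / 2)); last first.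
    by rewrite sumr_const card_ord -[_ *+ _]mulr_natr natrX.
  apply: ler_sum => j _; rewrite /g.
  set w := cexp _; have nw : normc w = expR (- (k%:R * L)) by rewrite normc_cexp.
  have := hd w; rewrite subr0 nw => /(_ _)/wrap[|h]; first by rewrite (le_trans hk)// ge_min lexx.
  rewrite (_ : _ - _ = (p w - p 0 - A * w) + A * w); last by ring.
  apply: le_trans (normcD _ _) _; rewrite ComplexField.Normc.normcM nw.
  apply: (@le_trans _ _ ((normc A + 1) * expR (- (k%:R * L)))).
    by rewrite mulrDl mul1r addrC lerD2l -[leRHS]mul1r.
  rewrite mulrC -ler_pdivlMr//; apply: le_trans hk _.
  by rewrite ge_min lexx orbT.
apply/cvgrPdist_le => e e0; have [N0 h] := limit _ e0.
near=> N; rewrite sub0r normrN ger0_norm ?normc_ge0//; apply: h.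
by near: N; exact: nbhs_infty_ge.
Unshelve. all: by end_near.
Qed.

End MeanValue.

(** * Invariance of Lebesgue and Gauss measures *)

Section MeasurePreserving.
Local Open Scope ereal_scope.
Context d (T : measurableType d) (R : realType) (m : {measure set T -> \bar R}).
Implicit Types (phi psi : T -> T).

Definition measure_preserving phi := measurable_fun setT phi /\
  forall A, measurable A -> m (phi @^-1` A) = m A.

Lemma measure_preserving_comp phi psi : measure_preserving phi -> measure_preserving psi ->
  measure_preserving (phi \o psi).
Proof.
move=> [mphi hphi] [mpsi hpsi]; split; first exact: measurableT_comp.
move=> A mA; rewrite comp_preimage hpsi ?hphi//.
by rewrite -[X in measurable X]setTI; exact: mphi.
Qed.

Lemma ge0_measure_preserving_integral phi (f : T -> \bar R) : measure_preserving phi ->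
  measurable_fun setT f -> (forall x, 0 <= f x) -> \int[m]_x f (phi x) = \int[m]_x f x.
Proof.
move=> [mphi hphi] mf f0.
have -> : \int[m]_x f (phi x) = \int[pushforward m phi]_x f x.
  by rewrite ge0_integral_pushforward.
by apply: eq_measure_integral => A mA _; rewrite -hphi.
Qed.

Lemma measure_preserving_integral phi (f : T -> \bar R) : measure_preserving phi ->
  measurable_fun setT f -> \int[m]_x f (phi x) = \int[m]_x f x.
Proof.
move=> hphi mf; rewrite integralE [RHS]integralE; congr (_ - _).
  rewrite -[RHS](ge0_measure_preserving_integral hphi (measurable_funepos mf) (@funepos_ge0 _ _ f)).
  by apply: eq_integral => x _; rewrite !funeposE.
rewrite -[RHS](ge0_measure_preserving_integral hphi (measurable_funeneg mf) (@funeneg_ge0 _ _ f)).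
by apply: eq_integral => x _; rewrite !funenegE.
Qed.

End MeasurePreserving.

Section ProductPreserving.
Local Open Scope ereal_scope.
Context d1 d2 (T1 : measurableType d1) (T2 : measurableType d2) (R : realType).
Variable m1 : {sigma_finite_measure set T1 -> \bar R}.
Variable m2 : {sigma_finite_measure set T2 -> \bar R}.

(** [\x] integrates the measures of sections over the first coordinate, [\x^] over the second.
    Shears of the first coordinate are treated with the latter. *)
Lemma product_measure12E A : measurable A -> (m1 \x m2) A = (m1 \x^ m2) A.
Proof.
by move=> mA; apply: product_measure_unique => //= B C mB mC; rewrite product_measure2E.
Qed.

Lemma measure_preserving_shear2 (phi : T1 -> T2 -> T2) :
  measurable_fun setT (fun p : T1 * T2 => phi p.1 p.2) ->
  (forall x, measure_preserving m2 (phi x)) ->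
  measure_preserving (m1 \x m2) (fun p => (p.1, phi p.1 p.2)).
Proof.
move=> mphi hphi; split.
  by apply: measurable_fun_pair => //; exact: measurable_fst.
move=> A mA; rewrite /product_measure1; apply: eq_integral => x _ /=.
rewrite -[RHS](hphi x).2; last exact: measurable_xsection.
by congr (m2 _); apply/seteqP; split => y; rewrite /xsection/= !inE.
Qed.

Lemma measure_preserving_shear1 (phi : T2 -> T1 -> T1) :
  measurable_fun setT (fun p : T1 * T2 => phi p.2 p.1) ->
  (forall y, measure_preserving m1 (phi y)) ->
  measure_preserving (m1 \x m2) (fun p => (phi p.2 p.1, p.2)).
Proof.
move=> mphi hphi.
have mp : measurable_fun setT (fun p : T1 * T2 => (phi p.2 p.1, p.2)).
  by apply: measurable_fun_pair => //; exact: measurable_snd.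
split=> // A mA; have mB : measurable ((fun p : T1 * T2 => (phi p.2 p.1, p.2)) @^-1` A).
  by rewrite -[X in measurable X]setTI; exact: mp.
apply: (etrans (product_measure12E mB)); apply: (etrans _ (esym (product_measure12E mA))).
rewrite /product_measure2; apply: eq_integral => y _ /=.
rewrite -[RHS](hphi y).2; last exact: measurable_ysection.
by congr (m1 _); apply/seteqP; split => x; rewrite /ysection/= !inE.
Qed.

Lemma measure_preserving_prod (phi : T1 -> T1) (psi : T2 -> T2) :
  measure_preserving m1 phi -> measure_preserving m2 psi ->
  measure_preserving (m1 \x m2) (fun p => (phi p.1, psi p.2)).
Proof.
move=> hphi hpsi.
have h1 : measure_preserving (m1 \x m2) (fun p => (phi p.1, p.2)).
  apply: (@measure_preserving_shear1 (fun=> phi)) => //.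
  exact: measurableT_comp hphi.1 measurable_fst.
have h2 : measure_preserving (m1 \x m2) (fun p => (p.1, psi p.2)).
  apply: (@measure_preserving_shear2 (fun=> psi)) => //.
  exact: measurableT_comp hpsi.1 measurable_snd.
exact: (measure_preserving_comp h1 h2).
Qed.

End ProductPreserving.

Section TuplePreserving.
Local Open Scope ereal_scope.
Context d (T : measurableType d) (R : realType) (m : {sigma_finite_measure set T -> \bar R}).

Definition tuple_map n (phi : 'I_n -> T -> T) (t : n.-tuple T) : n.-tuple T :=
  [tuple phi k (tnth t k) | k < n].

Lemma tnth_tuple_cons0 n (x : T) (t : n.-tuple T) : tnth (tuple_cons (x, t)) ord0 = x.
Proof. by rewrite (tnth_nth x). Qed.

Lemma tnth_tuple_consS n (x : T) (t : n.-tuple T) (j : 'I_n) :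
  tnth (tuple_cons (x, t)) (lift ord0 j) = tnth t j.
Proof. by rewrite !(tnth_nth x). Qed.

Lemma measure_preserving_tuple n (phi : 'I_n -> T -> T) :
  (forall k, measure_preserving m (phi k)) ->
  measure_preserving (tuple_measure m n) (tuple_map phi).
Proof.
elim: n phi => [|n IH] phi hphi.
  have -> : tuple_map phi = id by apply/funext => t; rewrite (tuple0 t) [LHS]tuple0.
  by split => //; exact: measurable_id.
have := measure_preserving_prod (hphi ord0) (IH (fun k => phi (lift ord0 k)) (fun k => hphi _)).
move=> [mp hp].
have E x t : tuple_map phi (tuple_cons (x, t)) =
    tuple_cons (phi ord0 x, tuple_map (fun k => phi (lift ord0 k)) t).
  apply: eq_from_tnth => k; rewrite tnth_mktuple.
  case: (unliftP ord0 k) => [j|] ->; last by rewrite !tnth_tuple_cons0.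
  by rewrite !tnth_tuple_consS tnth_mktuple.
have mE : measurable_fun setT (tuple_map phi).
  rewrite (_ : tuple_map phi = @tuple_cons _ _ n \o ((fun p => (phi ord0 p.1,
    tuple_map (fun k => phi (lift ord0 k)) p.2)) \o @tuple_uncons _ _ n)).
    apply: measurableT_comp; first exact: measurable_tuple_cons.
    apply: measurableT_comp => //; exact: measurable_tuple_uncons.
  apply/funext => t /=; rewrite -E; congr tuple_map.
  by apply: val_inj; case: t => -[].
split => // A mA /=; rewrite /cons_measure /pushforward.
rewrite -[RHS]hp; last first.
  by rewrite -[X in measurable X]setTI; apply: measurable_tuple_cons.
congr (_ _); apply/seteqP; split => -[x t]; by rewrite /= E.
Qed.

Lemma tuple_integral_prod n (f : T -> R) : measurable_fun setT f -> (forall x, (0 <= f x)%R) ->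
  forall I : R, \int[m]_x (f x)%:E = I%:E ->
  \int[tuple_measure m n]_t (\prod_(k < n) f (tnth t k))%:E = (I ^+ n)%:E.
Proof.
move=> mf f0 I fI; elim: n => [|n IH] /=.
  rewrite integral_dirac//; first by rewrite diracT mul1e expr0 big_ord0.
  apply/measurable_EFinP; rewrite (_ : (fun _ => _) = cst 1%R)//.
  by apply/funext => t; rewrite big_ord0.
have mprod k : measurable_fun setT (fun t : k.-tuple T => \prod_(j < k) f (tnth t j))%R.
  apply: measurable_prod => j _; apply: measurableT_comp => //; exact: measurable_tnth.
have prod0 k (t : k.-tuple T) : (0 <= \prod_(j < k) f (tnth t j))%R by apply: prodr_ge0.
rewrite /cons_measure ge0_integral_pushforward//; last 3 first.
- exact: measurable_tuple_cons.
- by apply/measurable_EFinP; exact: mprod.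
- by move=> t _; rewrite lee_fin; exact: prod0.
rewrite preimage_setT.
rewrite (_ : (fun _ => _) = (fun p : T * n.-tuple T => (f p.1 * \prod_(j < n) f (tnth p.2 j))%:E)); last first.
  apply/funext => -[x t] /=; rewrite big_ord_recl tnth_tuple_cons0; congr (_ * _)%:E.
  by apply: eq_bigr => j _; rewrite tnth_tuple_consS.
rewrite fubini_tonelli1/=; last 2 first.
- apply/measurable_EFinP/measurable_funM; first exact: measurableT_comp measurable_fst.
  exact: measurableT_comp (mprod n) measurable_snd.
- by move=> p; rewrite lee_fin mulr_ge0//; exact: prod0.
rewrite /fubini_F/=.
under eq_integral.
  move=> x _; under eq_integral do rewrite EFinM.
  rewrite ge0_integralZl//; last 3 first.
  - by apply/measurable_EFinP; exact: mprod.
  - by move=> t _; rewrite lee_fin; exact: prod0.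
  - by rewrite lee_fin.
  rewrite IH; over.
rewrite ge0_integralZr//; first by rewrite fI -EFinM -exprS.
- exact/measurable_EFinP.
- by move=> x _; rewrite lee_fin.
- by rewrite -IH; apply: integral_ge0 => t _; rewrite lee_fin; exact: prod0.
Qed.

Lemma tuple_measure_box_gt0 n (B : 'I_n -> set T) :
  (forall k, measurable (B k)) -> (forall k, 0 < m (B k)) ->
  0 < tuple_measure m n [set t | forall k, B k (tnth t k)].
Proof.
elim: n B => [|n IH] B mB B0 /=.
  by rewrite diracE mem_set// => -[].
rewrite /cons_measure /pushforward.
rewrite (_ : _ @^-1` _ = B ord0 `*` [set t | forall k : 'I_n, B (lift ord0 k) (tnth t k)]).
  rewrite product_measure1E//.
    by apply: mule_gt0; [exact: B0|exact: (IH (fun k => B (lift ord0 k)))].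
  rewrite (_ : [set t | _] = \bigcap_(k in [set: 'I_n]) [set t | B (lift ord0 k) (tnth t k)]).
    apply: fin_bigcap_measurable => [|k _]; first exact: finite_finset.
    rewrite -[X in measurable X]setTI; exact: (measurable_tnth (k : 'I_n)).
  by apply/seteqP; split => t /= h k; [move=> _|]; exact: h.
apply/seteqP; split => -[x t] /= h.
  split; first by have := h ord0; rewrite tnth_tuple_cons0.
  by move=> k; have := h (lift ord0 k); rewrite tnth_tuple_consS.
by move=> k; case: (unliftP ord0 k) => [j|] ->; rewrite ?tnth_tuple_cons0 ?tnth_tuple_consS; [exact: h.2|exact: h.1].
Qed.

End TuplePreserving.

(** * Translations and rotations in dimensions one and two; Gaussian integrals *)

Section LebesgueInvariance.
Variable R : realType.
Local Notation R' := (measurableTypeR R).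

Lemma lebesgue_measure_translate (c : R) :
  measure_preserving (@lebesgue_measure R) (fun x : R' => x + c : R').
Proof.
have mc : measurable_fun setT (fun x : R' => x + c : R') by exact: measurable_funD.
split => // A mA; apply/esym.
apply: (lebesgue_measure_unique (mu := pushforward lebesgue_measure (fun x : R' => x + c : R'))) => // X.
move=> [[a b] /= _ <-]; rewrite /pushforward.
rewrite (_ : _ @^-1` _ = `]a - c, b - c]%classic); last first.
  by apply/seteqP; split => x /=; rewrite !in_itv/= ltrBlDr lerBrDr.
rewrite !lebesgue_measure_itv/= !lte_fin ltrD2r; case: ifP => // _.
by rewrite -!EFinB; congr EFin; ring.
Qed.

Lemma lebesgue2_translate (a b : R) :
  measure_preserving (@lebesgue2 R) (fun p : R' * R' => (p.1 + a : R', p.2 + b : R')).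
Proof.
exact: (measure_preserving_prod (lebesgue_measure_translate a) (lebesgue_measure_translate b)).
Qed.

(* A rotation is a product of three shears. *)
Lemma lebesgue2_rotate (a b : R) : a ^+ 2 + b ^+ 2 = 1 -> b != 0 ->
  measure_preserving (@lebesgue2 R)
    (fun p : R' * R' => (a * p.1 - b * p.2 : R', b * p.1 + a * p.2 : R')).
Proof.
(* For the rotation by an angle t, with [a = cos t] and [b = sin t], this is [- tan (t / 2)]. *)
move=> ab b0; pose s := (a - 1) / b.
have h1 c : measure_preserving (@lebesgue2 R) (fun p : R' * R' => (p.1 + c * p.2 : R', p.2)).
  apply: (@measure_preserving_shear1 _ _ _ _ _ lebesgue_measure lebesgue_measure
    (fun y x : R' => x + c * y : R')) => [|y].
    by apply: measurable_funD => //; apply: measurable_funM.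
  exact: lebesgue_measure_translate.
have h2 c : measure_preserving (@lebesgue2 R) (fun p : R' * R' => (p.1, p.2 + c * p.1 : R')).
  apply: (@measure_preserving_shear2 _ _ _ _ _ lebesgue_measure lebesgue_measure
    (fun x y : R' => y + c * x : R')) => [|x].
    by apply: measurable_funD => //; apply: measurable_funM.
  exact: lebesgue_measure_translate.
have := measure_preserving_comp (h1 s) (measure_preserving_comp (h2 b) (h1 s)).
congr measure_preserving; apply/funext => -[x y] /=.
have sb : s * b = a - 1 by rewrite /s divfK.
have e2 : b * s = a - 1 by rewrite mulrC.
congr pair; last by rewrite mulrDr mulrA e2; ring.
have -> : x + s * y + s * (y + b * (x + s * y)) = x * (1 + s * b) + y * (s * (1 + s * b) + s) by ring.
rewrite sb (_ : s * _ + s = - b); first by ring.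
have -> : s * (1 + (a - 1)) + s = (a ^+ 2 - 1) / b by rewrite /s; field.
have -> : a ^+ 2 - 1 = - b ^+ 2 by rewrite -ab; ring.
by field.
Qed.

Lemma lebesgue2_rotate_unit (a b : R) : a ^+ 2 + b ^+ 2 = 1 ->
  measure_preserving (@lebesgue2 R)
    (fun p : R' * R' => (a * p.1 - b * p.2 : R', b * p.1 + a * p.2 : R')).
Proof.
move=> ab; have [b0|] := eqVneq b 0; last exact: lebesgue2_rotate.
(* If [b = 0] the factorization into shears breaks down. The map is then plus or minus the identity,
   the fourth or second power of the quarter turn [h]. *)
have q : (0 : R) ^+ 2 + 1 ^+ 2 = 1 by rewrite expr0n/= add0r expr1n.
have h := lebesgue2_rotate q (oner_neq0 _).
rewrite {}b0 in ab *; move: ab; rewrite expr0n/= addr0 => /eqP; rewrite sqrf_eq1.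
move=> /orP[]/eqP ->.
  have := measure_preserving_comp h (measure_preserving_comp h (measure_preserving_comp h h)).
  by congr measure_preserving; apply/funext => -[x y] /=; congr pair; ring.
have := measure_preserving_comp h h.
by congr measure_preserving; apply/funext => -[x y] /=; congr pair; ring.
Qed.

Lemma integral_gauss_scale (c : R) : 0 < c ->
  exists I : R, (\int[lebesgue_measure]_(x in [set: R']) (expR (- c * x ^+ 2))%:E = I%:E)%E.
Proof.
(* The normal density with standard deviation [s] has exponent [- x^2 / (2 s^2) = - c x^2] and total
   mass 1. Only the finiteness of [I] will matter. *)
move=> c0; pose s := Num.sqrt (2 * c)^-1.
have c20 : 0 < 2 * c by rewrite mulr_gt0.
have s0 : s != 0 by rewrite gt_eqF// sqrtr_gt0 invr_gt0.
have := @integral_normal_pdf R 0 s; rewrite normal_pdfE//= => h.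
exists (normal_peak s)^-1.
have p0 := normal_peak_gt0 s0.
rewrite -[X in _ = X]mule1 -{}h -ge0_integralZl//; last 3 first.
- apply/measurable_EFinP; rewrite -normal_pdfE//; exact: measurable_normal_pdf.
- by move=> x _; rewrite lee_fin mulr_ge0 ?expR_ge0// ltW.
- by rewrite lee_fin invr_ge0 ltW.
apply: eq_integral => x _; rewrite -EFinM mulKf ?gt_eqF//; congr (expR _)%:E.
rewrite subr0 /s -mulr_natr sqr_sqrtr ?invr_ge0 ?ltW//.
by field; rewrite gt_eqF.
Qed.

Lemma lebesgue2_gauss (c I : R) :
  (\int[lebesgue_measure]_(x in [set: R']) (expR (- c * x ^+ 2))%:E = I%:E)%E ->
  (\int[lebesgue2 (R:=R)]_p (expR (- c * (p.1 ^+ 2 + p.2 ^+ 2)))%:E = (I * I)%:E)%E.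
Proof.
move=> hI.
have mg : measurable_fun setT (fun x : R' => expR (- c * x ^+ 2)).
  by apply: measurableT_comp => //; apply: measurable_funM => //; exact: measurable_funX.
rewrite (_ : (fun p => _) = (fun p : R' * R' => (expR (- c * p.1 ^+ 2) * expR (- c * p.2 ^+ 2))%:E)); last first.
  by apply/funext => p; rewrite -expRD mulrDr.
have -> : (\int[lebesgue2 (R:=R)]_p (expR (- c * p.1 ^+ 2) * expR (- c * p.2 ^+ 2))%:E)%E =
  (\int[lebesgue_measure \x lebesgue_measure]_p (expR (- c * p.1 ^+ 2) * expR (- c * p.2 ^+ 2))%:E)%E by [].
rewrite fubini_tonelli1/=; last 2 first.
- apply/measurable_EFinP/measurable_funM; first exact: measurableT_comp mg measurable_fst.
  exact: measurableT_comp mg measurable_snd.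
- by move=> p; rewrite lee_fin mulr_ge0 ?expR_ge0.
rewrite /fubini_F/=.
under eq_integral.
  move=> x _; under eq_integral do rewrite EFinM.
  rewrite ge0_integralZl//; last exact/measurable_EFinP.
  rewrite hI; over.
rewrite ge0_integralZr//; first by rewrite hI EFinM.
- exact/measurable_EFinP.
- by rewrite -hI; apply: integral_ge0 => x _; rewrite lee_fin expR_ge0.
Qed.

End LebesgueInvariance.

(** * Integration against a measure with a density *)

Section DensityIntegral.
Local Open Scope ereal_scope.
Context d (T : measurableType d) (R : realType).
Variables (m nu : {measure set T -> \bar R}) (g : T -> R).
Hypotheses (mg : measurable_fun setT g) (g0 : forall x, (0 <= g x)%R).
Hypothesis nuE : forall A, measurable A -> nu A = \int[m]_(x in A) (g x)%:E.

Import HBNNSimple.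

Let integral_density_nnsfun (f : {nnsfun T >-> R}) :
  \int[nu]_x (f x)%:E = \int[m]_x ((f x)%:E * (g x)%:E).
Proof.
under [LHS]eq_integral do rewrite fimfunE -fsumEFin//.
rewrite [LHS]ge0_integral_fsum//; last 2 first.
- by move=> r; exact/measurable_EFinP/measurableT_comp.
- by move=> r x _; rewrite EFinM nnfun_muleindic_ge0.
under [RHS]eq_integral.
  move=> x xD; rewrite muleC fimfunE -fsumEFin// ge0_mule_fsumr; last first.
    by move=> r; rewrite EFinM nnfun_muleindic_ge0.
  over.
rewrite [RHS]ge0_integral_fsum//; last 2 first.
- by move=> r; apply: emeasurable_funM; apply/measurable_EFinP => //; apply/measurableT_comp.
- by move=> r x _; apply: mule_ge0; [rewrite lee_fin|rewrite EFinM nnfun_muleindic_ge0].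
apply: eq_fsbigr => r _.
have mA : measurable (f @^-1` [set r]) by [].
under [RHS]eq_integral do rewrite EFinM muleCA.
have [r0|r0] := ltP r 0%R.
  rewrite preimage_nnfun0// indic0 [RHS]integral0_eq => [|x _]; last by rewrite !mule0.
  by rewrite integral0_eq// => x _; rewrite mulr0.
rewrite ge0_integralZl//; last 2 first.
- apply: emeasurable_funM; apply/measurable_EFinP => //.
- by move=> x _; rewrite mule_ge0 ?lee_fin.
under [LHS]eq_integral do rewrite EFinM.
rewrite ge0_integralZl//; last exact/measurable_EFinP.
congr (_ * _); rewrite integral_indic// setIT; apply: (etrans (nuE mA)).
rewrite integral_mkcond; apply: eq_integral => x _.
by rewrite patchE indicE; case: (x \in _); rewrite ?mule1 ?mule0.
Qed.

Lemma ge0_integral_density (f : T -> \bar R) : measurable_fun setT f -> (forall x, 0 <= f x) ->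
  \int[nu]_x f x = \int[m]_x (f x * (g x)%:E).
Proof.
move=> mf f0.
pose f_ := nnsfun_approx measurableT mf.
have gm : measurable_fun setT (EFin \o g) by exact/measurable_EFinP.
transitivity (lim (\int[nu]_x (f_ n x)%:E @[n --> \oo])).
  rewrite -monotone_convergence//=.
  - apply: eq_integral => ? /[!inE] xD; apply/esym/cvg_lim => //=.
    exact: cvg_nnsfun_approx.
  - by move=> n; exact/measurable_EFinP/measurable_funTS.
  - by move=> n ? _; rewrite lee_fin.
  - by move=> ? _ ? ? mn; rewrite lee_fin; exact/lefP/nd_nnsfun_approx.
transitivity (lim (\int[m]_x ((f_ n x)%:E * (g x)%:E) @[n --> \oo])).
  by apply: congr_lim; apply/funext => n /=; exact: integral_density_nnsfun.
rewrite -monotone_convergence//=.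
- apply: eq_integral => x _; apply/cvg_lim => //=.
  by apply: cvgeZr => //; exact: cvg_nnsfun_approx.
- by move=> n; apply: emeasurable_funM => //; exact/measurable_EFinP/measurable_funTS.
- by move=> n x _; rewrite mule_ge0 ?lee_fin.
- move=> x _ k l kl; rewrite lee_wpmul2r ?lee_fin//; exact/lefP/nd_nnsfun_approx.
Qed.

Lemma integral_density (f : T -> R) : measurable_fun setT f ->
  \int[nu]_x (f x)%:E = \int[m]_x (f x * g x)%:E.
Proof.
move=> mf; have mF : measurable_fun setT (EFin \o f) by exact/measurable_EFinP.
rewrite integralE [RHS]integralE !ge0_integral_density//; last 2 first.
- exact: measurable_funeneg.
- exact: measurable_funepos.
congr (_ - _); apply: eq_integral => x _.
  by rewrite !funeposE EFinM maxe_pMl ?lee_fin// mul0e.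
by rewrite !funenegE EFinM -mulNe maxe_pMl ?lee_fin// mul0e.
Qed.

End DensityIntegral.

(** * Lebesgue and Gauss measures on C^n *)

Section ComplexSpaceMeasure.
Variables (R : realType) (n : nat).
Local Notation Cn := 'rV[R[i]]_n.
Local Notation V := (@lebesgueCn R n).
Local Notation mu := (@gauss R n).
Local Notation R' := (measurableTypeR R).
Implicit Types (z w : Cn) (c : R).

Lemma measurable_to_Cn d (X : measurableType d) (phi : X -> Cn) :
  (forall k, measurable_fun setT (fun x => complex.Re (phi x ord0 k) : R') /\
    measurable_fun setT (fun x => complex.Im (phi x ord0 k) : R')) ->
  measurable_fun setT phi.
Proof.
move=> h; have m : measurable_fun setT (fun x => to_pairs (phi x)).
  apply/measurable_fun_tnthP => k.
  rewrite (_ : _ \o _ = (fun x => ((complex.Re (phi x ord0 k) : R'), (complex.Im (phi x ord0 k) : R')))).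
    by apply: measurable_fun_pair; [exact: (h k).1|exact: (h k).2].
  by apply/funext => x /=; rewrite tnth_mktuple.
rewrite (_ : phi = @of_pairs R n \o (fun x => to_pairs (phi x))).
  by apply: measurableT_comp => //; exact: measurable_of_pairs.
by apply/funext => x /=; rewrite to_pairsK.
Qed.

Lemma measure_preserving_Cn (phi : Cn -> Cn) (psi : 'I_n -> R' * R' -> R' * R') :
  (forall k, measure_preserving (@lebesgue2 R) (psi k)) ->
  (forall t, phi (of_pairs t) = of_pairs (tuple_map psi t)) -> measure_preserving V phi.
Proof.
move=> hpsi E; have [mp hp] := measure_preserving_tuple hpsi; split.
  rewrite (_ : phi = @of_pairs R n \o (tuple_map psi \o @to_pairs R n)).
    apply: measurableT_comp; first exact: measurable_of_pairs.
    by apply: measurableT_comp => //; exact: measurable_to_pairs.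
  by apply/funext => z /=; rewrite -E to_pairsK.
move=> A mA; rewrite /= /lebesgueCn /pushforward -[RHS]hp; last first.
  by rewrite -[X in measurable X]setTI; exact: measurable_of_pairs.
by congr (_ _); apply/seteqP; split => t /=; rewrite E.
Qed.

Lemma lebesgueCn_translate (p : Cn) : measure_preserving V (fun z => z + p).
Proof.
apply: (measure_preserving_Cn (psi := fun k (x : R' * R') =>
  (x.1 + complex.Re (p ord0 k) : R', x.2 + complex.Im (p ord0 k) : R'))).
  by move=> k; exact: lebesgue2_translate.
move=> t; apply/rowP => k; rewrite !mxE tnth_mktuple /=.
by case: (p ord0 k).
Qed.

Lemma lebesgueCn_rotate (u : R[i]) : normc u = 1 -> measure_preserving V (fun z => u *: z).
Proof.
move=> u1; apply: (measure_preserving_Cn (psi := fun k (x : R' * R') =>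
  (complex.Re u * x.1 - complex.Im u * x.2 : R', complex.Im u * x.1 + complex.Re u * x.2 : R'))).
  by move=> k; apply: lebesgue2_rotate_unit; rewrite -normc_sqr u1 expr1n.
move=> t; apply/rowP => k; rewrite !mxE tnth_mktuple /=.
by case: u u1 => a b _ /=; congr Complex; rewrite addrC.
Qed.

Lemma sqnormC_rotate (u : R[i]) z : normc u = 1 -> sqnormC (u *: z) = sqnormC z.
Proof.
move=> u1; rewrite !sqnormCE; apply: eq_bigr => k _.
by rewrite -!normc_sqr mxE ComplexField.Normc.normcM u1 mul1r.
Qed.

Lemma integral_lebesgueCn_gauss c I :
  (\int[lebesgue_measure]_(x in [set: R']) (expR (- c * x ^+ 2))%:E = I%:E)%E ->
  (\int[V]_z (expR (- c * sqnormC z))%:E = ((I * I) ^+ n)%:E)%E.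
Proof.
move=> hI; rewrite ge0_integral_pushforward//; last 2 first.
- exact: measurable_of_pairs.
- apply/measurable_EFinP; apply: measurableT_comp => //.
  by apply: measurable_funM => //; exact: measurable_sqnormC.
rewrite preimage_setT -(tuple_integral_prod n _ _ (lebesgue2_gauss hI)).
- apply: eq_integral => t _ /=; rewrite sqnormCE mulr_sumr expR_sum; congr EFin.
  by apply: eq_bigr => k _; rewrite mxE.
- apply: measurableT_comp => //; apply: measurable_funM => //.
  by apply: measurable_funD; apply: measurable_funX.
- by move=> x; exact: expR_ge0.
Qed.

Lemma gauss_setT : mu setT = 1%E.
Proof.
have h : (\int[lebesgue_measure]_(x in [set: R']) (expR (- 1 * x ^+ 2))%:E = (Num.sqrt pi)%:E)%E.
  by rewrite -integralT_gauss; apply: eq_integral => x _; rewrite mulN1r.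
rewrite /= /gauss /gauss_density.
under eq_integral do rewrite EFinM -mulN1r.
rewrite ge0_integralZl//; last 2 first.
- apply/measurable_EFinP; apply: measurableT_comp => //.
  by apply: measurable_funM => //; exact: measurable_sqnormC.
- by rewrite lee_fin invr_ge0 exprn_ge0// pi_ge0.
rewrite (integral_lebesgueCn_gauss h) -EFinM -expr2 sqr_sqrtr ?pi_ge0// mulVf//.
by rewrite expf_neq0// gt_eqF// pi_gt0.
Qed.

HB.instance Definition _ := Measure_isProbability.Build _ _ _ (@gauss R n) gauss_setT.

Lemma ge0_integral_gauss (f : Cn -> \bar R) : measurable_fun setT f -> (forall z, 0 <= f z)%E ->
  (\int[mu]_z f z = \int[V]_z (f z * (gauss_density z)%:E))%E.
Proof.
apply: ge0_integral_density => //; [exact: measurable_gauss_density|exact: gauss_density_ge0].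
Qed.

Lemma integral_gauss (f : Cn -> R) : measurable_fun setT f ->
  (\int[mu]_z (f z)%:E = \int[V]_z (f z * gauss_density z)%:E)%E.
Proof.
apply: integral_density => //; [exact: measurable_gauss_density|exact: gauss_density_ge0].
Qed.

(** The usual dominating function against [mu]: the density leaves [e^(-(1 - c)|z|^2)], which is
    integrable for Lebesgue measure. *)
Lemma integrable_gauss_exp c : c < 1 -> mu.-integrable setT (fun z => (expR (c * sqnormC z))%:E).
Proof.
move=> c1; have me : measurable_fun setT (fun z : Cn => expR (c * sqnormC z)).
  by apply: measurableT_comp => //; apply: measurable_funM => //; exact: measurable_sqnormC.
apply/integrableP; split; first exact/measurable_EFinP.
under eq_integral do rewrite /= ger0_norm ?expR_ge0//.
rewrite ge0_integral_gauss; last 2 first.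
- exact/measurable_EFinP.
- by move=> z; rewrite lee_fin expR_ge0.
have c0 : 0 < 1 - c by rewrite subr_gt0.
have [I hI] := integral_gauss_scale c0.
have E z : ((expR (c * sqnormC z))%:E * (gauss_density z)%:E =
    ((pi ^+ n)^-1)%:E * (expR (- (1 - c) * sqnormC z))%:E)%E.
  rewrite -!EFinM /gauss_density mulrCA -expRD; congr (_ * expR _)%:E; ring.
under eq_integral do rewrite E.
rewrite ge0_integralZl//; last 2 first.
- apply/measurable_EFinP; apply: measurableT_comp => //.
  by apply: measurable_funM => //; exact: measurable_sqnormC.
- by rewrite lee_fin invr_ge0 exprn_ge0// pi_ge0.
by rewrite (integral_lebesgueCn_gauss hI) -EFinM ltry.
Qed.

Lemma gauss_rotate (u : R[i]) : normc u = 1 -> measure_preserving mu (fun z => u *: z).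
Proof.
move=> u1; have [m h] := lebesgueCn_rotate u1; split => // A mA.
have mE B : measurable B -> mu B = (\int[V]_z (((\1_B z) : R)%:E * (gauss_density z)%:E))%E.
  move=> mB; rewrite -ge0_integral_gauss.
  - by rewrite integral_indic// setIT.
  - by apply/measurable_EFinP; exact: measurable_indic.
  - by move=> z; rewrite lee_fin.
have mB : measurable ((fun z => u *: z) @^-1` A) by rewrite -[X in measurable X]setTI; exact: m.
apply: (etrans (mE _ mB)); apply: (etrans _ (esym (mE _ mA))).
rewrite -[RHS](ge0_measure_preserving_integral (lebesgueCn_rotate u1)).
- by apply: eq_integral => z _; rewrite /gauss_density sqnormC_rotate.
- apply: emeasurable_funM; apply/measurable_EFinP; first exact: measurable_indic.
  exact: measurable_gauss_density.
- by move=> z; rewrite mule_ge0 ?lee_fin// gauss_density_ge0.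
Qed.

Lemma ae_lebesgueCn_gauss (P : Cn -> Prop) : {ae V, forall z, P z} -> {ae mu, forall z, P z}.
Proof.
move=> [A [mA A0 PA]]; exists A; split => //.
rewrite /= /gauss; apply: null_set_integral => //.
by apply/measurable_funTS/measurable_EFinP; exact: measurable_gauss_density.
Qed.

Lemma gauss_density_gt0 z : 0 < gauss_density z.
Proof. by rewrite mulr_gt0 ?expR_gt0// invr_gt0 exprn_gt0// pi_gt0. Qed.

(** The density is positive everywhere, so it cannot integrate to zero over a set of positive
    Lebesgue measure. This brings the result of the uniqueness argument, which works with [mu], back
    to Lebesgue measure. *)
Lemma ae_gauss_lebesgueCn (P : Cn -> Prop) : {ae mu, forall z, P z} -> {ae V, forall z, P z}.
Proof.
move=> [A [mA A0 PA]]; exists A; split => //.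
have mg : measurable_fun A (fun z => (gauss_density z)%:E).
  by apply/measurable_funTS/measurable_EFinP; exact: measurable_gauss_density.
have : (\int[V]_(z in A) `|(gauss_density z)%:E| = 0)%E.
  rewrite -[RHS]A0; apply: eq_integral => z _.
  by rewrite gee0_abs// lee_fin gauss_density_ge0.
move/(ae_eq_integral_abs V mA mg) => [B [mB B0 AB]].
apply/eqP; rewrite eq_le measure_ge0 andbT -B0 le_measure ?inE// => z Az.
apply: AB => /= /(_ Az)[] /eqP; apply/negP; by rewrite gt_eqF// gauss_density_gt0.
Qed.

(** Positive measure of small boxes lets an essential bound be used at points arbitrarily close to a
    given one. *)
Lemma lebesgueCn_box_gt0 z (r : R) : 0 < r ->
  (0 < V [set w | forall k, `|complex.Re (w ord0 k - z ord0 k)| < r /\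
    `|complex.Im (w ord0 k - z ord0 k)| < r]%R)%E.
Proof.
move=> r0; rewrite /lebesgueCn /pushforward.
pose B k : set (R' * R') := `](complex.Re (z ord0 k) - r), (complex.Re (z ord0 k) + r)[%classic `*`
  `](complex.Im (z ord0 k) - r), (complex.Im (z ord0 k) + r)[%classic.
have -> : @of_pairs R n @^-1` [set w | forall k, `|complex.Re (w ord0 k - z ord0 k)| < r /\
    `|complex.Im (w ord0 k - z ord0 k)| < r]%R = [set t | forall k, B k (tnth t k)].
  by apply/seteqP; split => t h k; have := h k; rewrite /B /= mxE cReD cReN cImD cImN/=
    !in_itv/= -!ltr_distl.
apply: tuple_measure_box_gt0 => k; first exact: measurableX.
rewrite /= /lebesgue2 product_measure1E//= !lebesgue_measure_itv/= !lte_fin !ltrBlDr -!addrA.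
by rewrite !ltrDl addr_gt0// -!EFinB mule_gt0// lte_fin; lra.
Qed.

End ComplexSpaceMeasure.

(** * Complex-valued integrals *)

Section ComplexMeasurable.
Context d (X : measurableType d) (R : realType).
Implicit Types (F G : X -> R[i]).

(** [cmeasurable] over any measurable space, in particular over [Cn * Cn] for Fubini's theorem. *)
Definition cmeas F := measurable_fun setT (fun x => complex.Re (F x)) /\
  measurable_fun setT (fun x => complex.Im (F x)).

Lemma cmeas_ext F G : F =1 G -> cmeas F -> cmeas G.
Proof. by move=> /funext ->. Qed.

Lemma cmeas_cst (c : R[i]) : cmeas (fun=> c).
Proof. by split; exact: measurable_cst. Qed.

Lemma cmeasD F G : cmeas F -> cmeas G -> cmeas (fun x => F x + G x).
Proof.
move=> [Fr Fi] [Gr Gi]; split.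
  by under eq_fun do rewrite cReD; exact: measurable_funD.
by under eq_fun do rewrite cImD; exact: measurable_funD.
Qed.

Lemma cmeasM F G : cmeas F -> cmeas G -> cmeas (fun x => F x * G x).
Proof.
move=> [Fr Fi] [Gr Gi]; split.
  by under eq_fun do rewrite cReM; apply: measurable_funB; exact: measurable_funM.
by under eq_fun do rewrite cImM; apply: measurable_funD; exact: measurable_funM.
Qed.

Lemma cmeasN F : cmeas F -> cmeas (fun x => - F x).
Proof.
move=> h; apply: (cmeas_ext (F := fun x => (-1) * F x)) => [x|]; first by rewrite mulN1r.
by apply: cmeasM => //; exact: cmeas_cst.
Qed.

Lemma cmeasB F G : cmeas F -> cmeas G -> cmeas (fun x => F x - G x).
Proof. by move=> hF hG; apply: cmeasD => //; exact: cmeasN. Qed.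

Lemma cmeas_conj F : cmeas F -> cmeas (fun x => (F x)^*).
Proof.
move=> [Fr Fi]; split.
  by under eq_fun do rewrite cRe_conj.
by under eq_fun do rewrite cIm_conj; exact: measurableT_comp.
Qed.

Lemma cmeas_sum (I : Type) (r : seq I) (P : pred I) (F : I -> X -> R[i]) :
  (forall i, cmeas (F i)) -> cmeas (fun x => \sum_(i <- r | P i) F i x).
Proof.
move=> h; elim: r => [|i r IH].
  by apply: cmeas_ext (cmeas_cst 0) => x; rewrite big_nil.
have [Pi|Pi] := boolP (P i).
  by apply: cmeas_ext (cmeasD (h i) IH) => x; rewrite big_cons Pi.
by apply: cmeas_ext IH => x; rewrite big_cons (negbTE Pi).
Qed.

Lemma cmeas_prod (I : Type) (r : seq I) (P : pred I) (F : I -> X -> R[i]) :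
  (forall i, cmeas (F i)) -> cmeas (fun x => \prod_(i <- r | P i) F i x).
Proof.
move=> h; elim: r => [|i r IH].
  by apply: cmeas_ext (cmeas_cst 1) => x; rewrite big_nil.
have [Pi|Pi] := boolP (P i).
  by apply: cmeas_ext (cmeasM (h i) IH) => x; rewrite big_cons Pi.
by apply: cmeas_ext IH => x; rewrite big_cons (negbTE Pi).
Qed.

Lemma cmeasX F k : cmeas F -> cmeas (fun x => F x ^+ k).
Proof.
move=> h; elim: k => [|k IH]; first exact: cmeas_cst.
by apply: cmeas_ext (cmeasM h IH) => x; rewrite exprS.
Qed.

Lemma cmeas_cexp F : cmeas F -> cmeas (fun x => cexp (F x)).
Proof.
move=> [Fr Fi].
have me : measurable_fun setT (fun x => expR (complex.Re (F x))) by exact: measurableT_comp.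
have mc : measurable_fun setT (fun x => cos (complex.Im (F x))).
  by apply: measurableT_comp => //; apply: continuous_measurable_fun; exact: continuous_cos.
have ms : measurable_fun setT (fun x => sin (complex.Im (F x))).
  by apply: measurableT_comp => //; apply: continuous_measurable_fun; exact: continuous_sin.
split.
  rewrite (_ : (fun x => _) = (fun x => expR (complex.Re (F x)) * cos (complex.Im (F x)))).
    exact: measurable_funM.
  by apply/funext => x; rewrite /cexp cReM/= mul0r subr0.
rewrite (_ : (fun x => _) = (fun x => expR (complex.Re (F x)) * sin (complex.Im (F x)))).
  exact: measurable_funM.
by apply/funext => x; rewrite /cexp cImM/= mul0r addr0.
Qed.

Lemma measurable_normc F : cmeas F -> measurable_fun setT (fun x => normc (F x)).
Proof.
move=> [Fr Fi].
rewrite (_ : (fun x => _) = (fun x => Num.sqrt (complex.Re (F x) ^+ 2 + complex.Im (F x) ^+ 2))).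
  apply: measurableT_comp; first by apply: continuous_measurable_fun; exact: sqrt_continuous.
  by apply: measurable_funD; exact: measurable_funX.
by apply/funext => x; case: (F x).
Qed.

End ComplexMeasurable.

Lemma cmeas_comp d d' (X : measurableType d) (Y : measurableType d') (R : realType)
  (F : Y -> R[i]) (phi : X -> Y) : cmeas F -> measurable_fun setT phi ->
  cmeas (fun x => F (phi x)).
Proof.
move=> [Fr Fi] mphi; split; [exact: measurableT_comp Fr mphi|exact: measurableT_comp Fi mphi].
Qed.

Section ComplexIntegral.
Context d (X : measurableType d) (R : realType) (m : {measure set X -> \bar R}).
Implicit Types (F G : X -> R[i]) (c : R[i]).

(** For [m = mu] this is convertible to [gauss_integral], which [toeplitzE] relies on. *)
Definition cint F : R[i] :=
  Rintegral m setT (fun x => complex.Re (F x)) +i* Rintegral m setT (fun x => complex.Im (F x)).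

Definition cintegrable F :=
  m.-integrable setT (fun x => (complex.Re (F x))%:E) /\
  m.-integrable setT (fun x => (complex.Im (F x))%:E).

Lemma cintegrable_cmeas F : cintegrable F -> cmeas F.
Proof. by move=> [/measurable_int/measurable_EFinP ? /measurable_int/measurable_EFinP ?]. Qed.

Lemma eq_cint F G : F =1 G -> cint F = cint G.
Proof. by move=> /funext ->. Qed.

Lemma eq_cintegrable F G : F =1 G -> cintegrable F -> cintegrable G.
Proof. by move=> /funext ->. Qed.

Lemma cintegrableD F G : cintegrable F -> cintegrable G -> cintegrable (fun x => F x + G x).
Proof.
move=> [Fr Fi] [Gr Gi]; split.
  by under eq_fun do rewrite cReD EFinD; exact: integrableD.
by under eq_fun do rewrite cImD EFinD; exact: integrableD.
Qed.

Lemma cintD F G : cintegrable F -> cintegrable G -> cint (fun x => F x + G x) = cint F + cint G.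
Proof.
move=> [Fr Fi] [Gr Gi]; apply: complexP.
  by rewrite cReD/= -RintegralD//; apply: eq_Rintegral => x _; rewrite cReD.
by rewrite cImD/= -RintegralD//; apply: eq_Rintegral => x _; rewrite cImD.
Qed.

Lemma cintegrableZ c F : cintegrable F -> cintegrable (fun x => c * F x).
Proof.
move=> [Fr Fi]; split.
  under eq_fun do rewrite cReM EFinB !EFinM.
  by apply: integrableB => //; exact: integrableZl.
under eq_fun do rewrite cImM EFinD !EFinM.
by apply: integrableD => //; exact: integrableZl.
Qed.

Lemma cintZ c F : cintegrable F -> cint (fun x => c * F x) = c * cint F.
Proof.
move=> [Fr Fi].
have iZ (a : R) (g : X -> R) : m.-integrable setT (fun x => (g x)%:E) ->
    m.-integrable setT (fun x => (a * g x)%:E).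
  by move=> ig; under eq_fun do rewrite EFinM; exact: integrableZl.
apply: complexP.
  rewrite cReM/= -!RintegralZl// -RintegralB//; [|exact: iZ|exact: iZ].
  by apply: eq_Rintegral => x _; rewrite cReM.
rewrite cImM/= -!RintegralZl// -RintegralD//; [|exact: iZ|exact: iZ].
by apply: eq_Rintegral => x _; rewrite cImM.
Qed.

Lemma cintegrableB F G : cintegrable F -> cintegrable G -> cintegrable (fun x => F x - G x).
Proof.
move=> iF iG; apply: (eq_cintegrable _ (cintegrableD iF (cintegrableZ (-1) iG))) => x.
by rewrite mulN1r.
Qed.

Lemma cintB F G : cintegrable F -> cintegrable G -> cint (fun x => F x - G x) = cint F - cint G.
Proof.
move=> iF iG; rewrite -mulN1r -cintZ// -cintD//; last exact: cintegrableZ.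
by apply: eq_cint => x; rewrite mulN1r.
Qed.

Lemma cintegrable0 : cintegrable (fun=> 0).
Proof. by split; exact: integrable0. Qed.

Lemma cint0 : cint (fun=> 0) = 0.
Proof. by rewrite /cint /= /Rintegral !integral0. Qed.

Lemma cintegrable_sum (I : Type) (r : seq I) (P : pred I) (F : I -> X -> R[i]) :
  (forall i, cintegrable (F i)) -> cintegrable (fun x => \sum_(i <- r | P i) F i x).
Proof.
move=> h; elim: r => [|i r IH].
  by apply: eq_cintegrable cintegrable0 => x; rewrite big_nil.
have [Pi|Pi] := boolP (P i).
  by apply: eq_cintegrable (cintegrableD (h i) IH) => x; rewrite big_cons Pi.
by apply: eq_cintegrable IH => x; rewrite big_cons (negbTE Pi).
Qed.

Lemma cint_sum (I : Type) (r : seq I) (P : pred I) (F : I -> X -> R[i]) :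
  (forall i, cintegrable (F i)) ->
  cint (fun x => \sum_(i <- r | P i) F i x) = \sum_(i <- r | P i) cint (F i).
Proof.
move=> h; elim: r => [|i r IH].
  by rewrite big_nil -[RHS]cint0; apply: eq_cint => x; rewrite big_nil.
rewrite big_cons -IH; case: ifP => Pi.
  rewrite -cintD//; last exact: cintegrable_sum.
  by apply: eq_cint => x; rewrite big_cons Pi.
by apply: eq_cint => x; rewrite big_cons Pi.
Qed.

Lemma cint_conj F : cintegrable F -> cint (fun x => (F x)^*) = (cint F)^*.
Proof.
move=> [Fr Fi]; apply: complexP; rewrite ?cRe_conj ?cIm_conj/=.
  by apply: eq_Rintegral => x _; rewrite cRe_conj.
rewrite -mulN1r -RintegralZl//; apply: eq_Rintegral => x _.
by rewrite cIm_conj mulN1r.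
Qed.

Lemma cintegrable_le F (G : X -> R) : cmeas F -> m.-integrable setT (EFin \o G) ->
  (forall x, normc (F x) <= G x) -> cintegrable F.
Proof.
move=> [Fr Fi] iG FG; split; apply: le_integrable iG => //; try exact/measurable_EFinP.
  by move=> x _ /=; rewrite lee_fin (le_trans (normr_Re_le _))// (le_trans (FG _))// ler_norm.
by move=> x _ /=; rewrite lee_fin (le_trans (normr_Im_le _))// (le_trans (FG _))// ler_norm.
Qed.

(** Estimating the parts separately loses a factor 2, harmless in all uses, and avoids the rotation
    of the integral onto the real axis. *)
Lemma normc_cint_le F (G : X -> R) : cmeas F -> m.-integrable setT (EFin \o G) ->
  (forall x, normc (F x) <= G x) -> normc (cint F) <= Rintegral m setT G *+ 2.
Proof.
move=> mF iG FG; have [Fr Fi] := cintegrable_le mF iG FG.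
apply: le_trans (normc_le_ReIm _) _; rewrite mulr2n /cint /=; apply: lerD.
  apply: le_trans (le_normr_Rintegral _ _) _ => //; apply: le_Rintegral => //.
    exact: (integrable_norm Fr).
  by move=> x _; rewrite (le_trans (normr_Re_le _)).
apply: le_trans (le_normr_Rintegral _ _) _ => //; apply: le_Rintegral => //.
  exact: (integrable_norm Fi).
by move=> x _; rewrite (le_trans (normr_Im_le _)).
Qed.

Lemma ae_eq_cint F G : cmeas F -> cmeas G -> {ae m, forall x, F x = G x} -> cint F = cint G.
Proof.
move=> [Fr Fi] [Gr Gi] FG; congr Complex; congr fine; apply: ae_eq_integral => //;
  try exact/measurable_EFinP; by apply: filterS FG => x -> _.
Qed.

Lemma measure_preserving_cint phi F : measure_preserving m phi -> cmeas F ->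
  cint (fun x => F (phi x)) = cint F.
Proof.
move=> hphi [Fr Fi]; congr Complex; congr fine.
  by apply: (measure_preserving_integral hphi (f := fun x => (complex.Re (F x))%:E)); exact/measurable_EFinP.
by apply: (measure_preserving_integral hphi (f := fun x => (complex.Im (F x))%:E)); exact/measurable_EFinP.
Qed.

(** Dominated convergence for identities: it carries the orthogonality relations, with [r = 0], and
    the rotation invariance of Gaussian means to the limit. *)
Lemma dominated_Rintegral_cst (f_ : nat -> X -> R) (f g : X -> R) (r : R) :
  (forall N, measurable_fun setT (f_ N)) -> measurable_fun setT f ->
  m.-integrable setT (EFin \o g) -> (forall N x, `|f_ N x| <= g x) ->
  (forall x, f_ N x @[N --> \oo] --> f x) ->
  (forall N, Rintegral m setT (f_ N) = r) -> Rintegral m setT f = r.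
Proof.
move=> mf_ mf ig fg ff fr.
have [] := @dominated_convergence _ _ _ m setT measurableT (fun N x => (f_ N x)%:E) (fun x => (f x)%:E) (EFin \o g).
- by move=> N; exact/measurable_EFinP.
- exact/measurable_EFinP.
- by apply: aeW => x _; apply: cvg_EFin; [exact: nearW|exact: ff].
- by [].
- by apply: aeW => x N _; rewrite /= lee_fin.
move=> intf _ h; have E N : (\int[m]_x (f_ N x)%:E = r%:E)%E.
  rewrite -(fr N) /Rintegral fineK// integrable_fin_num//.
  apply: le_integrable ig => //; first exact/measurable_EFinP.
  by move=> x _ /=; rewrite lee_fin (le_trans (fg N x))// ler_norm.
rewrite /Rintegral -[r]/(fine r%:E); congr fine.
have h2 : (fun N => \int[m]_x (f_ N x)%:E)%E @ \oo --> (\int[m]_x (f x)%:E)%E by exact: h.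
by apply: (cvg_unique _ h2) => //; rewrite (funext E); exact: cvg_cst.
Qed.

Lemma dominated_cint_cst (F_ : nat -> X -> R[i]) F (g : X -> R) c :
  (forall N, cmeas (F_ N)) -> cmeas F -> m.-integrable setT (EFin \o g) ->
  (forall N x, normc (F_ N x) <= g x) ->
  (forall x, normc (F_ N x - F x) @[N --> \oo] --> (0 : R)) ->
  (forall N, cint (F_ N) = c) -> cint F = c.
Proof.
move=> mF_ [Fr Fi] ig Fg FF Fc; apply: complexP => /=.
  apply: (dominated_Rintegral_cst (f_ := fun N x => complex.Re (F_ N x)) (g := g)) => //.
  - by move=> N; have [] := mF_ N.
  - by move=> N x; rewrite (le_trans (normr_Re_le _)).
  - move=> x; apply/subr_cvg0/norm_cvg0P; apply: squeeze_cvgr (cvg_cst _) (FF x).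
    by apply: nearW => N; rewrite normr_ge0/= -cReN -cReD normr_Re_le.
  - by move=> N; rewrite -(Fc N).
apply: (dominated_Rintegral_cst (f_ := fun N x => complex.Im (F_ N x)) (g := g)) => //.
- by move=> N; have [] := mF_ N.
- by move=> N x; rewrite (le_trans (normr_Im_le _)).
- move=> x; apply/subr_cvg0/norm_cvg0P; apply: squeeze_cvgr (cvg_cst _) (FF x).
  by apply: nearW => N; rewrite normr_ge0/= -cImN -cImD normr_Im_le.
- by move=> N; rewrite -(Fc N).
Qed.

End ComplexIntegral.

(** * Fubini's theorem for complex-valued functions *)

Section ComplexFubini.
Context d1 d2 (X : measurableType d1) (Y : measurableType d2) (R : realType).
Variables (m1 : {sigma_finite_measure set X -> \bar R}) (m2 : {sigma_finite_measure set Y -> \bar R}).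
Variable F : X * Y -> R[i].
Hypothesis iF : cintegrable (m1 \x m2)%E F.
Hypothesis iF1 : forall x, cintegrable m2 (fun y => F (x, y)).
Hypothesis iF2 : forall y, cintegrable m1 (fun x => F (x, y)).

Lemma cmeas_cint1 : cmeas (fun x => cint m2 (fun y => F (x, y))).
Proof.
have [Fr Fi] := iF; split => /=; apply: measurableT_comp => //.
  exact: (measurable_fubini_F Fr).
exact: (measurable_fubini_F Fi).
Qed.

(** Every section is assumed integrable, so that the real and the extended inner integrals agree at
    each point. *)
Lemma cint_fubini : cint m1 (fun x => cint m2 (fun y => F (x, y))) =
  cint m2 (fun y => cint m1 (fun x => F (x, y))).
Proof.
have [Fr Fi] := iF; congr Complex; congr fine => /=.
  rewrite (eq_integral (fun x => \int[m2]_y (complex.Re (F (x, y)))%:E)%E); last first.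
    by move=> x _; rewrite /Rintegral fineK// integrable_fin_num//; exact: (iF1 x).1.
  rewrite [RHS](eq_integral (fun y => \int[m1]_x (complex.Re (F (x, y)))%:E)%E); last first.
    by move=> y _; rewrite /Rintegral fineK// integrable_fin_num//; exact: (iF2 y).1.
  exact: (Fubini Fr).
rewrite (eq_integral (fun x => \int[m2]_y (complex.Im (F (x, y)))%:E)%E); last first.
  by move=> x _; rewrite /Rintegral fineK// integrable_fin_num//; exact: (iF1 x).2.
rewrite [RHS](eq_integral (fun y => \int[m1]_x (complex.Im (F (x, y)))%:E)%E); last first.
  by move=> y _; rewrite /Rintegral fineK// integrable_fin_num//; exact: (iF2 y).2.
exact: (Fubini Fi).
Qed.

End ComplexFubini.

(** * Functions orthogonal to the kernels vanish *)

Section Uniqueness.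
Variables (R : realType) (n : nat).
Local Notation Cn := 'rV[R[i]]_n.
Local Notation mu := (@gauss R n).
Local Notation R' := (measurableTypeR R).
Implicit Types (w a b : Cn) (c : R) (p q : Cn -> R).

(** The Euclidean inner product of C^n seen as a real space of dimension 2n. As [a] varies all real
    linear forms occur, among them the parts of the coordinates. *)
Definition real_lin a w : R := complex.Re (dotC w (conjv a)).

Lemma real_linD a b w : real_lin (a + b) w = real_lin a w + real_lin b w.
Proof.
rewrite /real_lin /dotC -cReD -big_split/=; congr complex.Re; apply: eq_bigr => k _.
by rewrite !mxE rmorphD mulrDr.
Qed.

Lemma real_linN a w : real_lin (- a) w = - real_lin a w.
Proof.
rewrite /real_lin /dotC -cReN -sumrN; congr complex.Re; apply: eq_bigr => k _.
by rewrite !mxE rmorphN mulrN.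
Qed.

Lemma real_linB a b w : real_lin (a - b) w = real_lin a w - real_lin b w.
Proof. by rewrite real_linD real_linN. Qed.

Lemma real_linZ c a w : real_lin (c%:C *: a) w = c * real_lin a w.
Proof.
rewrite /real_lin /dotC.
transitivity (complex.Re (c%:C * \sum_k w ord0 k * conjv a ord0 k)).
  congr complex.Re; rewrite mulr_sumr; apply: eq_bigr => k _.
  by rewrite !mxE rmorphM /= conj_Creal ?complex_real// mulrCA.
by rewrite cReM/= mul0r subr0.
Qed.

Lemma real_lin0 w : real_lin 0 w = 0.
Proof. by rewrite -[0](subrr 0) real_linB subrr. Qed.

Lemma real_lin_Re k w : real_lin (delta_mx ord0 k) w = complex.Re (w ord0 k).
Proof.
rewrite /real_lin /dotC (bigD1 k)//= big1 ?addr0; last first.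
  by move=> j jk; rewrite !mxE eqxx/= (negbTE jk) rmorph0 mulr0.
by rewrite !mxE !eqxx/= rmorph1 mulr1.
Qed.

Lemma real_lin_Im k w : real_lin ('i *: delta_mx ord0 k) w = complex.Im (w ord0 k).
Proof.
rewrite /real_lin /dotC (bigD1 k)//= big1 ?addr0; last first.
  by move=> j jk; rewrite !mxE eqxx/= (negbTE jk) mulr0 rmorph0 mulr0.
by rewrite !mxE !eqxx/= mulr1 cReM/= mulr0 add0r mulrN1 opprK.
Qed.

Lemma cmeas_coord k : cmeas (fun w : Cn => w ord0 k).
Proof. exact: measurable_coord. Qed.

Lemma measurable_real_lin a : measurable_fun setT (real_lin a).
Proof.
have [] // : cmeas (fun w => dotC w (conjv a)).
by apply: cmeas_sum => k; apply: cmeasM; [exact: cmeas_coord|exact: cmeas_cst].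
Qed.

Lemma measurable_cos_lin a c : measurable_fun setT (fun w => cos (real_lin a w + c)).
Proof.
apply: measurableT_comp; first by apply: continuous_measurable_fun; exact: continuous_cos.
by apply: measurable_funD => //; exact: measurable_real_lin.
Qed.

Lemma measurable_sin_lin a c : measurable_fun setT (fun w => sin (real_lin a w + c)).
Proof.
apply: measurableT_comp; first by apply: continuous_measurable_fun; exact: continuous_sin.
by apply: measurable_funD => //; exact: measurable_real_lin.
Qed.

Variable kappa : Cn -> R.
Hypothesis ikappa : mu.-integrable setT (EFin \o kappa).

Let mkappa : measurable_fun setT kappa.
Proof. exact/measurable_EFinP/(measurable_int _ ikappa). Qed.

Let integrable_kappaM q K : measurable_fun setT q -> (forall w, `|q w| <= K) ->
  mu.-integrable setT (fun w => (kappa w * q w)%:E).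
Proof.
move=> mq qK; have iK : mu.-integrable setT (fun w => (K * `|kappa w|)%:E).
  under eq_fun do rewrite EFinM; apply: integrableZl => //; exact: (integrable_norm ikappa).
apply: le_integrable iK => //; first by apply/measurable_EFinP; exact: measurable_funM.
move=> w _ /=; rewrite lee_fin normrM [leRHS]ger0_norm.
  by rewrite mulrC ler_wpM2r.
by rewrite mulr_ge0// (le_trans _ (qK w)).
Qed.

(** Orthogonality to all cosines, with a phase, and not just to the constants makes the class stable
    under multiplication by sines. Boundedness of [p] serves dominated convergence, with a multiple
    of [|kappa|] as dominating function. *)
Definition orthogonal_to_cos p := [/\ measurable_fun setT p, exists K, forall w, `|p w| <= K &
  forall a c, Rintegral mu setT (fun w => kappa w * (p w * cos (real_lin a w + c))) = 0].

Lemma orthogonal_to_cos_int p a c : orthogonal_to_cos p ->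
  mu.-integrable setT (fun w => (kappa w * (p w * cos (real_lin a w + c)))%:E).
Proof.
move=> [mp [K pK] _]; apply: (@integrable_kappaM _ K).
  by apply: measurable_funM => //; exact: measurable_cos_lin.
move=> w; rewrite normrM; apply: le_trans (pK w); rewrite ler_piMr//.
by rewrite ler_norml cos_geN1 cos_le1.
Qed.

Lemma orthogonal_to_cosD p q : orthogonal_to_cos p -> orthogonal_to_cos q ->
  orthogonal_to_cos (fun w => p w + q w).
Proof.
move=> hp hq; have [mp [K pK] p0] := hp; have [mq [L qL] q0] := hq; split.
- exact: measurable_funD.
- by exists (K + L) => w; rewrite (le_trans (ler_normD _ _))// lerD.
- move=> a c; rewrite -[RHS]addr0 -{1}(p0 a c) -(q0 a c) -RintegralD//.
  + by apply: eq_Rintegral => w _; ring.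
  + exact: orthogonal_to_cos_int.
  + exact: orthogonal_to_cos_int.
Qed.

Lemma orthogonal_to_cosZ p (r : R) : orthogonal_to_cos p -> orthogonal_to_cos (fun w => r * p w).
Proof.
move=> hp; have [mp [K pK] p0] := hp; split.
- exact: measurable_funM.
- by exists (`|r| * K) => w; rewrite normrM ler_wpM2l.
- move=> a c; rewrite -[RHS](mulr0 r) -(p0 a c) -RintegralZl//.
    by apply: eq_Rintegral => w _; ring.
  exact: orthogonal_to_cos_int.
Qed.

Lemma orthogonal_to_cos_sum (p_ : nat -> Cn -> R) J : (forall j, orthogonal_to_cos (p_ j)) ->
  orthogonal_to_cos (fun w => \sum_(j < J) p_ j w).
Proof.
move=> h; elim: J => [|J IH].
  have := orthogonal_to_cosZ 0 (h 0%N).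
  by congr orthogonal_to_cos; apply/funext => w; rewrite big_ord0 mul0r.
have := orthogonal_to_cosD IH (h J).
by congr orthogonal_to_cos; apply/funext => w; rewrite big_ord_recr.
Qed.

Lemma orthogonal_to_cos_lim (p_ : nat -> Cn -> R) p K : (forall N, orthogonal_to_cos (p_ N)) ->
  (forall N w, `|p_ N w| <= K) -> (forall w, p_ N w @[N --> \oo] --> p w) -> orthogonal_to_cos p.
Proof.
move=> h pK cvg_p.
have mp : measurable_fun setT p.
  by apply: (measurable_fun_cvg (h := p_)) => // N; have [] := h N.
have K0 : 0 <= K by rewrite (le_trans _ (pK 0%N 0)).
have pK' w : `|p w| <= K.
  have cvg_n : `|p_ N w| @[N --> \oo] --> `|p w| by exact: cvg_norm.
  rewrite -(cvg_lim _ cvg_n)//; apply: limr_le; first by apply/cvg_ex; exists `|p w|.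
  by apply: nearW => N; exact: pK.
split=> //; first by exists K.
move=> a c; pose g w := K * `|kappa w|.
apply: (dominated_Rintegral_cst (f_ := fun N w => kappa w * (p_ N w * cos (real_lin a w + c))) (g := g)).
- move=> N; have [m _ _] := h N; apply: measurable_funM => //; apply: measurable_funM => //.
  exact: measurable_cos_lin.
- by apply: measurable_funM => //; apply: measurable_funM => //; exact: measurable_cos_lin.
- rewrite (_ : _ \o _ = (fun w => K%:E * (`|kappa w|)%:E)%E)//.
  by apply: integrableZl => //; exact: (integrable_norm ikappa).
- move=> N w; rewrite /g !normrM mulrC ler_wpM2r//.
  by apply: le_trans (pK N w); rewrite ler_piMr// ler_norml cos_geN1 cos_le1.
- by move=> w; apply: cvgMr; apply: cvgMl; exact: cvg_p.
- by move=> N; have [_ _ ->] := h N.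
Qed.

(** [2 cos A sin B = cos (A + B - pi / 2) + cos (A - B + pi / 2)]: the phases turn sines into
    cosines. *)
Lemma orthogonal_to_cos_sin p b c : orthogonal_to_cos p ->
  orthogonal_to_cos (fun w => p w * sin (real_lin b w + c)).
Proof.
move=> hp; have [mp [K pK] p0] := hp; split.
- by apply: measurable_funM => //; exact: measurable_sin_lin.
- exists K => w; rewrite normrM; apply: le_trans (pK w); rewrite ler_piMr//.
  by rewrite ler_norml sin_geN1 sin_le1.
- move=> a e.
  have h := orthogonal_to_cosZ 2^-1 hp.
  have i1 := orthogonal_to_cos_int (a + b) (e + c - pi / 2) h.
  have i2 := orthogonal_to_cos_int (a - b) (e - c + pi / 2) h.
  have [_ _ h0] := h.
  rewrite -[RHS]addr0 -{1}(h0 (a + b) (e + c - pi / 2)) -(h0 (a - b) (e - c + pi / 2)) -RintegralD//.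
  apply: eq_Rintegral => w _; rewrite real_linD real_linB.
  set x := real_lin b w; set y := real_lin a w.
  have -> : y + x + (e + c - pi / 2) = (y + e) + (x + c - pi / 2) by ring.
  have -> : y - x + (e - c + pi / 2) = (y + e) - (x + c - pi / 2) by ring.
  by rewrite (cosD (y + e)) (cosB (y + e)) cosBpihalf; field.
Qed.

Lemma orthogonal_to_cos_expn p b c j : orthogonal_to_cos p ->
  orthogonal_to_cos (fun w => p w * (1 + sin (real_lin b w + c)) ^+ j).
Proof.
move=> hp; elim: j => [|j IH].
  by move: hp; congr orthogonal_to_cos; apply/funext => w; rewrite expr0 mulr1.
have := orthogonal_to_cosD IH (orthogonal_to_cos_sin b c IH).
by congr orthogonal_to_cos; apply/funext => w; rewrite exprS; ring.
Qed.

(** The partial sums of the exponential series are uniformly bounded, since [(1 + sin x)^k] lies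
    between 0 and [2^k]. *)
Lemma orthogonal_to_cos_exp p b c (r : R) k : 0 <= r -> orthogonal_to_cos p ->
  orthogonal_to_cos (fun w => p w * expR (- (r * (1 + sin (real_lin b w + c)) ^+ k))).
Proof.
move=> r0 hp; have [mp [K pK] p0] := hp.
pose s w := 1 + sin (real_lin b w + c).
have s0 w : 0 <= s w by rewrite /s -lerBlDl sub0r sin_geN1.
have s2 w : s w <= 2 by rewrite /s -[leRHS]/(1 + 1) lerD2l sin_le1.
pose x w := - (r * s w ^+ k).
have hx w : `|x w| <= r * 2 ^+ k.
  by rewrite normrN normrM !ger0_norm ?exprn_ge0// ler_wpM2l// lerXn2r// nnegrE.
apply: (@orthogonal_to_cos_lim (fun J w => \sum_(j < J) p w * (x w ^+ j / j`!%:R)) _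
  (K * expR (r * 2 ^+ k))).
- move=> J; apply: (@orthogonal_to_cos_sum (fun j w => p w * (x w ^+ j / j`!%:R))) => j.
  have := orthogonal_to_cosZ ((- r) ^+ j / j`!%:R) (orthogonal_to_cos_expn b c (k * j) hp).
  congr orthogonal_to_cos; apply/funext => w.
  by rewrite /x -mulNr exprMn -exprM; ring.
- move=> J w; rewrite -mulr_sumr normrM ler_pM//.
  apply: le_trans (ler_norm_sum _ _ _) _.
  have -> : \sum_(j < J) `|x w ^+ j / j`!%:R| = \sum_(j < J) `|x w| ^+ j / j`!%:R.
    by apply: eq_bigr => j _; rewrite normrM normrX [X in _ * X]ger0_norm ?invr_ge0.
  by apply: le_trans (exp_part_le _ (normr_ge0 _)) _; rewrite ler_expR.
- move=> w; under eq_fun do rewrite -mulr_sumr.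
  apply: cvgMr; rewrite (_ : (fun J => _) = series (exp_coeff (x w))).
    exact: is_cvg_series_exp_coeff.
  by apply/funext => J; rewrite /series/= big_mkord.
Qed.

(* [1 - expR (- m (1 + sin x)^m)] converges boundedly to the indicator of [0 <= sin x]. *)
Lemma orthogonal_to_cos_sin_ge0 p b c : orthogonal_to_cos p ->
  orthogonal_to_cos (fun w => p w * (0 <= sin (real_lin b w + c))%R%:R).
Proof.
move=> hp; have [mp [K pK] p0] := hp.
pose s w := 1 + sin (real_lin b w + c).
have s0 w : 0 <= s w by rewrite /s -lerBlDl sub0r sin_geN1.
apply: (@orthogonal_to_cos_lim (fun m w => p w * (1 - expR (- (m%:R * s w ^+ m)))) _ K).
- move=> m.
  have := orthogonal_to_cosD hp (orthogonal_to_cosZ (-1) (orthogonal_to_cos_exp b c m (ler0n _ m) hp)).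
  by congr orthogonal_to_cos; apply/funext => w; rewrite -/(s w); ring.
- move=> m w; rewrite normrM; apply: le_trans (pK w); rewrite ler_piMr// ger0_norm.
    by rewrite lerBlDr lerDl expR_ge0.
  by rewrite subr_ge0 -[leRHS]expR0 ler_expR oppr_le0 mulr_ge0// exprn_ge0.
(* If the sine is nonnegative, then [s w >= 1], and [expR x >= 1 + x] bounds the exponential in the
   limit by [1 / (m + 1)]. *)
- move=> w; apply: cvgMr; case: leP => sw.
    have s1 : 1 <= s w by rewrite lerDl.
    rewrite -[X in _ --> X]subr0; apply: cvgB; first exact: cvg_cst.
    apply: (@squeeze_cvgr _ _ _ _ (fun=> 0) (fun m => m.+1%:R^-1 : R)); last 2 first.
    + exact: cvg_cst.
    + exact: cvg_harmonic.
    apply: nearW => m; rewrite expR_ge0/= expRN lef_pV2 ?posrE ?expR_gt0//.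
    have h := expR_ge1Dx (m%:R * s w ^+ m); apply: le_trans h; rewrite -nat1r lerD2l.
    by rewrite ler_peMr// exprn_ege1.
  have s1 : s w < 1 by rewrite -[ltRHS]addr0 ltrD2l.
  (* As [s w <= r^2], the number [m (s w)^m] is at most [(m r^m) r^m], where the first factor is
     bounded by Bernoulli's inequality and the second tends to 0. *)
  pose r := (1 + s w) / 2.
  have r0 : 0 < r by rewrite divr_gt0// ltr_pwDl.
  have r1 : r < 1 by rewrite ltr_pdivrMr// mul1r -[ltRHS]/(1 + 1) ltrD2l.
  have sr : s w <= r ^+ 2 by rewrite /r; have := sqr_ge0 (1 - s w); nra.
  pose t := r^-1 - 1.
  have t0 : 0 < t by rewrite subr_gt0 invf_gt1.
  have mr m : m%:R * r ^+ m <= t^-1.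
    have h : 1 + t *+ m <= (1 + t) ^+ m.
      elim: m => [|m IH]; first by rewrite mulr0n addr0 expr0.
      rewrite exprS; apply: le_trans (ler_wpM2l _ IH); last by rewrite addr_ge0// ltW.
      rewrite mulrS; set x := t *+ m.
      have tx : 0 <= t * x by rewrite mulr_ge0 ?mulrn_wge0// ltW.
      by rewrite mulrDl mul1r mulrDr mulr1; lra.
    have E1 : (1 + t) ^+ m * r ^+ m = 1 by rewrite -exprMn /t addrC subrK mulVf ?gt_eqF// expr1n.
    rewrite -[leRHS]mul1r ler_pdivlMr// -[leRHS]E1 mulrAC ler_wpM2r ?exprn_ge0 ?(ltW r0)//.
    by apply: le_trans h; rewrite mulr_natl lerDr.
  rewrite -[X in _ --> X](subrr 1); apply: cvgB; first exact: cvg_cst.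
  apply: (@squeeze_cvgr _ _ _ _ (fun m => 1 - t^-1 * r ^+ m) (fun=> 1)); last 2 first.
  + rewrite -[X in _ --> X]subr0; apply: cvgB; first exact: cvg_cst.
    by apply: cvg_geometric; rewrite ger0_norm// ltW.
  + exact: cvg_cst.
  apply: nearW => m; apply/andP; split; last first.
    by rewrite -[leRHS]expR0 ler_expR oppr_le0 mulr_ge0// exprn_ge0.
  apply: le_trans (expR_ge1Dx _); rewrite lerD2l lerN2.
  apply: (@le_trans _ _ (m%:R * (r ^+ m * r ^+ m))).
    by rewrite ler_wpM2l// -exprMn -expr2 lerXn2r// nnegrE ?exprn_ge0// ltW.
  by rewrite mulrA ler_wpM2r// exprn_ge0// ltW.
Qed.

(* For [N] large, [sin (x / N)] has the sign of [x]. *)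
Lemma orthogonal_to_cos_halfspace p b c : orthogonal_to_cos p ->
  orthogonal_to_cos (fun w => p w * (c <= real_lin b w)%R%:R).
Proof.
move=> hp; have [mp [K pK] p0] := hp.
apply: (@orthogonal_to_cos_lim (fun N w => p w *
    (0 <= sin (real_lin ((N.+1%:R^-1)%:C *: b) w + - c / N.+1%:R))%R%:R) _ K).
- by move=> N; exact: orthogonal_to_cos_sin_ge0.
- move=> N w; rewrite normrM; apply: le_trans (pK w); rewrite ler_piMr//.
  by case: (0 <= _); rewrite ?normr1 ?normr0.
- move=> w; apply: cvgMr; apply: cvg_near_cst.
  near=> N; congr ((_ : bool)%:R).
  rewrite real_linZ mulrC -mulrDl; set x := _ - c.
  have N0 : 0 < N.+1%:R :> R by rewrite ltr0n.
  have xN : `|x / N.+1%:R| < pi.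
    rewrite normrM (ger0_norm (x := _^-1)) ?invr_ge0 ?ler0n// ltr_pdivrMr//.
    rewrite mulrC -ltr_pdivrMr ?pi_gt0//.
    apply: lt_le_trans (truncnS_gt _) _; rewrite ler_nat ltnS.
    by near: N; exact: nbhs_infty_ge.
  move: xN; rewrite ltr_norml => /andP[x1 x2].
  rewrite -[RHS]subr_ge0 -/x; have [x0|x0] := leP 0 x.
    by rewrite sin_ge0_pi// divr_ge0//= ltW.
  apply/negbTE; rewrite -ltNge -oppr_gt0 -sinN -mulNr.
  by apply: sin_gt0_pi; rewrite divr_gt0 ?oppr_gt0//= mulNr ltrNl.
Unshelve. all: by end_near.
Qed.

End Uniqueness.

(** * From half-spaces to all measurable sets, and from cosines to kernels *)

Section UniquenessConclusion.
Variables (R : realType) (n : nat).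
Local Notation Cn := 'rV[R[i]]_n.
Local Notation mu := (@gauss R n).
Local Notation R' := (measurableTypeR R).

(** Finite intersections are taken to make the family stable under intersection, as Dynkin's theorem
    requires. *)
Let in_halfspaces (s : seq (Cn * R)) : set Cn := [set w | all (fun ac => ac.2 <= real_lin ac.1 w) s].
Let halfspaces : set (set Cn) := [set A | exists s, A = in_halfspaces s].

Lemma measurable_Cn_halfspaces : @measurable _ Cn `<=` <<s halfspaces >>.
Proof.
pose X := g_sigma_algebraType halfspaces.
suff h : measurable_fun setT (fun w : X => (w : Cn)).
  by move=> A mA; have := h measurableT A mA; rewrite setTI.
have ml a : measurable_fun setT (fun w : X => real_lin a w : R').
  apply: (measurability _ (@RGenCInfty.measurableE R)) => _ [_ [c ->] <-].
  rewrite setTI; apply: sub_sigma_algebra; exists [:: (a, c)].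
  by apply/seteqP; split => w; rewrite /in_halfspaces/= in_itv/= !andbT.
apply: (measurable_to_Cn (phi := fun w : X => (w : Cn))) => k; split.
  by have := ml (delta_mx ord0 k); under eq_fun do rewrite real_lin_Re.
by have := ml ('i *: delta_mx ord0 k); under eq_fun do rewrite real_lin_Im.
Qed.

(** The measurable sets over which [kappa] has integral zero form a lambda-system, which contains
    the finite intersections of half-spaces. *)
Lemma ae_eq0_of_cos (kappa : Cn -> R) : mu.-integrable setT (EFin \o kappa) ->
  (forall a c, Rintegral mu setT (fun w => kappa w * cos (real_lin a w + c)) = 0) ->
  {ae mu, forall w, kappa w = 0}.
Proof.
move=> ik hk.
have mk : measurable_fun setT kappa by exact/measurable_EFinP/(measurable_int _ ik).
have h1 : orthogonal_to_cos kappa (fun=> 1).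
  split; [exact: measurable_cst|by exists 1 => w; rewrite normr1|].
  by move=> a c; rewrite -[RHS](hk a c); apply: eq_Rintegral => w _; rewrite mul1r.
have hs s : orthogonal_to_cos kappa (fun w => (w \in in_halfspaces s)%:R).
  elim: s => [|[a c] s IH].
    by move: h1; congr orthogonal_to_cos; apply/funext => w; rewrite mem_set.
  have := orthogonal_to_cos_halfspace ik a c IH.
  congr orthogonal_to_cos; apply/funext => w; rewrite -natrM mulnb; congr ((_ : bool)%:R).
  rewrite andbC; apply/andP/idP => [[l]|].
    by rewrite !inE => sw; apply/andP.
  by rewrite inE => /andP[l sw]; rewrite inE.
pose H : set (set Cn) := [set A | measurable A /\ Rintegral mu setT (fun w => kappa w * (w \in A)%:R) = 0].
have mI (A : set Cn) : measurable A -> measurable_fun setT (fun w => (w \in A)%:R : R).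
  by move=> mA; exact: (@measurable_indic _ _ R setT A mA).
have iI A : measurable A -> mu.-integrable setT (EFin \o (fun w => kappa w * (w \in A)%:R)).
  move=> mA; apply: le_integrable ik => //.
    by apply/measurable_EFinP; apply: measurable_funM => //; exact: mI.
  by move=> w _ /=; rewrite lee_fin normrM ler_piMr//; case: (_ \in _); rewrite ?normr1 ?normr0.
have H_all A : measurable A -> H A.
  move=> mA; apply: (@lambda_system_subset _ halfspaces _ setT H) => //.
  - move=> _ _ [s ->] [t ->]; exists (s ++ t); apply/seteqP; split => w; rewrite /in_halfspaces/= all_cat.
      by move=> [-> ->].
    by move=> /andP[].
  - split => //.
    - split => //; rewrite -[RHS](hk 0 0); apply: eq_Rintegral => w _.
      by rewrite in_setT real_lin0 addr0 cos0.
    - move=> A' B BA [mA' A0] [mB B0]; split; first exact: measurableD.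
      rewrite -[RHS](subrr 0) -{1}A0 -B0 -RintegralB//; [|exact: iI|exact: iI].
      apply: eq_Rintegral => w _; rewrite -mulrBr; congr (_ * _).
      case: (boolP (w \in B)) => wB; have [wA|wA] := boolP (w \in A').
      + by rewrite memNset ?subrr// => -[_]; apply; exact: set_mem.
      + by move: wA; rewrite mem_set//; apply: BA; exact: set_mem.
      + by rewrite mem_set ?subr0//; split; [exact: set_mem|move=> Bw; move: wB; rewrite mem_set].
      + rewrite memNset ?subr0// => -[wA' _]; by move: wA; rewrite mem_set.
    - move=> F ndF hF; split; first by apply: bigcupT_measurable => N; exact: (hF N).1.
      apply: (dominated_Rintegral_cst (f_ := fun N w => kappa w * (w \in F N)%:R) (g := fun w => `|kappa w|)).
      + by move=> N; apply: measurable_funM => //; apply: mI; exact: (hF N).1.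
      + apply: measurable_funM => //; apply: mI; apply: bigcupT_measurable => N; exact: (hF N).1.
      + exact: (integrable_norm ik).
      + by move=> N w; rewrite normrM ler_piMr//; case: (_ \in _); rewrite ?normr1 ?normr0.
      + move=> w; apply: cvgMr; apply: cvg_near_cst.
        case: (boolP (w \in \bigcup_N F N)) => wF.
          have [N _ FNw] := set_mem wF; exists N => // m /= Nm.
          by rewrite mem_set//; have /subsetPset := ndF _ _ Nm; apply.
        apply: nearW => N; rewrite memNset// => FNw; move/negP: wF; apply.
        by rewrite inE; exists N.
      + by move=> N; have [] := hF N.
  (* The measurability of the intersection is read off from that of its indicator, as the preimage
     of 1. *)
  - move=> _ [s ->]; have [ms _ s0] := hs s; split.
      have := ms measurableT [set 1] (measurable_set1 _).
      congr measurable; apply/seteqP; split => w /=; rewrite ?setTI/=.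
        by move=> [_]; case: (boolP (w \in _)) => [|_ /esym/eqP]; rewrite ?inE// oner_eq0.
      by move=> ws; split => //; rewrite mem_set.
    rewrite -(s0 0 0); apply: eq_Rintegral => w _.
    by rewrite real_lin0 addr0 cos0 mulr1.
  - exact: measurable_Cn_halfspaces.
have := @integral_ae_eq _ _ _ mu setT measurableT (cst 0%E) (EFin \o kappa) ik (measurable_cst _).
move=> /(_ _)/wrap[].
  move=> E _ mE; rewrite integral_cst// mul0e.
  have [_ hE] := H_all _ mE.
  have fE := integrable_fin_num measurableT (iI _ mE).
  rewrite integral_mkcond -[RHS]/(0%:E) -hE fineK//; apply: eq_integral => w _.
  by rewrite patchE /=; case: (w \in E); rewrite ?mulr1 ?mulr0.
by apply: filterS => w /(_ I) /= [].
Qed.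

(** With [b = (- 'i / 2) a] the left side is [w.conj b] minus its conjugate, hence [2 'i] times the
    imaginary part of [w.conj b]. The coefficient of [a] makes this ['i] times [real_lin a w], so
    that the product of kernels is a character. *)
Lemma real_lin_i a (w : Cn) : dotC w (conjv ((- 'i / 2) *: a)) + dotC (- ((- 'i / 2) *: a)) (conjv w) = 0 +i* real_lin a w.
Proof.
set b := _ *: a.
have E x y : dotC (- x) (conjv y) = - (dotC y (conjv x))^* :> R[i].
  rewrite /dotC rmorph_sum -sumrN; apply: eq_bigr => k _.
  by rewrite !mxE rmorphM/= conjCK mulNr mulrC.
have Eb : dotC w (conjv b) = 'i / 2 * dotC w (conjv a).
  rewrite /dotC mulr_sumr; apply: eq_bigr => k _; rewrite !mxE rmorphM/= mulrCA; congr (_ * (_ * _)).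
  by rewrite rmorphM rmorphN fmorphV rmorph_nat; congr (_ / _); apply: complexP => /=; rewrite ?opprK ?oppr0.
rewrite E Eb /real_lin; set D := dotC w (conjv a).
have -> : 'i / 2 * D = (2^-1)%:C * ('i * D).
  by rewrite fmorphV rmorph_nat; ring.
by apply: complexP; rewrite !(cReD, cImD, cReN, cImN, cRe_conj, cIm_conj, cReM, cImM)/=; field.
Qed.

Lemma ae_eq0_of_kernels (k : Cn -> R[i]) : cintegrable mu k ->
  (forall a z, cint mu (fun w => k w * cexp (dotC w (conjv a)) * cexp (dotC z (conjv w))) = 0) ->
  {ae mu, forall w, k w = 0}.
Proof.
move=> [ir ii] hk.
pose kr w := complex.Re (k w); pose ki w := complex.Im (k w).
have mr : measurable_fun setT kr by exact/measurable_EFinP/(measurable_int _ ir).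
have mi : measurable_fun setT ki by exact/measurable_EFinP/(measurable_int _ ii).
have bnd (q p : Cn -> R) : mu.-integrable setT (EFin \o q) -> measurable_fun setT p ->
    (forall w, `|p w| <= 1) -> mu.-integrable setT (EFin \o (fun w => q w * p w)).
  move=> iq mp p1; apply: (le_integrable _ _ _ iq) => //.
    apply/measurable_EFinP; apply: measurable_funM => //; exact/measurable_EFinP/(measurable_int _ iq).
  by move=> w _ /=; rewrite lee_fin normrM ler_piMr.
have mcosl (a : Cn) : measurable_fun setT (fun w => cos (real_lin a w)).
  by have := measurable_cos_lin a 0; under eq_fun do rewrite addr0.
have msinl (a : Cn) : measurable_fun setT (fun w => sin (real_lin a w)).
  by have := measurable_sin_lin a 0; under eq_fun do rewrite addr0.
have cosl1 (a w : Cn) : `|cos (real_lin a w)| <= 1 by rewrite ler_norml cos_geN1 cos_le1.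
have sinl1 (a w : Cn) : `|sin (real_lin a w)| <= 1 by rewrite ler_norml sin_geN1 sin_le1.
have E a w : k w * cexp (dotC w (conjv ((- 'i / 2) *: a))) * cexp (dotC (- ((- 'i / 2) *: a)) (conjv w)) =
   (kr w * cos (real_lin a w) - ki w * sin (real_lin a w)) +i*
   (kr w * sin (real_lin a w) + ki w * cos (real_lin a w)).
  rewrite -mulrA -cexpD real_lin_i /cexp /= expR0 mul1r.
  by apply: complexP; rewrite ?cReM ?cImM.
pose I (q p : Cn -> R) := Rintegral mu setT (fun w => q w * p w).
have hre a : I kr (fun w => cos (real_lin a w)) - I ki (fun w => sin (real_lin a w)) = 0.
  have /(congr1 (@complex.Re R)) := hk ((- 'i / 2) *: a) (- ((- 'i / 2) *: a)).
  rewrite /= => h; rewrite /I -RintegralB//; [|exact: bnd|exact: bnd].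
  by rewrite -[RHS]h; apply: eq_Rintegral => w _; rewrite E.
have him a : I kr (fun w => sin (real_lin a w)) + I ki (fun w => cos (real_lin a w)) = 0.
  have /(congr1 (@complex.Im R)) := hk ((- 'i / 2) *: a) (- ((- 'i / 2) *: a)).
  rewrite /= => h; rewrite /I -RintegralD//; [|exact: bnd|exact: bnd].
  by rewrite -[RHS]h; apply: eq_Rintegral => w _; rewrite E.
(* The complex relations mix the two parts of [k]. As the cosine is even and the sine odd, the
   relations for [a] and [- a] separate them. *)
have cosN q a : I q (fun w => cos (real_lin (- a) w)) = I q (fun w => cos (real_lin a w)).
  by apply: eq_Rintegral => w _; rewrite real_linN cosN.
have sinN q a : mu.-integrable setT (EFin \o q) ->
    I q (fun w => sin (real_lin (- a) w)) = - I q (fun w => sin (real_lin a w)).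
  move=> iq; rewrite -mulN1r -RintegralZl//; last exact: bnd.
  by apply: eq_Rintegral => w _; rewrite real_linN sinN; ring.
have main (q : Cn -> R) : mu.-integrable setT (EFin \o q) ->
   (forall a, I q (fun w => cos (real_lin a w)) = 0) ->
   (forall a, I q (fun w => sin (real_lin a w)) = 0) -> {ae mu, forall w, q w = 0}.
  move=> iq hc hs; apply: ae_eq0_of_cos => // a c.
  have Ic := bnd _ _ iq (mcosl a) (cosl1 a); have Is := bnd _ _ iq (msinl a) (sinl1 a).
  have Zc : Rintegral mu setT (fun w => cos c * (q w * cos (real_lin a w))) = 0.
    by rewrite RintegralZl// -[X in _ * X]/(I q (fun w => cos (real_lin a w))) hc mulr0.
  have Zs : Rintegral mu setT (fun w => sin c * (q w * sin (real_lin a w))) = 0.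
    by rewrite RintegralZl// -[X in _ * X]/(I q (fun w => sin (real_lin a w))) hs mulr0.
  rewrite -[RHS](subrr 0) -{1}Zc -Zs.
  rewrite -RintegralB//.
  - by apply: eq_Rintegral => w _; rewrite cosD; ring.
  - by rewrite (_ : _ \o _ = (fun w => (cos c)%:E * (q w * cos (real_lin a w))%:E)%E)//;
      apply: integrableZl => //; exact: bnd.
  - by rewrite (_ : _ \o _ = (fun w => (sin c)%:E * (q w * sin (real_lin a w))%:E)%E)//;
      apply: integrableZl => //; exact: bnd.
have r0 : {ae mu, forall w, kr w = 0}.
  apply: main => // a; have h1 := hre a; have h2 := hre (- a); have h3 := him a; have h4 := him (- a);
    rewrite ?cosN ?sinN// in h2 h4; lra.
have i0 : {ae mu, forall w, ki w = 0}.
  apply: main => // a; have h1 := hre a; have h2 := hre (- a); have h3 := him a; have h4 := him (- a);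
    rewrite ?cosN ?sinN// in h2 h4; lra.
by apply: filterS2 r0 i0 => w rw iw; apply: complexP.
Qed.

End UniquenessConclusion.

(** * The reproducing formula *)

Section Growth.
Variables (R : realType) (n : nat).
Local Notation Cn := 'rV[R[i]]_n.
Local Notation mu := (@gauss R n).
Local Notation V := (@lebesgueCn R n).
Implicit Types (w z a b p q : Cn) (c : R) (F G : Cn -> R[i]).

Lemma sqnormC_sum z : sqnormC z = \sum_k normc (z ord0 k) ^+ 2.
Proof. by rewrite sqnormCE; apply: eq_bigr => k _; rewrite normc_sqr. Qed.

Lemma sqnormC_ge0 z : 0 <= sqnormC z.
Proof. by rewrite sqnormC_sum sumr_ge0// => k _; rewrite sqr_ge0. Qed.

Lemma sqnormC_dotC z : (sqnormC z)%:C = dotC z (conjv z).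
Proof.
apply: complexP => //; rewrite /dotC [RHS](big_morph _ (@cImD R) (erefl (complex.Im 0))).
by rewrite big1// => k _; rewrite mxE cImM cRe_conj cIm_conj; ring.
Qed.

Lemma sqnormCD z w : sqnormC (z + w) <= sqnormC z *+ 2 + sqnormC w *+ 2.
Proof.
rewrite !sqnormC_sum -!sumrMnl -big_split/=; apply: ler_sum => k _; rewrite mxE.
have h := normcD (z ord0 k) (w ord0 k).
have h1 := normc_ge0 (z ord0 k + w ord0 k).
have h2 := normc_ge0 (z ord0 k); have h3 := normc_ge0 (w ord0 k).
apply: (@le_trans _ _ ((normc (z ord0 k) + normc (w ord0 k)) ^+ 2)).
  by rewrite lerXn2r// nnegrE addr_ge0.
have := sqr_ge0 (normc (z ord0 k) - normc (w ord0 k)); lra.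
Qed.

Lemma sqnormCN z : sqnormC (- z) = sqnormC z.
Proof. by rewrite !sqnormC_sum; apply: eq_bigr => k _; rewrite mxE normcN. Qed.

Lemma sqnormCB z w : sqnormC (z - w) <= sqnormC z *+ 2 + sqnormC w *+ 2.
Proof. by rewrite -[sqnormC w]sqnormCN sqnormCD. Qed.

Definition abs_dot z w : R := \sum_k normc (z ord0 k) * normc (w ord0 k).

(** The weight [e] decides how the growth of [e^(z.conj w)] is shared: small on the free variable
    when the other one is fixed, balanced when both vary. *)
Lemma abs_dot_le (e : R) z w : 0 < e -> abs_dot z w <= e * sqnormC z + (4 * e)^-1 * sqnormC w.
Proof.
move=> e0; rewrite !sqnormC_sum !mulr_sumr -big_split/=; apply: ler_sum => k _.
set x := normc _; set y := normc _.
have -> : e * x ^+ 2 + (4 * e)^-1 * y ^+ 2 = (4 * e)^-1 * (2 * e * x - y) ^+ 2 + x * y.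
  by field; rewrite gt_eqF.
by rewrite lerDr mulr_ge0 ?sqr_ge0// invr_ge0 mulr_ge0// ltW.
Qed.

Lemma normc_dotC z w : normc (dotC z w) <= abs_dot z w.
Proof.
apply: le_trans (normc_sum _ _ _) _; apply: ler_sum => k _.
by rewrite ComplexField.Normc.normcM.
Qed.

Lemma abs_dot_conj z w : abs_dot z (conjv w) = abs_dot z w.
Proof. by apply: eq_bigr => k _; rewrite mxE normc_conj. Qed.

Lemma normc_cexp_dotC z w : normc (cexp (dotC z w)) <= expR (abs_dot z w).
Proof.
rewrite normc_cexp ler_expR; apply: le_trans (normc_dotC _ _).
exact: le_trans (ler_norm _) (normr_Re_le _).
Qed.

Definition gauss_bounded (c : R) F := exists2 M, 0 <= M & forall z, normc (F z) <= M * expR (c * sqnormC z).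

(** The growth condition of [Sym] with a pointwise bound instead of an essential one. Unlike a fixed
    rate [c] it is stable under products. *)
Definition subgauss F := forall c, 0 < c -> gauss_bounded c F.

Lemma gauss_boundedM c c' F G : gauss_bounded c F -> gauss_bounded c' G ->
  gauss_bounded (c + c') (fun z => F z * G z).
Proof.
move=> [M M0 hM] [N N0 hN]; exists (M * N); first exact: mulr_ge0.
move=> z; rewrite ComplexField.Normc.normcM mulrDl expRD mulrACA.
by rewrite ler_pM ?normc_ge0.
Qed.

Lemma gauss_boundedD c F G : gauss_bounded c F -> gauss_bounded c G ->
  gauss_bounded c (fun z => F z + G z).
Proof.
move=> [M M0 hM] [N N0 hN]; exists (M + N); first exact: addr_ge0.
by move=> z; rewrite (le_trans (normcD _ _))// mulrDl lerD.
Qed.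

Lemma gauss_bounded_conj c F : gauss_bounded c F -> gauss_bounded c (fun z => (F z)^*).
Proof. by move=> [M M0 hM]; exists M => // z; rewrite normc_conj. Qed.

Lemma subgaussM F G : subgauss F -> subgauss G -> subgauss (fun z => F z * G z).
Proof.
move=> hF hG c c0; have c2 : 0 < c / 2 by rewrite divr_gt0.
by rewrite (splitr c); apply: gauss_boundedM; [exact: hF|exact: hG].
Qed.

Lemma subgaussD F G : subgauss F -> subgauss G -> subgauss (fun z => F z + G z).
Proof. by move=> hF hG c c0; apply: gauss_boundedD; [exact: hF|exact: hG]. Qed.

Lemma subgauss_conj F : subgauss F -> subgauss (fun z => (F z)^*).
Proof. by move=> hF c c0; apply: gauss_bounded_conj; exact: hF. Qed.

Lemma subgauss_cst (k : R[i]) : subgauss (fun=> k).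
Proof.
move=> c c0; exists (normc k); rewrite ?normc_ge0// => z.
by rewrite ler_peMr ?normc_ge0// -expR0 ler_expR mulr_ge0 ?sqnormC_ge0// ltW.
Qed.

Lemma subgauss_cexp b : subgauss (fun z => cexp (dotC z b)).
Proof.
move=> c c0; exists (expR ((4 * c)^-1 * sqnormC b)); rewrite ?expR_ge0// => z.
apply: le_trans (normc_cexp_dotC _ _) _; rewrite -expRD ler_expR addrC.
exact: abs_dot_le.
Qed.

Lemma subgauss_translate F p : subgauss F -> subgauss (fun z => F (z + p)).
Proof.
move=> hF c c0; have c2 : 0 < c / 2 by rewrite divr_gt0.
have [M M0 hM] := hF _ c2; exists (M * expR (c * sqnormC p)); first by rewrite mulr_ge0 ?expR_ge0.
move=> z; apply: le_trans (hM _) _; rewrite -[leRHS]mulrA -expRD ler_wpM2l// ler_expR.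
apply: le_trans (ler_wpM2l (ltW c2) (sqnormCD z p)) _.
by rewrite le_eqVlt; apply/orP; left; apply/eqP; field.
Qed.

Lemma subgauss_coord k : subgauss (fun z => z ord0 k).
Proof.
move=> c c0; exists (1 + c^-1); first by rewrite addr_ge0// invr_ge0 ltW.
move=> z; set x := normc _.
have hx : x ^+ 2 <= sqnormC z.
  by rewrite sqnormC_sum (bigD1 k)//= lerDl sumr_ge0// => j _; rewrite sqr_ge0.
have h1 : 1 + c * x ^+ 2 <= expR (c * sqnormC z).
  by apply: le_trans (expR_ge1Dx _) _; rewrite ler_expR ler_wpM2l// ltW.
apply: (@le_trans _ _ ((1 + c^-1) * (1 + c * x ^+ 2))); last first.
  by rewrite ler_wpM2l// addr_ge0// invr_ge0 ltW.
have -> : (1 + c^-1) * (1 + c * x ^+ 2) = 1 + c^-1 + c * x ^+ 2 + x ^+ 2.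
  by field; rewrite gt_eqF.
have c'0 : 0 <= c^-1 by rewrite invr_ge0 ltW.
have h2 : 0 <= c * x ^+ 2 by rewrite mulr_ge0 ?sqr_ge0// ltW.
have := sqr_ge0 (1 - x); have : 0 <= x by exact: normc_ge0.
by nra.
Qed.

Lemma gauss_bounded_int c F : cmeas F -> c < 1 -> gauss_bounded c F -> cintegrable mu F.
Proof.
move=> mF c1 [M M0 hM].
apply: (cintegrable_le (G := fun z => M * expR (c * sqnormC z)) mF) => //.
rewrite (_ : _ \o _ = (fun z => M%:E * (expR (c * sqnormC z))%:E)%E)//.
by apply: integrableZl => //; exact: integrable_gauss_exp.
Qed.

Lemma subgauss_int F : cmeas F -> subgauss F -> cintegrable mu F.
Proof.
move=> mF hF; have h : (0 : R) < 2^-1 by rewrite invr_gt0.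
by apply: (gauss_bounded_int mF _ (hF _ h)); rewrite invf_lt1// ltr1n.
Qed.

Lemma cint_cst (k : R[i]) : cint mu (fun=> k) = k.
Proof.
rewrite /cint; apply: complexP => /=; rewrite Rintegral_cst//.
  by rewrite [X in fine X]gauss_setT mulr1.
by rewrite [X in fine X]gauss_setT mulr1.
Qed.

Lemma cmeas_dotC a : cmeas (fun w => dotC w a).
Proof. by apply: cmeas_sum => k; apply: cmeasM; [exact: cmeas_coord|exact: cmeas_cst]. Qed.

Lemma cmeas_kernel a : cmeas (fun w => cexp (dotC w a)).
Proof. by apply: cmeas_cexp; exact: cmeas_dotC. Qed.

Lemma dotC_conj z w : dotC z (conjv w) = (dotC w (conjv z))^*.
Proof.
rewrite /dotC rmorph_sum; apply: eq_bigr => k _.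
by rewrite !mxE rmorphM/= conjCK mulrC.
Qed.

Lemma kernel_conj z w : cexp (dotC z (conjv w)) = (cexp (dotC w (conjv z)))^*.
Proof. by rewrite cexp_conj -dotC_conj. Qed.

Lemma cmeas_kernel_conj z : cmeas (fun w => cexp (dotC z (conjv w))).
Proof.
by apply: cmeas_ext (cmeas_conj (cmeas_kernel (conjv z))) => w; rewrite -kernel_conj.
Qed.

Lemma subgauss_kernel_conj z : subgauss (fun w => cexp (dotC z (conjv w))).
Proof.
move=> c c0; have [M M0 hM] := subgauss_conj (subgauss_cexp (conjv z)) c0.
by exists M => // w; rewrite kernel_conj.
Qed.

Lemma dotCDl a b z : dotC (a + b) z = dotC a z + dotC b z.
Proof. by rewrite /dotC -big_split/=; apply: eq_bigr => k _; rewrite !mxE mulrDl. Qed.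

Lemma dotCNl a z : dotC (- a) z = - dotC a z.
Proof. by rewrite /dotC -sumrN; apply: eq_bigr => k _; rewrite !mxE mulNr. Qed.

Lemma dotCZl (k : R[i]) a z : dotC (k *: a) z = k * dotC a z.
Proof. by rewrite /dotC mulr_sumr; apply: eq_bigr => j _; rewrite !mxE mulrA. Qed.

Lemma dotC_sym a z : dotC a z = dotC z a.
Proof. by apply: eq_bigr => k _; rewrite mulrC. Qed.

Lemma dotCDr a b z : dotC z (a + b) = dotC z a + dotC z b.
Proof. by rewrite dotC_sym dotCDl !(dotC_sym z). Qed.

Lemma dotCNr a z : dotC z (- a) = - dotC z a.
Proof. by rewrite dotC_sym dotCNl (dotC_sym z). Qed.

Lemma conjvD a b : conjv (a + b) = conjv a + conjv b.
Proof. by apply/rowP => k; rewrite !mxE rmorphD. Qed.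

End Growth.

(** * From essential to pointwise bounds *)

Section SymBound.
Variables (R : realType) (n : nat).
Local Notation Cn := 'rV[R[i]]_n.
Local Notation V := (@lebesgueCn R n).

(* On a small box around [z] the essential bound with [c / 2] holds at some point close to [z], and
   [sqnormC] at most doubles there up to a constant. *)
Lemma Sym_subgauss (f : Cn -> R[i]) : Sym f -> entire f -> subgauss f.
Proof.
move=> [mf hf] ef c c0; pose c' := c / 2; have c'0 : 0 < c' by rewrite divr_gt0.
have [M hM] := hf _ c'0.
exists (1 + `|M| * expR c); first by rewrite addr_ge0// mulr_ge0// expR_ge0.
move=> z.
have cf : {for z, continuous f} by exact: differentiable_continuous.
have [r r0 hr] : exists2 r : R, 0 < r & forall w : Cn, (forall k, normc (w ord0 k - z ord0 k) < r) ->
    normc (f w - f z) < 1.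
  have /cvgrPdist_lt/(_ 1 ltr01)/nbhs_ballP[e /= e0 he] := cf.
  (* A positive element of [R[i]] is real, so that a radius may be replaced by its real part. *)
  move: (e0); rewrite ltcE /= => /andP[/eqP ie re].
  exists (complex.Re e) => // w hw.
  have : `|f z - f w| < 1; last by rewrite distrC normCE ltcE/= => /andP[].
  apply: he; split => // i k; rewrite ord1 /ball /= distrC normCE ltcE/= ie eqxx/=.
  exact: hw.
(* The first bound makes [f w] differ from [f z] by less than 1; the second makes [|w - z|^2] at
   most 1, each coordinate giving at most [1 / (n + 1)]. *)
pose d := Num.min (r / 2) (n.+1%:R^-1 / 2).
have d0 : 0 < d by rewrite lt_min !divr_gt0// invr_gt0.
set B := [set w : Cn | forall k, `|complex.Re (w ord0 k - z ord0 k)| < d /\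
    `|complex.Im (w ord0 k - z ord0 k)| < d]%R.
have VB : (0 < V B)%E by exact: lebesgueCn_box_gt0.
have [w [Bw Mw]] : exists w : Cn, B w /\ normc (f w) * expR (- c' * sqnormC w) <= M.
  apply: contrapT => no; move: VB; apply/negP; rewrite -leNgt.
  have [A [mA A0 hA]] := hM; rewrite -A0; apply: le_measure; rewrite ?inE//.
    rewrite (_ : B = \bigcap_(k in [set: 'I_n])
      ((fun w : Cn => `|complex.Re (w ord0 k - z ord0 k)|) @^-1` `]-oo, d[%classic `&`
       (fun w : Cn => `|complex.Im (w ord0 k - z ord0 k)|) @^-1` `]-oo, d[%classic)); last first.
      by apply/seteqP; split => w h k; rewrite /= ?in_itv/=; [move=> _; exact: h|have := h k I; rewrite /= !in_itv].
    apply: fin_bigcap_measurable => [|k _]; first exact: finite_finset.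
    have [mr mi] : cmeas (fun w : Cn => w ord0 k - z ord0 k).
      by apply: cmeasB; [exact: cmeas_coord|exact: cmeas_cst].
    by apply: measurableI; rewrite -[X in measurable X]setTI; apply: measurableT_comp (measurable_itv _) => //.
  by move=> w Bw; apply: hA => /= h; apply: no; exists w.
have hr1 : normc (f w - f z) < 1.
  apply: hr => k; apply: le_lt_trans (normc_le_ReIm _) _; rewrite (splitr r).
  by have [h1 h2] := Bw k; apply: ltrD; [apply: lt_le_trans h1 _|apply: lt_le_trans h2 _]; rewrite ge_min lexx.
have sq : sqnormC w <= sqnormC z *+ 2 + 2.
  have -> : w = z + (w - z) by rewrite addrC subrK.
  apply: le_trans (sqnormCD _ _) _; rewrite lerD2l -[leRHS]/(1 *+ 2) lerMn2r/=.
  rewrite sqnormCE; apply: (@le_trans _ _ (\sum_(k < n) n.+1%:R^-1)); last first.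
    rewrite sumr_const card_ord -[_ *+ n]mulr_natl ler_pdivrMr ?ltr0n// mul1r ler_nat//.
  apply: ler_sum => k _; have [h1 h2] := Bw k; rewrite !mxE.
  have dle : d <= n.+1%:R^-1 / 2 by rewrite ge_min lexx orbT.
  have n1 : n.+1%:R^-1 <= 1 :> R by rewrite invf_le1 ?ltr0n// ler1n.
  have hs x : `|x| < d -> x ^+ 2 <= n.+1%:R^-1 / 2.
    move=> xd; rewrite -[x ^+ 2]ger0_norm ?sqr_ge0// normrX expr2.
    apply: le_trans (_ : d * 1 <= _); last by rewrite mulr1.
    apply: ler_pM => //; first exact: ltW.
    apply: le_trans (ltW xd) (le_trans dle _); rewrite ler_pdivrMr// mul1r.
    by apply: le_trans n1 _; rewrite ler1n.
  rewrite [leRHS](splitr _); apply: lerD; exact: hs.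
have hw : normc (f w) <= `|M| * expR (c' * sqnormC w).
  rewrite -ler_pdivrMr ?expR_gt0// -expRN -mulNr.
  exact: le_trans Mw (ler_norm _).
have -> : f z = f w - (f w - f z) by rewrite opprB addrC subrK.
apply: le_trans (normcB _ _) _; rewrite mulrDl mul1r addrC lerD//.
  by apply: le_trans (ltW hr1) _; rewrite -expR0 ler_expR mulr_ge0 ?sqnormC_ge0// ltW.
apply: le_trans hw _; rewrite -[leRHS]mulrA -expRD ler_wpM2l// ler_expR.
apply: le_trans (ler_wpM2l (ltW c'0) sq) _.
by rewrite /c' le_eqVlt; apply/orP; left; apply/eqP; field.
Qed.

End SymBound.

Section ComplexDiffAlgebra.
Variable R : realType.
Implicit Types (p q : R[i] -> R[i]).

Lemma complex_diff1_cst (k : R[i]) : complex_diff1 (fun=> k).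
Proof.
move=> z; exists 0 => e e0; exists 1 => // w _.
by rewrite subrr mul0r subr0 ComplexField.Normc.normc0 mulr_ge0 ?normc_ge0// ltW.
Qed.

Lemma complex_diff1_affine (a b : R[i]) : complex_diff1 (fun z => a + z * b).
Proof.
move=> z; exists b => e e0; exists 1 => // w _.
rewrite (_ : a + w * b - (a + z * b) - b * (w - z) = 0); last by ring.
by rewrite ComplexField.Normc.normc0 mulr_ge0 ?normc_ge0// ltW.
Qed.

Lemma complex_diff1_cont p z (e : R) : complex_diff1 p -> 0 < e ->
  exists2 d, 0 < d & forall w, normc (w - z) <= d -> normc (p w - p z) <= e.
Proof.
move=> dp e0; have [A hA] := dp z; have [d d0 hd] := hA 1 ltr01.
have A1 : 0 < normc A + 1 by rewrite ltr_wpDl ?normc_ge0.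
exists (Num.min d (e / (normc A + 1))); first by rewrite lt_min d0 divr_gt0.
move=> w; rewrite le_min => /andP[/hd h]; rewrite ler_pdivlMr// => we.
rewrite (_ : p w - p z = (p w - p z - A * (w - z)) + A * (w - z)); last by ring.
apply: le_trans (normcD _ _) _; rewrite ComplexField.Normc.normcM.
apply: le_trans we; rewrite mul1r in h.
by rewrite [leRHS]mulrDr mulr1 addrC lerD// mulrC.
Qed.

Lemma complex_diff1M p q : complex_diff1 p -> complex_diff1 q -> complex_diff1 (fun z => p z * q z).
Proof.
move=> dp dq z; have [A hA] := dp z; have [B hB] := dq z.
exists (A * q z + p z * B) => e e0.
pose K := normc (q z) + 1 + normc (p z) + 1 + normc A + 1.
have a0 := normc_ge0 A; have q0 := normc_ge0 (q z); have p0 := normc_ge0 (p z).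
have K0 : 0 < K by rewrite /K; lra.
have eK : 0 < e / K by rewrite divr_gt0.
have [d1 d10 h1] := hA _ eK; have [d2 d20 h2] := hB _ eK.
have m0 : 0 < Num.min 1 (e / K) by rewrite lt_min ltr01.
have [d3 d30 h3] := complex_diff1_cont z dq m0.
exists (Num.min d1 (Num.min d2 d3)); first by rewrite !lt_min d10 d20 d30.
move=> w; rewrite !le_min => /and3P[/h1 l1 /h2 l2 /h3]; rewrite le_min => /andP[l3 l4].
set x := normc (w - z) in l1 l2 *; have x0 : 0 <= x by exact: normc_ge0.
rewrite (_ : _ - _ = (p w - p z - A * (w - z)) * q w + (p z * (q w - q z - B * (w - z)) +
  A * (w - z) * (q w - q z))); last by ring.
apply: le_trans (normcD _ _) _; apply: (@le_trans _ _ (e / K * x * (normc (q z) + 1) +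
  (normc (p z) * (e / K * x) + normc A * x * (e / K)))).
  apply: lerD; last first.
    apply: le_trans (normcD _ _) _; rewrite !ComplexField.Normc.normcM; apply: lerD.
      by rewrite ler_wpM2l.
    by rewrite -/x ler_wpM2l// mulr_ge0.
  rewrite ComplexField.Normc.normcM ler_pM ?normc_ge0//.
  rewrite (_ : q w = q z + (q w - q z)); last by ring.
  by apply: le_trans (normcD _ _) _; rewrite lerD2l.
have -> : e * x = e / K * x * K by rewrite mulrAC divfK// gt_eqF.
set y := e / K * x; have y0 : 0 <= y by rewrite mulr_ge0// ltW.
have -> : normc A * x * (e / K) = y * normc A by rewrite /y; ring.
by rewrite [normc (p z) * y]mulrC -!mulrDr ler_wpM2l// /K; lra.
Qed.

End ComplexDiffAlgebra.

(** * Tame functions, their Gaussian means and the reproducing formula *)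

Section Reproducing.
Variables (R : realType) (n : nat).
Local Notation Cn := 'rV[R[i]]_n.
Local Notation mu := (@gauss R n).
Local Notation V := (@lebesgueCn R n).
Implicit Types (F G : Cn -> R[i]) (p q z w a b : Cn).

(* An entire function enters the proof only through its restrictions to complex lines. *)
Definition tame F := [/\ cmeas F, subgauss F & forall p q, complex_diff1 (fun l : R[i] => F (p + l *: q))].

Lemma entire_slice F p q : entire F -> complex_diff1 (fun l : R[i] => F (p + l *: q)).
Proof.
move=> eF l; set z0 := p + l *: q.
have dF : derivable F z0 q by exact: diff_derivable.
exists ('D_q F z0) => e e0.
have /cvgrPdist_le/(_ e%:C) : (fun h : R[i] => h^-1 *: ((F \o shift z0) (h *: q) - F z0)) @ 0^' --> 'D_q F z0.
  exact: dF.
rewrite ltcR => /(_ e0)/nbhs_ballP[r /= r0 hr].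
move: (r0); rewrite ltcE/= => /andP[/eqP ir rr].
exists (complex.Re r / 2); first by rewrite divr_gt0.
move=> w wl; have [->|wl0] := eqVneq w l.
  by rewrite !subrr mulr0 subr0 ComplexField.Normc.normc0 mulr0.
have wl1 : w - l != 0 by rewrite subr_eq0.
have := hr (w - l); rewrite /ball/= sub0r normrN normCE ltcE/= ir eqxx/=.
move=> /(_ _ wl1)/wrap[|]; first by apply: le_lt_trans wl _; rewrite ltr_pdivrMr// ltr_pMr// ltr1n.
have -> : (w - l) *: q + z0 = p + w *: q by rewrite /z0 addrCA -scalerDl subrK.
rewrite normCE lecR => h.
have -> : F (p + w *: q) - F z0 - 'D_q F z0 * (w - l) =
   - ((w - l) * ('D_q F z0 - (w - l)^-1 * (F (p + w *: q) - F z0))).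
  by set d := w - l in wl1 *; field.
by rewrite normcN ComplexField.Normc.normcM mulrC ler_wpM2r ?normc_ge0.
Qed.

Lemma tame_entire F : Sym F -> entire F -> tame F.
Proof.
move=> SF eF; split; [exact: SF.1|exact: Sym_subgauss|by move=> p q; exact: entire_slice].
Qed.

Lemma tameM F G : tame F -> tame G -> tame (fun z => F z * G z).
Proof.
move=> [mF sF dF] [mG sG dG]; split; [exact: cmeasM|exact: subgaussM|].
by move=> p q; apply: (complex_diff1M (dF p q) (dG p q)).
Qed.

Lemma measurable_translate p : measurable_fun setT (fun z : Cn => z + p).
Proof. exact: (lebesgueCn_translate p).1. Qed.

Lemma tame_translate F p : tame F -> tame (fun z => F (z + p)).
Proof.
move=> [mF sF dF]; split; [|exact: subgauss_translate|].
  exact: cmeas_comp mF (measurable_translate p).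
move=> q r; have := dF (q + p) r; congr complex_diff1; apply/funext => l.
by rewrite addrAC.
Qed.

Lemma tame_kernel b : tame (fun z => cexp (dotC z b)).
Proof.
split; [exact: cmeas_kernel|exact: subgauss_cexp|].
move=> p q; have := complex_diff1_comp (@complex_diff1_cexp R) (complex_diff1_affine (dotC p b) (dotC q b)).
by congr complex_diff1; apply/funext => l; rewrite dotCDl dotCZl.
Qed.

Lemma tame_cst (k : R[i]) : tame (fun=> k).
Proof. by split; [exact: cmeas_cst|exact: subgauss_cst|move=> p q; exact: complex_diff1_cst]. Qed.

(* Averaging over the rotations by 2^N-th roots of unity leaves the Gaussian integral unchanged
   and converges pointwise to the value at the origin. *)
Lemma gauss_mean_value G : tame G -> cint mu G = G 0.
Proof.
move=> [mG sG dG]; rewrite -[RHS](cint_cst n (G 0)); apply/esym.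
have h : (0 : R) < 2^-1 by rewrite invr_gt0.
have [M M0 hM] := sG _ h.
pose u N (j : nat) : R[i] := cexp (0 +i* (j%:R * (2 * pi / 2 ^+ N))).
have u1 N j : normc (u N j) = 1 by rewrite normc_cexp/= expR0.
have mrot N j : cmeas (fun z => G (u N j *: z)).
  exact: cmeas_comp mG (gauss_rotate n (u1 N j)).1.
have irot N j : cintegrable mu (fun z => G (u N j *: z)).
  apply: (gauss_bounded_int (c := 2^-1) (mrot N j)); first by rewrite invf_lt1// ltr1n.
  by exists M => // z; rewrite -(sqnormC_rotate z (u1 N j)).
apply: (dominated_cint_cst (F_ := fun N z => 2 ^- N * \sum_(j < 2 ^ N) G (u N j *: z))
  (g := fun z => M * expR (2^-1 * sqnormC z))).
- by move=> N; apply: cmeasM; [exact: cmeas_cst|apply: cmeas_sum => j; exact: mrot].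
- exact: cmeas_cst.
- rewrite (_ : _ \o _ = (fun z => M%:E * (expR (2^-1 * sqnormC z))%:E)%E)//.
  by apply: integrableZl => //; apply: integrable_gauss_exp; rewrite invf_lt1// ltr1n.
- move=> N z; rewrite ComplexField.Normc.normcM.
  have n2 : normc (2 ^- N : R[i]) = 2 ^- N.
    by rewrite ComplexField.Normc.normcV normcX -(rmorph_nat (real_complex R)) normc_real ger0_norm.
  rewrite n2 mulrC ler_pdivrMr ?exprn_gt0//; apply: le_trans (normc_sum _ _ _) _.
  apply: (@le_trans _ _ (\sum_(j < 2 ^ N) M * expR (2^-1 * sqnormC z))); last first.
    by rewrite sumr_const card_ord -[_ *+ _]mulr_natr natrX.
  by apply: ler_sum => j _; rewrite -(sqnormC_rotate z (u1 N j)).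
- move=> z; have := cvg_root_mean1 (dG 0 z); rewrite /root_mean scale0r addr0.
  by under eq_fun do under eq_bigr do rewrite add0r.
- move=> N; rewrite cintZ ?cint_sum//; last exact: cintegrable_sum.
  under eq_bigr do rewrite (measure_preserving_cint (gauss_rotate n (u1 N _)) mG).
  rewrite sumr_const card_ord -[cint mu G *+ _]mulr_natl natrX mulKf//.
Qed.

Lemma cint_gauss F : cmeas F -> cint mu F = cint V (fun z => F z * (gauss_density z)%:C).
Proof.
move=> [Fr Fi]; congr Complex; congr fine; rewrite integral_gauss//; apply: eq_integral => z _.
  by rewrite cReM/= mulr0 subr0.
by rewrite cImM/= mulr0 add0r.
Qed.

(** After the translation [w = t + z] the exponents combine: [- |t + z|^2 + z.conj (t + z) = - |t|^2
    - t.conj z]. What multiplies the density is [G], which is tame and has the value [F z] at 0. *)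
Lemma reproducing F z : tame F -> cint mu (fun w => F w * cexp (dotC z (conjv w))) = F z.
Proof.
move=> tF; pose G t := F (t + z) * cexp (dotC t (- conjv z)).
have tG : tame G by apply: tameM; [exact: tame_translate|exact: tame_kernel].
have mH : cmeas (fun w => F w * cexp (dotC z (conjv w))).
  by case: tF => mF _ _; apply: cmeasM => //; exact: cmeas_kernel_conj.
transitivity (cint mu G); last by rewrite gauss_mean_value// /G add0r -[0](scale0r z) dotCZl mul0r cexp0 mulr1.
have md : cmeas (fun w : Cn => (gauss_density w)%:C).
  by split => /=; [exact: measurable_gauss_density|exact: measurable_cst].
rewrite !cint_gauss//; last by case: tG.
rewrite -(measure_preserving_cint (lebesgueCn_translate z)); last exact: cmeasM.
apply: eq_cint => t; rewrite /G -[LHS]mulrA -[RHS]mulrA; congr (_ * _).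
have E w : (gauss_density w)%:C = (pi ^+ n)^-1%:C * cexp (- dotC w (conjv w)) :> R[i].
  rewrite /gauss_density rmorphM; congr (_ * _).
  by rewrite -sqnormC_dotC -rmorphN /cexp/= cos0 sin0 mulr1.
rewrite !E !(mulrCA _ (pi ^+ n)^-1%:C) -!cexpD; congr (_ * cexp _).
rewrite !(conjvD, dotCDl, dotCDr, dotCNr); ring.
Qed.

Lemma reproducing_conj F z : tame F ->
  cint mu (fun w => (F w)^* * cexp (dotC w (conjv z))) = (F z)^*.
Proof.
move=> tF; rewrite -[in RHS](reproducing z tF) -cint_conj.
  by apply: eq_cint => w; rewrite rmorphM/= (kernel_conj z w) conjCK.
apply: subgauss_int; first by case: tF => mF _ _; apply: cmeasM => //; exact: cmeas_kernel_conj.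
by case: tF => _ sF _; apply: subgaussM => //; exact: subgauss_kernel_conj.
Qed.

End Reproducing.

(** * The operator v^*(conj z - d_z) as an integral *)

Section ShiftPow.
Variables (R : realType) (n : nat).
Local Notation Cn := 'rV[R[i]]_n.
Local Notation mu := (@gauss R n).
Implicit Types (F Q f : Cn -> R[i]) (z w : Cn).

Definition gauss_transform Q z : R[i] := cint mu (fun w => Q w * cexp (dotC z (conjv w))).

Lemma integrable_normc_subgauss F : cmeas F -> subgauss F ->
  mu.-integrable setT (EFin \o (fun w => normc (F w))).
Proof.
move=> mF sF; have h : (0 : R) < 2^-1 by rewrite invr_gt0.
have [M M0 hM] := sF _ h.
have iG : mu.-integrable setT (fun z : Cn => (M * expR (2^-1 * sqnormC z))%:E).
  under eq_fun do rewrite EFinM.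
  by apply: integrableZl => //; apply: integrable_gauss_exp; rewrite invf_lt1// ltr1n.
apply: (le_integrable _ _ _ iG) => //; first exact/measurable_EFinP/measurable_normc.
by move=> w _ /=; rewrite lee_fin ger0_norm ?normc_ge0// (le_trans (hM w))// ler_norm.
Qed.

Lemma subgauss_exp_normc_coord k : subgauss (fun w : Cn => (expR (normc (w ord0 k)))%:C).
Proof.
move=> c c0; exists (expR (4 * c)^-1); rewrite ?expR_ge0// => z.
rewrite normc_real ger0_norm ?expR_ge0// -expRD ler_expR.
set x := normc _.
have hx : x ^+ 2 <= sqnormC z.
  by rewrite sqnormC_sum (bigD1 k)//= lerDl sumr_ge0// => j _; rewrite sqr_ge0.
apply: (@le_trans _ _ ((4 * c)^-1 + c * x ^+ 2)); last by rewrite lerD2l ler_wpM2l// ltW.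
have -> : (4 * c)^-1 + c * x ^+ 2 = (4 * c)^-1 * (2 * c * x - 1) ^+ 2 + x.
  by field; rewrite gt_eqF.
by rewrite lerDr mulr_ge0 ?sqr_ge0// invr_ge0 mulr_ge0// ltW.
Qed.

Lemma cmeas_exp_normc_coord k : cmeas (fun w : Cn => (expR (normc (w ord0 k)))%:C).
Proof.
split => /=; last exact: measurable_cst.
by apply: measurableT_comp => //; apply: measurable_normc; exact: cmeas_coord.
Qed.

Lemma subgauss_coord_conj k : subgauss (fun w : Cn => (w ord0 k)^*).
Proof. by apply: subgauss_conj; exact: subgauss_coord. Qed.

Lemma cmeas_coord_conj k : cmeas (fun w : Cn => (w ord0 k)^*).
Proof. by apply: cmeas_conj; exact: cmeas_coord. Qed.

(** The error is the integral of [Q e^(z.conj w)] times the quadratic remainder of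
    [cexp (t conj w_k)], divided by [t]. It is of order [t] with an integrable coefficient, so that
    no limit theorem for integrals is called. The 8 is 4 from the remainder times 2 from
    [normc_cint_le]. *)
Lemma gauss_transform_quotient Q k z : cmeas Q -> subgauss Q -> exists2 C : R, 0 <= C &
  forall t : R[i], t != 0 -> normc t <= 1 ->
  normc (gauss_transform (fun w => Q w * (w ord0 k)^*) z -
    t^-1 * (gauss_transform Q (t *: delta_mx ord0 k + z) - gauss_transform Q z)) <= C * normc t.
Proof.
move=> mQ sQ; pose E w := cexp (dotC z (conjv w)).
pose B w := Q w * E w * (w ord0 k * w ord0 k * (expR (normc (w ord0 k)))%:C).
have mE : cmeas E by exact: cmeas_kernel_conj.
have sE : subgauss E by exact: subgauss_kernel_conj.
have mB : cmeas B.
  apply: cmeasM; first exact: cmeasM.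
  apply: cmeasM; [apply: cmeasM; exact: cmeas_coord|exact: cmeas_exp_normc_coord].
have sB : subgauss B.
  apply: subgaussM; first exact: subgaussM.
  apply: subgaussM; [apply: subgaussM; exact: subgauss_coord|exact: subgauss_exp_normc_coord].
have iB := integrable_normc_subgauss mB sB.
exists (Rintegral mu setT (fun w => normc (B w)) *+ 8).
  by rewrite mulrn_wge0// Rintegral_ge0// => w _; exact: normc_ge0.
move=> t t0 t1.
have i1 : cintegrable mu (fun w => Q w * (w ord0 k)^* * E w).
  apply: subgauss_int; first by apply: cmeasM => //; apply: cmeasM => //; exact: cmeas_coord_conj.
  by apply: subgaussM => //; apply: subgaussM => //; exact: subgauss_coord_conj.
have iz y : cintegrable mu (fun w => Q w * cexp (dotC y (conjv w))).
  apply: subgauss_int; first by apply: cmeasM => //; exact: cmeas_kernel_conj.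
  by apply: subgaussM => //; exact: subgauss_kernel_conj.
rewrite /gauss_transform -cintB// -cintZ; last exact: cintegrableB.
rewrite -cintB//; last by apply: cintegrableZ; exact: cintegrableB.
pose D w := - t^-1 * (Q w * E w * (cexp (t * (w ord0 k)^*) - 1 - t * (w ord0 k)^*)).
rewrite (eq_cint _ (G := D)); last first.
  move=> w; rewrite /D dotCDl dotCZl.
  have -> : dotC (delta_mx ord0 k) (conjv w) = (w ord0 k)^*.
    rewrite /dotC (bigD1 k)//= big1 ?addr0; last by move=> j jk; rewrite !mxE (negbTE jk) mul0r.
    by rewrite !mxE !eqxx mul1r.
  by rewrite cexpD -/(E w); field.
have mD : cmeas D.
  apply: cmeasM; first exact: cmeas_cst.
  apply: cmeasM; first exact: cmeasM.
  have mt : cmeas (fun w : Cn => t * (w ord0 k)^*).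
    by apply: cmeasM; [exact: cmeas_cst|exact: cmeas_coord_conj].
  by apply: cmeasB => //; apply: cmeasB; [exact: cmeas_cexp|exact: cmeas_cst].
have -> : Rintegral mu setT (fun w => normc (B w)) *+ 8 * normc t =
    Rintegral mu setT (fun w => normc t *+ 4 * normc (B w)) *+ 2.
  by rewrite RintegralZl//; ring.
apply: normc_cint_le => //.
  rewrite (_ : _ \o _ = (fun w => (normc t *+ 4)%:E * (normc (B w))%:E)%E)//.
  exact: integrableZl.
move=> w; rewrite /D /B (ComplexField.Normc.normcM (- t^-1)) 2!(ComplexField.Normc.normcM (Q w * E w)).
rewrite (ComplexField.Normc.normcM (Q w)) normcN ComplexField.Normc.normcV.
rewrite (ComplexField.Normc.normcM (w ord0 k * w ord0 k)) (ComplexField.Normc.normcM (w ord0 k)).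
rewrite normc_real (ger0_norm (expR_ge0 _)).
have nt0 : 0 < normc t.
  by rewrite lt_neqAle normc_ge0 andbT eq_sym; apply: contra t0 => /eqP/ComplexField.Normc.eq0_normc ->.
set x := normc (w ord0 k); have x0 : 0 <= x by exact: normc_ge0.
have h := normc_cexpB1B (t * (w ord0 k)^*).
rewrite ComplexField.Normc.normcM normc_conj -/x in h.
rewrite mulrC ler_pdivrMr//.
rewrite [leRHS](_ : _ = normc (Q w) * normc (E w) * ((normc t * x) ^+ 2 * expR x *+ 4)); last by ring.
rewrite ler_wpM2l ?mulr_ge0 ?normc_ge0//; apply: le_trans h _.
by rewrite lerMn2r/= ler_wpM2l ?sqr_ge0// ler_expR ler_piMl.
Qed.

Lemma pderiv_gauss_transform Q k : cmeas Q -> subgauss Q ->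
  pderiv k (gauss_transform Q) = gauss_transform (fun w => Q w * (w ord0 k)^*).
Proof.
move=> mQ sQ; apply/funext => z; rewrite /pderiv /derive; apply: cvg_lim => //.
have [C C0 hC] := gauss_transform_quotient k z mQ sQ.
apply/cvgrPdist_le => e e0; move: (e0); rewrite ltcE/= => /andP[/eqP ie re].
have C1 : 0 < C + 1 by rewrite ltr_wpDl.
pose d := Num.min 1 (complex.Re e / (C + 1)).
have d0 : 0 < d by rewrite lt_min ltr01 divr_gt0.
have dc0 : 0 < d%:C :> R[i] by rewrite ltcR.
near=> t.
have t0 : t != 0 by near: t; exact: nbhs_dnbhs_neq.
have td : normc t <= d.
  have : `|t| <= d%:C by near: t; exact: dnbhs0_le.
  by rewrite normCE lecR.
have t1 : normc t <= 1 by rewrite (le_trans td)// ge_min lexx.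
rewrite normCE lecE/= ie eqxx/=; apply: le_trans (hC t t0 t1) _.
apply: (@le_trans _ _ ((C + 1) * d)).
  by apply: ler_pM => //; [exact: normc_ge0|rewrite lerDl].
by rewrite mulrC -ler_pdivlMr// ge_min lexx orbT.
Unshelve. all: by end_near.
Qed.

Lemma cmeas_conj_monomial (j : multi_index n) (s : seq 'I_n) :
  cmeas (fun w : Cn => \prod_(k <- s) (w ord0 k)^* ^+ j k).
Proof. by apply: cmeas_prod => k; apply: cmeasX; exact: cmeas_coord_conj. Qed.

Lemma subgaussX F m : subgauss F -> subgauss (fun w => F w ^+ m).
Proof.
move=> sF; elim: m => [|m IH]; first exact: subgauss_cst.
by have := subgaussM sF IH; congr subgauss; apply/funext => w; rewrite exprS.
Qed.

Lemma subgauss_conj_monomial (j : multi_index n) (s : seq 'I_n) :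
  subgauss (fun w : Cn => \prod_(k <- s) (w ord0 k)^* ^+ j k).
Proof.
elim: s => [|k s IH].
  by have := @subgauss_cst R n 1; congr subgauss; apply/funext => w; rewrite big_nil.
have := subgaussM (subgaussX (j k) (@subgauss_coord_conj k)) IH.
by congr subgauss; apply/funext => w; rewrite big_cons.
Qed.

Lemma mderiv_gauss_transform Q (j : multi_index n) : cmeas Q -> subgauss Q ->
  mderiv j (gauss_transform Q) = gauss_transform (fun w => Q w * \prod_k (w ord0 k)^* ^+ j k).
Proof.
move=> mQ sQ; rewrite /mderiv.
have iterE k m P : cmeas P -> subgauss P ->
    iter m (pderiv k) (gauss_transform P) = gauss_transform (fun w => P w * (w ord0 k)^* ^+ m).
  move=> mP sP; elim: m => [|m IH].
    by congr gauss_transform; apply/funext => w; rewrite expr0 mulr1.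
  rewrite iterS IH pderiv_gauss_transform.
  - by congr gauss_transform; apply/funext => w; rewrite exprSr mulrA.
  - by apply: cmeasM => //; apply: cmeasX; exact: cmeas_coord_conj.
  - by apply: subgaussM => //; apply: subgaussX; exact: subgauss_coord_conj.
suff H s : foldr (fun k F => iter (j k) (pderiv k) F) (gauss_transform Q) s =
    gauss_transform (fun w => Q w * \prod_(k <- s) (w ord0 k)^* ^+ j k).
  by rewrite H; congr gauss_transform; apply/funext => w; rewrite big_enum.
elim: s => [|k s IH] /=.
  by congr gauss_transform; apply/funext => w; rewrite big_nil mulr1.
rewrite IH iterE; last 2 first.
- by apply: cmeasM => //; exact: cmeas_conj_monomial.
- by apply: subgaussM => //; exact: subgauss_conj_monomial.
by congr gauss_transform; apply/funext => w; rewrite big_cons; ring.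
Qed.

Lemma gauss_transform_tame f : tame f -> gauss_transform f = f.
Proof. by move=> tf; apply/funext => z; exact: reproducing. Qed.

(** Derivatives of all orders of a function assumed differentiable only once are obtained by writing
    it as its own transform. *)
Lemma mderiv_tame f (j : multi_index n) z : tame f ->
  mderiv j f z = cint mu (fun w => f w * \prod_k (w ord0 k)^* ^+ j k * cexp (dotC z (conjv w))).
Proof.
move=> tf; have [mf sf _] := tf.
by rewrite -{1}(gauss_transform_tame tf) mderiv_gauss_transform.
Qed.

Lemma cintegrable_conj_monomial f (j : multi_index n) z : tame f ->
  cintegrable mu (fun w => f w * \prod_k (w ord0 k)^* ^+ j k * cexp (dotC z (conjv w))).
Proof.
move=> [mf sf _]; apply: subgauss_int.
  apply: cmeasM; last exact: cmeas_kernel_conj.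
  by apply: cmeasM => //; exact: cmeas_conj_monomial.
apply: subgaussM; last exact: subgauss_kernel_conj.
by apply: subgaussM => //; exact: subgauss_conj_monomial.
Qed.

Lemma binomial_multi (i : multi_index n) (x y : 'I_n -> R[i]) :
  \prod_k (x k - y k) ^+ i k =
  \sum_(l : {ffun 'I_n -> 'I_(mweight i).+1} | [forall k, l k <= i k]%N)
    (\prod_k 'C(i k, l k))%N%:R * (-1) ^+ (\sum_k (i k - l k))%N *
    (\prod_k x k ^+ l k) * (\prod_k y k ^+ (i k - l k)).
Proof.
(* The range of each sum is widened to [(mweight i).+1], the same for all [k], to match the index
   set of [shift_pow]. *)
have E k : (x k - y k) ^+ i k =
    \sum_(l < (mweight i).+1 | (l <= i k)%N) 'C(i k, l)%:R * (-1) ^+ (i k - l) * x k ^+ l * y k ^+ (i k - l).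
  have ik : (i k < (mweight i).+1)%N by rewrite ltnS /mweight (bigD1 k)//= leq_addr.
  rewrite addrC exprDn (big_ord_widen _ (fun l => (- y k) ^+ (i k - l) * x k ^+ l *+ 'C(i k, l)) ik).
  by apply: eq_bigr => l _; rewrite -mulr_natl [(- y k) ^+ _]exprNn; ring.
under eq_bigr do rewrite E.
rewrite bigA_distr_big_dep/=; apply: eq_big => [l|l _].
  by apply/familyP/forallP.
by rewrite !big_split/= natr_prod prodrXr.
Qed.

Lemma shift_powE f (i : multi_index n) z : tame f ->
  shift_pow i f z = cint mu (fun w => f w * cexp (dotC z (conjv w)) *
    \prod_k ((z ord0 k)^* - (w ord0 k)^*) ^+ i k).
Proof.
move=> tf; rewrite /shift_pow.
under eq_bigr => l _.
  rewrite (mderiv_tame _ _ tf) -cintZ; last exact: cintegrable_conj_monomial.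
  over.
rewrite -cint_sum; last by move=> l; apply: cintegrableZ; exact: cintegrable_conj_monomial.
apply: eq_cint => w; rewrite binomial_multi mulr_sumr; apply: eq_bigr => l _.
have e1 : \prod_k (conjv z ord0 k) ^+ l k = \prod_k (z ord0 k)^* ^+ l k.
  by apply: eq_bigr => k _; rewrite mxE.
have e2 : \prod_k (w ord0 k)^* ^+ [ffun k => (i k - l k)%N] k = \prod_k (w ord0 k)^* ^+ (i k - l k).
  by apply: eq_bigr => k _; rewrite ffunE.
rewrite e1 e2.
by ring.
Qed.

End ShiftPow.

(** * The exponential series over multi-indices as an unordered sum *)

Section MultiExponential.
Variables (R : realType) (n : nat).
Implicit Types (zeta : 'I_n -> R[i]) (x : 'I_n -> R) (N M : nat) (J : {fset (multi_index n)}).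

(** Boxes are cofinal among the finite sets of multi-indices, and over a box the exponential series
    factors into one-variable partial sums. *)
Definition index_box N : {fset (multi_index n)} :=
  seq_fset tt [seq [ffun k => nat_of_ord (l k)] | l : {ffun 'I_n -> 'I_N}].

Lemma index_boxP N (i : multi_index n) : reflect (forall k, (i k < N)%N) (i \in index_box N).
Proof.
rewrite seq_fsetE; apply: (iffP mapP) => [[l _ ->] k|h]; first by rewrite ffunE.
exists [ffun k => Ordinal (h k)]; first by rewrite mem_enum.
by apply/ffunP => k; rewrite !ffunE.
Qed.

Lemma sum_index_box (K : nmodType) N (F : multi_index n -> K) :
  \sum_(i <- index_box N) F i = \sum_(l : {ffun 'I_n -> 'I_N}) F [ffun k => nat_of_ord (l k)].
Proof.
rewrite (perm_big [seq [ffun k => nat_of_ord (l k)] | l : {ffun 'I_n -> 'I_N}])/=.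
  by rewrite big_image.
apply: uniq_perm; [exact: (fset_uniq (index_box N))| |exact: (seq_fsetE tt)].
rewrite map_inj_uniq ?enum_uniq// => l l' /ffunP h; apply/ffunP => k; apply: val_inj.
by have := h k; rewrite !ffunE.
Qed.

Lemma sub_index_box J : exists N, (J `<=` index_box N)%fset.
Proof.
exists (\max_(i <- J) mweight i).+1; apply/fsubsetP => i iJ; apply/index_boxP => k.
rewrite ltnS; apply: leq_trans (_ : (mweight i <= _)%N); first by rewrite /mweight (bigD1 k)//= leq_addr.
by rewrite (big_rem i)//= leq_maxl.
Qed.

Lemma index_boxS N M : (N <= M)%N -> (index_box N `<=` index_box M)%fset.
Proof.
move=> NM; apply/fsubsetP => i /index_boxP h; apply/index_boxP => k.
exact: leq_trans (h k) NM.
Qed.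

Definition exp_term zeta (i : multi_index n) : R[i] := \prod_k (zeta k ^+ i k / (i k)`!%:R).

Lemma sum_box_exp_term zeta N :
  \sum_(i <- index_box N) exp_term zeta i = \prod_k cexp_part N (zeta k).
Proof.
rewrite sum_index_box /cexp_part bigA_distr_bigA/=; apply: eq_bigr => l _.
by apply: eq_bigr => k _; rewrite ffunE.
Qed.

Lemma cvg_prod_cexp_part (s : seq 'I_n) zeta :
  normc (\prod_(k <- s) cexp (zeta k) - \prod_(k <- s) cexp_part N (zeta k)) @[N --> \oo] --> (0 : R).
Proof.
elim: s => [|k s IH].
  by under eq_fun do rewrite !big_nil subrr ComplexField.Normc.normc0; exact: cvg_cst.
pose a := cexp (zeta k); pose b := \prod_(k <- s) cexp (zeta k).
pose da N := normc (a - cexp_part N (zeta k)).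
pose db N := normc (b - \prod_(k <- s) cexp_part N (zeta k)).
have ha : da N @[N --> \oo] --> (0 : R) by exact: cvg_cexp_part.
apply: (@squeeze_cvgr _ _ _ _ (fun=> 0) (fun N => da N * normc b + (normc a + da N) * db N)).
- apply: nearW => N; rewrite normc_ge0/= !big_cons -/a -/b.
  set a' := cexp_part N (zeta k); set b' := \prod_(_ <- s) _.
  rewrite (_ : a * b - a' * b' = (a - a') * b + a' * (b - b')); last by ring.
  apply: le_trans (normcD _ _) _; rewrite !ComplexField.Normc.normcM lerD2l.
  rewrite ler_wpM2r ?normc_ge0// /da -/a' (_ : normc a' = normc (a - (a - a'))); last by congr normc; ring.
  exact: normcB.
- exact: cvg_cst.
- rewrite -[X in _ --> X](_ : 0 * normc b + (normc a + 0) * 0 = 0); last by ring.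
  by apply: cvgD; [apply: cvgMl|apply: cvgM => //; apply: cvgD => //; exact: cvg_cst].
Qed.

(** An index outside the box has a coordinate at least [N], so that [rho^N <= rho^|i|]. The
    geometric gain in [N] is paid for by inflating the arguments by [rho]. *)
Lemma normc_exp_term_le zeta N (rho : R) (i : multi_index n) : 1 <= rho -> i \notin index_box N ->
  normc (exp_term zeta i) <= rho ^- N * \prod_k ((rho * normc (zeta k)) ^+ i k / (i k)`!%:R).
Proof.
move=> rho1 iN; have rho0 : 0 < rho by rewrite (lt_le_trans ltr01).
have E : normc (exp_term zeta i) = \prod_k (normc (zeta k) ^+ i k / (i k)`!%:R).
  rewrite normc_prod; apply: eq_bigr => k _.
  rewrite ComplexField.Normc.normcM normcX ComplexField.Normc.normcV.
  by rewrite -(rmorph_nat (real_complex R)) normc_real ger0_norm.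
have [k0 Nk0] : exists k0, (N <= i k0)%N.
  apply: contrapT => no; move/index_boxP: iN; apply => k; rewrite ltnNge; apply/negP => Nk.
  by apply: no; exists k.
rewrite E; under [X in _ <= _ * X]eq_bigr do rewrite exprMn -mulrA.
rewrite [X in _ <= _ * X]big_split/= prodrXr mulrA ler_peMl//.
  by apply: prodr_ge0 => k _; rewrite mulr_ge0 ?exprn_ge0 ?normc_ge0.
rewrite mulrC ler_pdivlMr ?exprn_gt0// mul1r ler_weXn2l//.
by apply: leq_trans Nk0 _; rewrite (bigD1 k0)//= leq_addr.
Qed.

(** The bound is uniform in the finite sets that contain the box, as unordered summation demands. *)
Lemma exp_tail zeta N (rho : R) J : 1 <= rho -> (index_box N `<=` J)%fset ->
  normc (cexp (\sum_k zeta k) - \sum_(i <- J) exp_term zeta i) <=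
  rho ^- N * expR (rho * \sum_k normc (zeta k)).
Proof.
move=> rho1 NJ; have rho0 : 0 < rho by rewrite (lt_le_trans ltr01).
apply/ler_addgt0Pr => e e0.
have [M0 JM0] := sub_index_box J.
have /cvgrPdist_le/(_ e e0)[M1 _ hM1] := cvg_prod_cexp_part (index_enum 'I_n) zeta.
(* [J] is completed to a box so large that its sum is within [e] of the exponential; the indices
   added are outside the box [N]. *)
pose M := maxn M0 M1.
have JM : (J `<=` index_box M)%fset by apply: fsubset_trans JM0 _; apply: index_boxS; exact: leq_maxl.
have h1 := hM1 M (leq_maxr _ _); rewrite /= sub0r normrN ger0_norm ?normc_ge0// in h1.
rewrite -cexp_sum -sum_box_exp_term in h1.
pose F i := if i \in J then 0 else exp_term zeta i.
have -> : \sum_(i <- J) exp_term zeta i = \sum_(i <- index_box M) (exp_term zeta i - F i).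
  rewrite -(big_fset_incl _ JM) => [|i _ /negbTE iJ]; last by rewrite /F iJ subrr.
  by apply: eq_big_seq => i iJ; rewrite /F iJ subr0.
rewrite sumrB opprB addrA addrAC; apply: le_trans (normcD _ _) _; rewrite [leRHS]addrC; apply: lerD; first exact: h1.
apply: le_trans (normc_sum _ _ _) _.
apply: (@le_trans _ _ (\sum_(i <- index_box M) rho ^- N * \prod_k ((rho * normc (zeta k)) ^+ i k / (i k)`!%:R))).
  rewrite big_seq [leRHS]big_seq; apply: ler_sum => i _; rewrite /F; case: ifPn => iJ.
    rewrite ComplexField.Normc.normc0 mulr_ge0 ?invr_ge0 ?exprn_ge0 ?(ltW rho0)// prodr_ge0// => k _.
    by rewrite mulr_ge0 ?exprn_ge0// mulr_ge0 ?normc_ge0// ltW.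
  by apply: normc_exp_term_le => //; apply: contra iJ; exact: (fsubsetP NJ).
rewrite -mulr_sumr ler_wpM2l ?invr_ge0 ?exprn_ge0 ?(ltW rho0)// sum_index_box mulr_sumr expR_sum.
have -> : \sum_(l : {ffun 'I_n -> 'I_M}) \prod_k ((rho * normc (zeta k)) ^+
      ([ffun k0 => nat_of_ord (l k0)] : multi_index n) k / (([ffun k0 => nat_of_ord (l k0)] : multi_index n) k)`!%:R) =
    \prod_k \sum_(m < M) (rho * normc (zeta k)) ^+ m / m`!%:R.
  by rewrite bigA_distr_bigA/=; apply: eq_bigr => l _; apply: eq_bigr => k _; rewrite ffunE.
apply: ler_prod => k _; apply/andP; split.
  apply: sumr_ge0 => m _; by rewrite mulr_ge0 ?exprn_ge0// mulr_ge0 ?normc_ge0// ltW.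
by apply: exp_part_le; rewrite mulr_ge0 ?normc_ge0// ltW.
Qed.

End MultiExponential.

(** * The Taylor series under the integral sign *)

Section ShiftStar.
Variables (R : realType) (n : nat).
Local Notation Cn := 'rV[R[i]]_n.
Local Notation mu := (@gauss R n).
Local Notation rho := (9 / 8 : R).
Implicit Types (f v : Cn -> R[i]) (z w s t x : Cn).

Lemma integrable_gauss_expM (c M : R) : c < 1 ->
  mu.-integrable setT (EFin \o (fun z => M * expR (c * sqnormC z))).
Proof.
move=> c1; rewrite (_ : _ \o _ = (fun z => M%:E * (expR (c * sqnormC z))%:E)%E)//.
by apply: integrableZl => //; exact: integrable_gauss_exp.
Qed.

Lemma dotC0l z : dotC 0 z = 0.
Proof. by rewrite /dotC big1// => k _; rewrite mxE mul0r. Qed.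

Definition monomial (i : multi_index n) x : R[i] := \prod_k x ord0 k ^+ i k.

(** At the origin the kernel is 1, so that the derivatives of [v] there are moments of [v]. The
    terms of the Taylor series are thus those of the exponential series under the integral sign. *)
Lemma taylor_coef_monomial v (i : multi_index n) x : tame v ->
  taylor_coef v i * monomial i x =
  cint mu (fun t => v t * exp_term (fun k => x ord0 k * (t ord0 k)^*) i).
Proof.
move=> tv; rewrite /taylor_coef (mderiv_tame _ _ tv) -mulrA mulrC.
rewrite -cintZ; last exact: cintegrable_conj_monomial.
apply: eq_cint => t; rewrite dotC0l cexp0 mulr1.
rewrite /exp_term /monomial /mfact natr_prod -prodfV; under [in RHS]eq_bigr do rewrite exprMn.
rewrite !big_split/=; ring.
Qed.

Lemma cintegrable_exp_term v (i : multi_index n) x : tame v ->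
  cintegrable mu (fun t => v t * exp_term (fun k => x ord0 k * (t ord0 k)^*) i).
Proof.
move=> tv; have h := cintegrableZ (monomial i x / (mfact i)%:R) (cintegrable_conj_monomial i 0 tv).
apply: eq_cintegrable h => t.
rewrite dotC0l cexp0 mulr1.
rewrite /exp_term /monomial /mfact natr_prod -prodfV; under [in RHS]eq_bigr do rewrite exprMn.
rewrite !big_split/=; ring.
Qed.

(* With [rho = 9 / 8], [rho * abs_dot x t <= 3/8 |x|^2 + 27/32 |t|^2]: the second coefficient leaves
   room for the growth of [v] in the integral over [t], and [3/8 |w - s|^2] stays integrable in [s]. *)
Lemma taylor_tail v : tame v -> exists2 C : R, 0 <= C &
  forall N (J : {fset (multi_index n)}) x, (index_box n N `<=` J)%fset ->
  normc (v x - \sum_(i <- J) taylor_coef v i * monomial i x) <=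
    C * rho ^- N * expR (3 / 8 * sqnormC x).
Proof.
move=> tv; have [mv sv _] := tv.
have c0 : (0 : R) < 1 / 32 by rewrite divr_gt0.
have [M M0 hM] := sv _ c0.
exists (Rintegral mu setT (fun t => M * expR (7 / 8 * sqnormC t)) *+ 2).
  by rewrite mulrn_wge0// Rintegral_ge0// => t _; rewrite mulr_ge0// expR_ge0.
move=> N J x NJ.
rewrite -{1}(reproducing x tv); under eq_bigr do rewrite (taylor_coef_monomial _ _ tv).
have iv : cintegrable mu (fun t => v t * cexp (dotC x (conjv t))).
  by apply: subgauss_int; [apply: cmeasM => //; exact: cmeas_kernel_conj|
     apply: subgaussM => //; exact: subgauss_kernel_conj].
have iE i := cintegrable_exp_term i x tv.
rewrite -cint_sum// -cintB//; last exact: cintegrable_sum.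
have mF : cmeas (fun t => v t * cexp (dotC x (conjv t)) -
    \sum_(i <- J) v t * exp_term (fun k => x ord0 k * (t ord0 k)^*) i).
  by apply: (cintegrable_cmeas (m := mu)); apply: cintegrableB => //; exact: cintegrable_sum.
have iG : mu.-integrable setT (EFin \o (fun t =>
    (rho ^- N * expR (3 / 8 * sqnormC x)) * (M * expR (7 / 8 * sqnormC t)))).
  rewrite (_ : _ \o _ = EFin \o (fun t => ((rho ^- N * expR (3 / 8 * sqnormC x)) * M) *
    expR (7 / 8 * sqnormC t))); last by apply/funext => t; rewrite /= mulrA.
  by apply: integrable_gauss_expM; lra.
apply: le_trans (normc_cint_le mF iG _) _; last first.
  rewrite RintegralZl//; last by apply: integrable_gauss_expM; lra.
  by rewrite le_eqVlt; apply/orP; left; apply/eqP; ring.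
move=> t; rewrite -mulr_sumr -mulrBr ComplexField.Normc.normcM.
have E : dotC x (conjv t) = \sum_k x ord0 k * (t ord0 k)^*.
  by apply: eq_bigr => k _; rewrite mxE.
have rho1 : (1 : R) <= rho by lra.
have h := exp_tail (fun k => x ord0 k * (t ord0 k)^*) rho1 NJ.
have ab : \sum_k normc (x ord0 k * (t ord0 k)^*) = abs_dot x t.
  by apply: eq_bigr => k _; rewrite ComplexField.Normc.normcM normc_conj.
rewrite ab in h; rewrite E; apply: le_trans (ler_pM (normc_ge0 _) (normc_ge0 _) (hM t) h) _.
(* Weight 1/3 in [abs_dot_le] gives the rates 1/3 and 3/4, which [rho] turns into 3/8 and 27/32;
   with 1/32 for [v] the second becomes 7/8. *)
have a0 : (0 : R) < 1 / 3 by rewrite divr_gt0.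
have hab := abs_dot_le x t a0.
have -> : rho ^- N * expR (3 / 8 * sqnormC x) * (M * expR (7 / 8 * sqnormC t)) =
    M * rho ^- N * expR (3 / 8 * sqnormC x + 7 / 8 * sqnormC t) by rewrite expRD; ring.
have -> : M * expR (1 / 32 * sqnormC t) * (rho ^- N * expR (rho * abs_dot x t)) =
    M * rho ^- N * expR (1 / 32 * sqnormC t + rho * abs_dot x t) by rewrite expRD; ring.
rewrite ler_wpM2l//; first by rewrite mulr_ge0// invr_ge0 exprn_ge0//; lra.
by rewrite ler_expR; move: hab; have := sqnormC_ge0 x; have := sqnormC_ge0 t; lra.
Qed.

(* Integrating this over [s] gives v^*(conj w - d_w) f(w): expanding [(v (w - s))^*] in powers of
   [conj (w - s)] yields the terms of the series, by [shift_powE]. *)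
Definition star_integrand v f w s : R[i] := f s * (v (w - s))^* * cexp (dotC w (conjv s)).

Lemma measurable_reflect w : measurable_fun setT (fun s : Cn => w - s).
Proof.
apply: measurable_to_Cn => k.
have [mr mi] : cmeas (fun s : Cn => w ord0 k - s ord0 k).
  by apply: cmeasB; [exact: cmeas_cst|exact: cmeas_coord].
by split; under eq_fun do rewrite !mxE.
Qed.

Lemma subgauss_reflect v w : subgauss v -> subgauss (fun s => v (w - s)).
Proof.
move=> sv c c0; have c2 : 0 < c / 2 by rewrite divr_gt0.
have [M M0 hM] := sv _ c2; exists (M * expR (c * sqnormC w)); first by rewrite mulr_ge0 ?expR_ge0.
move=> s; apply: le_trans (hM _) _; rewrite -[leRHS]mulrA -expRD ler_wpM2l// ler_expR.
apply: le_trans (ler_wpM2l (ltW c2) (sqnormCB w s)) _.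
by rewrite le_eqVlt; apply/orP; left; apply/eqP; field.
Qed.

Lemma cmeas_monomial (i : multi_index n) : cmeas (monomial i).
Proof. by apply: cmeas_prod => k; apply: cmeasX; exact: cmeas_coord. Qed.

Lemma subgauss_monomial (i : multi_index n) : subgauss (monomial i).
Proof.
suff -> : monomial i = (fun w => (\prod_k (w ord0 k)^* ^+ i k)^*).
  by apply: subgauss_conj; exact: subgauss_conj_monomial.
apply/funext => w; rewrite rmorph_prod; apply: eq_bigr => k _.
by rewrite rmorphXn/= conjCK.
Qed.

Lemma cintegrable_star v f w : tame v -> tame f -> cintegrable mu (star_integrand v f w).
Proof.
move=> [mv sv _] [mf sf _]; apply: subgauss_int.
  apply: cmeasM; last exact: cmeas_kernel_conj.
  by apply: cmeasM => //; apply: cmeas_conj; exact: (cmeas_comp mv (measurable_reflect w)).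
apply: subgaussM; last exact: subgauss_kernel_conj.
by apply: subgaussM => //; apply: subgauss_conj; exact: subgauss_reflect.
Qed.

Lemma shift_starE v f w : tame v -> tame f ->
  shift_star v f w = cint mu (star_integrand v f w).
Proof.
move=> tv tf; have [C C0 hC] := taylor_tail tv.
have [mv sv _] := tv; have [mf sf _] := tf.
pose fe s := f s * cexp (dotC w (conjv s)).
have mfe : cmeas fe by apply: cmeasM => //; exact: cmeas_kernel_conj.
have sfe : subgauss fe by apply: subgaussM => //; exact: subgauss_kernel_conj.
have c0 : (0 : R) < 1 / 16 by rewrite divr_gt0.
have [M M0 hM] := sfe _ c0.
have mm i : cmeas (fun s => (monomial i (w - s))^*).
  by apply: cmeas_conj; exact: (cmeas_comp (cmeas_monomial i) (measurable_reflect w)).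
have im i : cintegrable mu (fun s => fe s * (monomial i (w - s))^*).
  apply: subgauss_int; first exact: cmeasM.
  by apply: subgaussM => //; apply: subgauss_conj; apply: subgauss_reflect; exact: subgauss_monomial.
have sE i : shift_pow i f w = cint mu (fun s => fe s * (monomial i (w - s))^*).
  rewrite shift_powE//; apply: eq_cint => s; congr (_ * _); rewrite /monomial rmorph_prod.
  by apply: eq_bigr => k _; rewrite !mxE rmorphXn rmorphB.
(* The rate 13/16 in [s] is 1/16 from [fe] plus 3/4, as [3/8 |w - s|^2 <= 3/4 |w|^2 + 3/4 |s|^2]. *)
have tail N (J : {fset (multi_index n)}) : (index_box n N `<=` J)%fset ->
    normc (cint mu (star_integrand v f w) - \sum_(i <- J) (taylor_coef v i)^* * shift_pow i f w) <=
    rho ^- N * (Rintegral mu setT (fun s => M * C * expR (3 / 4 * sqnormC w) *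
      expR (13 / 16 * sqnormC s)) *+ 2).
  move=> NJ; under eq_bigr do rewrite sE -cintZ//.
  have iz i : cintegrable mu (fun s => (taylor_coef v i)^* * (fe s * (monomial i (w - s))^*)).
    exact: cintegrableZ.
  have istar := cintegrable_star w tv tf.
  rewrite -cint_sum// -cintB//; last exact: cintegrable_sum.
  have lt1 : (13 / 16 : R) < 1 by lra.
  rewrite mulrnAr -RintegralZl//; last exact: integrable_gauss_expM.
  have iG : mu.-integrable setT (EFin \o (fun s =>
      rho ^- N * (M * C * expR (3 / 4 * sqnormC w) * expR (13 / 16 * sqnormC s)))).
    rewrite (_ : _ \o _ = EFin \o (fun s => (rho ^- N * (M * C * expR (3 / 4 * sqnormC w))) *
      expR (13 / 16 * sqnormC s))); last by apply/funext => s; rewrite /= mulrA.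
    exact: integrable_gauss_expM.
  apply: normc_cint_le => //.
    by apply: (cintegrable_cmeas (m := mu)); apply: cintegrableB => //; exact: cintegrable_sum.
  move=> s; rewrite (_ : _ - _ = fe s * (v (w - s) - \sum_(i <- J) taylor_coef v i * monomial i (w - s))^*); last first.
    rewrite rmorphB rmorph_sum mulrBr mulr_sumr /star_integrand /fe; congr (_ - _); first by ring.
    by apply: eq_bigr => i _; rewrite [X in _ = _ * X]rmorphM mulrCA.
  rewrite ComplexField.Normc.normcM normc_conj.
  apply: le_trans (ler_pM (normc_ge0 _) (normc_ge0 _) (hM s) (hC N J (w - s) NJ)) _.
  have -> : rho ^- N * (M * C * expR (3 / 4 * sqnormC w) * expR (13 / 16 * sqnormC s)) =
    M * C * rho ^- N * expR (3 / 4 * sqnormC w + 13 / 16 * sqnormC s) by rewrite expRD; ring.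
  have -> : M * expR (1 / 16 * sqnormC s) * (C * rho ^- N * expR (3 / 8 * sqnormC (w - s))) =
    M * C * rho ^- N * expR (1 / 16 * sqnormC s + 3 / 8 * sqnormC (w - s)) by rewrite expRD; ring.
  rewrite ler_wpM2l//; first by rewrite !mulr_ge0// invr_ge0 exprn_ge0//; lra.
  by rewrite ler_expR; move: (sqnormCB w s); lra.
set K := Rintegral _ _ _ *+ 2 in tail.
have K0 : 0 <= K.
  by rewrite mulrn_wge0// Rintegral_ge0// => s _; rewrite !mulr_ge0 ?expR_ge0.
(* The unordered sum is the limit along the finite sets ordered by inclusion, and the sets
   containing a given box form a member of this filter. *)
have FF : ProperFilter (@totally (multi_index n)) := @totally_filter _.
rewrite /shift_star /summability.sum; apply: cvg_lim => //.
refine (proj2 (@cvgrPdist_le _ _ _ totally FF _ _) _).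
move=> e e0; move: (e0); rewrite ltcE/= => /andP[/eqP ie re].
have [N hN] : exists N, rho ^- N * K <= complex.Re e.
  have q1 : `|(8 / 9 : R)| < 1 by rewrite ger0_norm; lra.
  have cv : (fun N => K * (8 / 9 : R) ^+ N) @ \oo --> (0 : R) by exact: cvg_geometric.
  have /cvgrPdist_le/(_ _ re)[N _ h] := cv; exists N.
  have := h N (leqnn _); rewrite /= sub0r normrN ger0_norm; last by rewrite mulr_ge0// exprn_ge0//; lra.
  by rewrite mulrC -exprVn (_ : rho^-1 = 8 / 9)//; field.
exists (index_box n N) => // J /= NJ.
rewrite normCE lecE/= ie eqxx/=; apply: le_trans hN; apply: le_trans (tail N J NJ).
by rewrite /partial_sum -(big_seq_fsetE _ _ xpredT (fun i => (taylor_coef v i)^* * shift_pow i f w)).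
Qed.

End ShiftStar.

(** * Products of Toeplitz operators on the kernels *)

Section StarTransform.
Variables (R : realType) (n : nat).
Local Notation Cn := 'rV[R[i]]_n.
Local Notation mu := (@gauss R n).
Implicit Types (f v : Cn -> R[i]) (z w s a : Cn).

Definition star v f w : R[i] := cint mu (star_integrand v f w).

(** Integrated against a symbol it gives the value at [z] of the Toeplitz operator applied to
    [K_a]. *)
Definition kernel_pair a z w : R[i] := cexp (dotC w (conjv a)) * cexp (dotC z (conjv w)).

Lemma cmeas_kernel_pair a z : cmeas (kernel_pair a z).
Proof. by apply: cmeasM; [exact: cmeas_kernel|exact: cmeas_kernel_conj]. Qed.

Lemma subgauss_kernel_pair a z : subgauss (kernel_pair a z).
Proof. by apply: subgaussM; [exact: subgauss_cexp|exact: subgauss_kernel_conj]. Qed.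

Variables (v f : Cn -> R[i]).
Hypotheses (tv : tame v) (tf : tame f).

Let kernel2 a z (p : Cn * Cn) : R[i] := star_integrand v f p.1 p.2 * kernel_pair a z p.1.

Let cmeas_kernel2 a z : cmeas (kernel2 a z).
Proof.
have [mv _ _] := tv; have [mf _ _] := tf.
have m1 k : cmeas (fun p : Cn * Cn => p.1 ord0 k) := cmeas_comp (@cmeas_coord R n k) measurable_fst.
have m2 k : cmeas (fun p : Cn * Cn => p.2 ord0 k) := cmeas_comp (@cmeas_coord R n k) measurable_snd.
have mB : measurable_fun setT (fun p : Cn * Cn => p.1 - p.2).
  apply: measurable_to_Cn => k; have [mr mi] := cmeasB (m1 k) (m2 k).
  by split; under eq_fun do rewrite !mxE.
apply: cmeasM; last exact: cmeas_comp (cmeas_kernel_pair a z) measurable_fst.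
apply: cmeasM.
  apply: cmeasM; first exact: cmeas_comp mf measurable_snd.
  by apply: cmeas_conj; exact: cmeas_comp mv mB.
apply: cmeas_cexp; apply: cmeas_sum => k; apply: cmeasM; first exact: m1.
by apply: cmeas_ext (cmeas_conj (m2 k)) => p; rewrite mxE.
Qed.

(** The rate 1/16 is used for [f], [v] and the pair of kernels. In [w] the sum is 1/8 from
    [v (w - s)], 1/2 from [e^(w.conj s)] and 1/16 from the pair; in [s] it is 1/16 from [f] plus the
    same 1/8 and 1/2. *)
Let kernel2_bound a z : exists2 K : R, 0 <= K & forall w s,
  normc (kernel2 a z (w, s)) <= K * expR (11 / 16 * sqnormC w) * expR (11 / 16 * sqnormC s).
Proof.
have [_ sv _] := tv; have [_ sf _] := tf.
have c0 : (0 : R) < 1 / 16 by rewrite divr_gt0.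
have [M1 M10 h1] := sf _ c0; have [M2 M20 h2] := sv _ c0.
have [M3 M30 h3] := subgauss_kernel_pair a z c0.
exists (M1 * M2 * M3); first by rewrite !mulr_ge0.
move=> w s; rewrite /kernel2 /star_integrand (ComplexField.Normc.normcM _ (kernel_pair a z w)).
rewrite (ComplexField.Normc.normcM (f s * _)) (ComplexField.Normc.normcM (f s)) normc_conj.
have e0 : (0 : R) < 1 / 2 by rewrite divr_gt0.
have h4 := abs_dot_le w s e0; have h5 := sqnormCB w s.
have h6 := normc_cexp_dotC w (conjv s); rewrite abs_dot_conj in h6.
apply: (@le_trans _ _ (M1 * expR (1 / 16 * sqnormC s) * (M2 * expR (1 / 16 * sqnormC (w - s))) *
   expR (abs_dot w s) * (M3 * expR (1 / 16 * sqnormC w)))).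
  by do 3 ?[apply: ler_pM; rewrite ?mulr_ge0 ?normc_ge0//].
rewrite (_ : _ * _ = M1 * M2 * M3 * (expR (1 / 16 * sqnormC s) * expR (1 / 16 * sqnormC (w - s)) *
  expR (abs_dot w s) * expR (1 / 16 * sqnormC w))); last by ring.
rewrite -[leRHS]mulrA -!expRD ler_wpM2l ?mulr_ge0// ler_expR.
by have := sqnormC_ge0 w; have := sqnormC_ge0 s; lra.
Qed.

(** This comes from [kernel2_bound] at [a = z = 0], where the pair of kernels is 1. The rate leaves
    room below 1 for a subgaussian factor. *)
Lemma gauss_bounded_star : gauss_bounded (11 / 16) (star v f).
Proof.
have [K K0 hK] := kernel2_bound 0 0.
have lt1 : (11 / 16 : R) < 1 by lra.
exists (Rintegral mu setT (fun s => K * expR (11 / 16 * sqnormC s)) *+ 2).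
  by rewrite mulrn_wge0// Rintegral_ge0// => s _; rewrite mulr_ge0 ?expR_ge0.
move=> w; rewrite [leRHS]mulrnAl -RintegralZr//; last exact: integrable_gauss_expM.
apply: normc_cint_le; first exact: (cintegrable_cmeas (cintegrable_star w tv tf)).
  rewrite (_ : _ \o _ = EFin \o (fun s => expR (11 / 16 * sqnormC w) * K * expR (11 / 16 * sqnormC s))).
    exact: integrable_gauss_expM.
  by apply/funext => s; rewrite /= mulrC mulrA.
move=> s; have := hK w s; rewrite /kernel2 /kernel_pair dotC0l.
have -> : conjv 0 = 0 :> Cn by apply/rowP => k; rewrite !mxE rmorph0.
by rewrite dotC_sym dotC0l cexp0 !mulr1 mulrAC.
Qed.

Let integrable_kernel2 a z : cintegrable (mu \x mu)%E (kernel2 a z).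
Proof.
have [K K0 hK] := kernel2_bound a z.
have lt1 : (11 / 16 : R) < 1 by lra.
pose g w : R := expR (11 / 16 * sqnormC w).
have ig c : mu.-integrable setT (EFin \o (fun w => c * g w)) by exact: integrable_gauss_expM.
have mg : measurable_fun setT g.
  by apply: measurableT_comp => //; apply: measurable_funM => //; exact: measurable_sqnormC.
apply: (cintegrable_le (G := fun p : Cn * Cn => K * g p.1 * g p.2)); [exact: cmeas_kernel2| |by case=> w s; exact: hK].
apply/integrable12ltyP.
  apply/measurable_EFinP; apply: measurable_funM; last exact: measurableT_comp mg measurable_snd.
  by apply: measurable_funM => //; exact: measurableT_comp mg measurable_fst.
pose I := Rintegral mu setT g.
have fI c : (\int[mu]_s (c * g s)%:E = (c * I)%:E)%E.
  have ig1 : mu.-integrable setT (EFin \o g).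
    by have := ig 1; under eq_fun do rewrite mul1r.
  under eq_integral do rewrite EFinM.
  rewrite integralZl// EFinM; congr (_ * _)%E.
  by rewrite /I /Rintegral fineK// integrable_fin_num.
have E w : (\int[mu]_s `|((EFin \o (fun p : Cn * Cn => (K * g p.1 * g p.2)%R)) (w, s))| = ((K * I) * g w)%:E)%E.
  rewrite [RHS](_ : _ = (K * g w * I)%:E); last by congr EFin; ring.
  rewrite -fI; apply: eq_integral => s _ /=.
  by rewrite ger0_norm// !mulr_ge0 ?expR_ge0.
under eq_integral do rewrite E.
by rewrite fI ltry.
Qed.

Let integrable_kernel2l a z w : cintegrable mu (fun s => kernel2 a z (w, s)).
Proof.
have := cintegrableZ (kernel_pair a z w) (cintegrable_star w tv tf).
by apply: eq_cintegrable => s; rewrite mulrC.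
Qed.

Let integrable_kernel2r a z s : cintegrable mu (fun w => kernel2 a z (w, s)).
Proof.
have [K K0 hK] := kernel2_bound a z.
apply: (cintegrable_le (G := fun w => (K * expR (11 / 16 * sqnormC s)) * expR (11 / 16 * sqnormC w))).
- by apply: (cmeas_comp (cmeas_kernel2 a z)); exact: measurable_fun_pair.
- by apply: integrable_gauss_expM; lra.
- by move=> w; rewrite mulrAC; exact: hK.
Qed.

Lemma cmeas_star : cmeas (star v f).
Proof.
apply: cmeas_ext (cmeas_cint1 (integrable_kernel2 0 0)) => w; apply: eq_cint => s.
rewrite /kernel2 /kernel_pair dotC0l.
have -> : conjv 0 = 0 :> Cn by apply/rowP => k; rewrite !mxE rmorph0.
by rewrite dotC_sym dotC0l cexp0 !mulr1.
Qed.

Lemma star_transform a z :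
  cint mu (fun w => star v f w * kernel_pair a z w) = (v a)^* * cexp (dotC z (conjv a)) * f z.
Proof.
transitivity (cint mu (fun w => cint mu (fun s => kernel2 a z (w, s)))).
  apply: eq_cint => w; rewrite /star mulrC -cintZ; last exact: cintegrable_star.
  by apply: eq_cint => s; rewrite mulrC.
rewrite cint_fubini; [|exact: integrable_kernel2|exact: integrable_kernel2l|exact: integrable_kernel2r].
rewrite -[in RHS](reproducing z tf) -cintZ; last first.
  have [mf sf _] := tf; apply: subgauss_int; first by apply: cmeasM => //; exact: cmeas_kernel_conj.
  by apply: subgaussM => //; exact: subgauss_kernel_conj.
apply: eq_cint => s.
(* For fixed [s] the factors that depend on [w] are the conjugate of [F w] and [e^(w.conj (s + a))].
   Reproducing at [s + a] cancels the shift by [s] and leaves [conj (v a)]; what remains is a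
   reproducing integral for [f]. *)
pose F w := v (w + - s) * cexp (dotC w (conjv z)).
have tF : tame F by apply: tameM; [exact: tame_translate|exact: tame_kernel].
have := reproducing_conj (s + a) tF.
have iF : cintegrable mu (fun w => (F w)^* * cexp (dotC w (conjv (s + a)))).
  have [mF sF _] := tF; apply: subgauss_int.
    by apply: cmeasM; [exact: cmeas_conj|exact: cmeas_kernel].
  by apply: subgaussM; [exact: subgauss_conj|exact: subgauss_cexp].
move=> /(congr1 (fun x => f s * x)); rewrite -cintZ// => E.
transitivity (f s * (F (s + a))^*).
  rewrite -E; apply: eq_cint => w; rewrite /kernel2 /star_integrand /kernel_pair /F rmorphM/=.
  by rewrite -kernel_conj conjvD dotCDr cexpD; ring.
rewrite /F addrC addrA addNr add0r rmorphM/= -kernel_conj conjvD dotCDr cexpD; ring.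
Qed.

End StarTransform.

(** * The product formula tested on the kernels *)

Section ToeplitzOnKernels.
Variables (R : realType) (n : nat).
Local Notation Cn := 'rV[R[i]]_n.
Local Notation mu := (@gauss R n).
Implicit Types (f g u v h F : Cn -> R[i]) (z w a : Cn).

(** Square integrability of [h] enters here: it makes the integral that defines [T_h] on a kernel
    converge. *)
Lemma L2_cintegrableM h F : L2 h -> cmeas F -> subgauss F -> cintegrable mu (fun w => h w * F w).
Proof.
move=> [mh ih] mF sF.
have isq (G : Cn -> R[i]) : cmeas G -> (\int[mu]_z (normc (G z) ^+ 2)%:E < +oo)%E ->
    mu.-integrable setT (fun z => (normc (G z) ^+ 2)%:E).
  move=> mG fG; apply/integrableP; split.
    by apply/measurable_EFinP; apply: measurable_funX; exact: measurable_normc.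
  by under eq_integral do rewrite /= ger0_norm ?sqr_ge0//.
have iF : mu.-integrable setT (fun z => (normc (F z) ^+ 2)%:E).
  have := integrable_normc_subgauss (cmeasM mF mF) (subgaussM sF sF).
  by rewrite (_ : _ \o _ = fun z => (normc (F z) ^+ 2)%:E)//; apply/funext => z;
    rewrite /= ComplexField.Normc.normcM expr2.
apply: (cintegrable_le (G := fun w => normc (h w) ^+ 2 + normc (F w) ^+ 2)).
- exact: cmeasM.
- rewrite (_ : _ \o _ = (fun w => (normc (h w) ^+ 2)%:E + (normc (F w) ^+ 2)%:E)%E)//.
  by apply: integrableD => //; exact: isq.
- move=> w; rewrite ComplexField.Normc.normcM.
  have := sqr_ge0 (normc (h w) - normc (F w)); have := normc_ge0 (h w); have := normc_ge0 (F w).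
  by nra.
Qed.

Lemma toeplitzE f F z : toeplitz f F z = cint mu (fun w => f w * F w * cexp (dotC z (conjv w))).
Proof. by []. Qed.

(** The factors [G j] allow for functions that depend on the kernel, since [T_psi] multiplies [K_a]
    by [u + conj (v a)]. *)
Lemma toeplitz_kernel_sum h m (c : 'I_m -> R[i]) (a : 'I_m -> Cn) (G : 'I_m -> Cn -> R[i]) F z :
  (forall j, cintegrable mu (fun w => h w * G j w * kernel_pair (a j) z w)) ->
  (forall w, F w = \sum_j c j * (G j w * fock_kernel (a j) w)) ->
  toeplitz h F z = \sum_j c j * cint mu (fun w => h w * G j w * kernel_pair (a j) z w).
Proof.
move=> ih FE; rewrite toeplitzE; under [RHS]eq_bigr do rewrite -cintZ//.
rewrite -cint_sum; last by move=> j; exact: cintegrableZ.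
apply: eq_cint => w; rewrite FE mulr_sumr mulr_suml; apply: eq_bigr => j _.
by rewrite /kernel_pair /fock_kernel; ring.
Qed.

Lemma cintegrable_kernel_pair F a z : cmeas F -> subgauss F ->
  cintegrable mu (fun w => F w * kernel_pair a z w).
Proof.
move=> mF sF; apply: subgauss_int.
  by apply: cmeasM => //; exact: cmeas_kernel_pair.
by apply: subgaussM => //; exact: subgauss_kernel_pair.
Qed.

Lemma reproducing_pair F a z : tame F ->
  cint mu (fun w => F w * kernel_pair a z w) = F z * cexp (dotC z (conjv a)).
Proof.
move=> tF; rewrite -(reproducing z (tameM tF (tame_kernel (conjv a)))).
by apply: eq_cint => w; rewrite /kernel_pair mulrA.
Qed.

(** [K_a] is an eigenvector of the operator whose symbol is the conjugate of [F]: the conjugate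
    reproducing formula is applied to [F w e^(w.conj z)] at [a]. *)
Lemma reproducing_pair_conj F a z : tame F ->
  cint mu (fun w => (F w)^* * kernel_pair a z w) = (F a)^* * cexp (dotC z (conjv a)).
Proof.
move=> tF; have := reproducing_conj a (tameM tF (tame_kernel (conjv z))).
rewrite [in RHS]rmorphM/= -kernel_conj => <-.
by apply: eq_cint => w; rewrite /kernel_pair rmorphM/= -kernel_conj; ring.
Qed.

Variables f g u v : Cn -> R[i].
Hypotheses (tf : tame f) (tg : tame g) (tu : tame u) (tv : tame v).

Let phi w := f w + (g w)^*.
Let psi w := u w + (v w)^*.

Let cmeas_subgauss F G : tame F -> tame G ->
  cmeas (fun w => F w + (G w)^*) /\ subgauss (fun w => F w + (G w)^*).
Proof.
move=> [mF sF _] [mG sG _]; split.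
  by apply: cmeasD => //; exact: cmeas_conj.
by apply: subgaussD => //; exact: subgauss_conj.
Qed.

Lemma toeplitz_kernel m (c : 'I_m -> R[i]) (a : 'I_m -> Cn) F :
  (forall w, F w = \sum_j c j * fock_kernel (a j) w) ->
  forall z, toeplitz psi F z = \sum_j c j * ((u z + (v (a j))^*) * fock_kernel (a j) z).
Proof.
move=> FE z; have [mp sp] := cmeas_subgauss tu tv.
rewrite (toeplitz_kernel_sum (c := c) (a := a) (G := fun _ _ => 1)).
- apply: eq_bigr => j _; congr (_ * _).
  have [mu' su _] := tu; have [mv sv _] := tv.
  rewrite (eq_cint _ (G := fun w => u w * kernel_pair (a j) z w + (v w)^* * kernel_pair (a j) z w)).
    rewrite cintD; last 2 first.
    + exact: cintegrable_kernel_pair.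
    + by apply: cintegrable_kernel_pair; [exact: cmeas_conj|exact: subgauss_conj].
    by rewrite reproducing_pair// reproducing_pair_conj// mulrDl.
  by move=> w; rewrite mulr1 mulrDl.
- by move=> j; apply: eq_cintegrable (cintegrable_kernel_pair (a j) z mp sp) => w; rewrite mulr1.
- by move=> w; rewrite FE; apply: eq_bigr => j _; rewrite mul1r.
Qed.

Definition product_symbol w : R[i] := u w * (g w)^* + f w * u w + (g w)^* * (v w)^* + star v f w.

Let cintegrable_star_pair a z : cintegrable mu (fun w => star v f w * kernel_pair a z w).
Proof.
apply: (gauss_bounded_int (c := 11 / 16 + 1 / 16)); last 2 first.
- lra.
- by apply: gauss_boundedM (gauss_bounded_star tv tf) (subgauss_kernel_pair _ _ _); rewrite divr_gt0.
- by apply: cmeasM; [exact: cmeas_star|exact: cmeas_kernel_pair].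
Qed.

Let poly_part w : R[i] := u w * (g w)^* + f w * u w + (g w)^* * (v w)^*.

Let poly_part_meas : cmeas poly_part /\ subgauss poly_part.
Proof.
have [mf sf _] := tf; have [mg sg _] := tg; have [mu' su _] := tu; have [mv sv _] := tv.
have mgc := cmeas_conj mg; have sgc := subgauss_conj sg.
have mvc := cmeas_conj mv; have svc := subgauss_conj sv.
split; first by apply: cmeasD; [apply: cmeasD|]; exact: cmeasM.
by apply: subgaussD; [apply: subgaussD|]; exact: subgaussM.
Qed.

Lemma cmeas_product_symbol : cmeas product_symbol.
Proof. by apply: cmeasD; [exact: poly_part_meas.1|exact: cmeas_star]. Qed.

Lemma cintegrable_product_symbol a z : cintegrable mu (fun w => product_symbol w * kernel_pair a z w).
Proof.
have [mp sp] := poly_part_meas.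
apply: eq_cintegrable (cintegrableD (cintegrable_kernel_pair a z mp sp) (cintegrable_star_pair a z)) => w.
by rewrite -mulrDl.
Qed.

Lemma cintegrable_toeplitz_product a z :
  cintegrable mu (fun w => phi w * (u w + (v a)^*) * kernel_pair a z w).
Proof.
have [mp sp] := cmeas_subgauss tf tg; have [mq sq] := cmeas_subgauss tu (tame_cst n (v a)).
by apply: cintegrable_kernel_pair; [exact: cmeasM|exact: subgaussM].
Qed.

Lemma cint_product_symbol a z :
  cint mu (fun w => phi w * (u w + (v a)^*) * kernel_pair a z w) =
  cint mu (fun w => product_symbol w * kernel_pair a z w).
Proof.
apply/eqP; rewrite -subr_eq0 -cintB; last 2 first.
- exact: cintegrable_toeplitz_product.
- exact: cintegrable_product_symbol.
(* The terms with [f u] and [u conj g] are common to both sides. [P1] and [P4] have equal integrals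
   by [star_transform]; so have [P2] and [P3], because conjugates of tame functions are evaluated at
   [a]. *)
pose P1 w := (v a)^* * (f w * kernel_pair a z w).
pose P2 w := (g w * v a)^* * kernel_pair a z w.
pose P3 w := (g w * v w)^* * kernel_pair a z w.
pose P4 w := star v f w * kernel_pair a z w.
have tgc := tameM tg (tame_cst n (v a)); have tgv := tameM tg tv.
have iconj F : tame F -> cintegrable mu (fun w => (F w)^* * kernel_pair a z w).
  by move=> [mF sF _]; apply: cintegrable_kernel_pair; [exact: cmeas_conj|exact: subgauss_conj].
have if_ : cintegrable mu (fun w => f w * kernel_pair a z w).
  by have [mf sf _] := tf; exact: cintegrable_kernel_pair.
have i1 : cintegrable mu P1 by exact: cintegrableZ.
have i2 : cintegrable mu P2 by exact: iconj.
have i3 : cintegrable mu P3 by exact: iconj.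
have i4 : cintegrable mu P4 by exact: cintegrable_star_pair.
rewrite (eq_cint _ (G := fun w => (P1 w - P4 w) + (P2 w - P3 w))); last first.
  by move=> w; rewrite /P1 /P2 /P3 /P4 /product_symbol /phi !rmorphM/=; ring.
rewrite cintD; [|exact: cintegrableB|exact: cintegrableB].
rewrite !cintB// cintZ// reproducing_pair// star_transform//.
by rewrite !reproducing_pair_conj//; apply/eqP; ring.
Qed.

Lemma toeplitz_product m (c : 'I_m -> R[i]) (a : 'I_m -> Cn) F z :
  (forall w, F w = \sum_j c j * fock_kernel (a j) w) ->
  toeplitz phi (toeplitz psi F) z = \sum_j c j * cint mu (fun w => product_symbol w * kernel_pair (a j) z w).
Proof.
move=> FE; rewrite (toeplitz_kernel_sum (c := c) (a := a) (G := fun j w => u w + (v (a j))^*)).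
- by apply: eq_bigr => j _; rewrite cint_product_symbol.
- by move=> j; exact: cintegrable_toeplitz_product.
- exact: toeplitz_kernel.
Qed.

Lemma toeplitz_L2 h m (c : 'I_m -> R[i]) (a : 'I_m -> Cn) F z : L2 h ->
  (forall w, F w = \sum_j c j * fock_kernel (a j) w) ->
  toeplitz h F z = \sum_j c j * cint mu (fun w => h w * kernel_pair (a j) z w).
Proof.
move=> hh FE; rewrite (toeplitz_kernel_sum (c := c) (a := a) (G := fun _ _ => 1)).
- by apply: eq_bigr => j _; congr (_ * _); apply: eq_cint => w; rewrite mulr1.
- move=> j; have := L2_cintegrableM hh (cmeas_kernel_pair (a j) z) (@subgauss_kernel_pair _ _ (a j) z).
  by apply: eq_cintegrable => w; rewrite mulr1.
- by move=> w; rewrite FE; apply: eq_bigr => j _; rewrite mul1r.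
Qed.

Lemma toeplitz_prod_eqP h : L2 h ->
  toeplitz_prod_eq phi psi h <-> {ae @lebesgueCn R n, forall w, h w = product_symbol w}.
Proof.
move=> hh; have [mh _] := hh; split => [H|H F [m [c [a FE]]] z]; last first.
  rewrite (toeplitz_product z FE) (toeplitz_L2 z hh FE); apply: eq_bigr => j _; congr (_ * _).
  apply: ae_eq_cint.
  - by apply: cmeasM; [exact: cmeas_product_symbol|exact: cmeas_kernel_pair].
  - by apply: cmeasM => //; exact: cmeas_kernel_pair.
  - by apply: filterS (ae_lebesgueCn_gauss H) => w ->.
apply: ae_gauss_lebesgueCn.
have ih a z := L2_cintegrableM hh (cmeas_kernel_pair a z) (@subgauss_kernel_pair _ _ a z).
(* At [a = z = 0] the pair is constant, so that [h] and the symbol are themselves integrable, as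
   [ae_eq0_of_kernels] requires. *)
have kp00 w : kernel_pair (0 : Cn) 0 w = 1.
  have c0 : conjv 0 = 0 :> Cn by apply/rowP => k; rewrite !mxE rmorph0.
  by rewrite /kernel_pair dotC0l c0 dotC_sym dotC0l cexp0 mulr1.
have i0 : cintegrable mu (fun w => h w - product_symbol w).
  apply: cintegrableB.
    by apply: eq_cintegrable (ih 0 0) => w; rewrite kp00 mulr1.
  by apply: eq_cintegrable (cintegrable_product_symbol 0 0) => w; rewrite kp00 mulr1.
have : {ae mu, forall w, h w - product_symbol w = 0}.
  apply: ae_eq0_of_kernels => // a z.
  pose c1 (_ : 'I_1) : R[i] := 1; pose a1 (_ : 'I_1) := a.
  have FE w : fock_kernel a w = \sum_j c1 j * fock_kernel (a1 j) w by rewrite big_ord1 mul1r.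
  have := H _ (ex_intro _ 1%N (ex_intro _ c1 (ex_intro _ a1 FE))) z.
  rewrite (toeplitz_product z FE) (toeplitz_L2 z hh FE) !big_ord1 !mul1r => E.
  rewrite (eq_cint _ (G := fun w => h w * kernel_pair a z w - product_symbol w * kernel_pair a z w)).
    rewrite cintB; [|exact: ih|exact: cintegrable_product_symbol].
    by rewrite E subrr.
  by move=> w; rewrite /kernel_pair; ring.
by apply: filterS => w /eqP; rewrite subr_eq0 => /eqP.
Qed.

End ToeplitzOnKernels.

Theorem theorem11 (R : realType) (n : nat) (hn : (1 <= n)%N)
    (f g u v h : 'rV[R[i]]_n -> R[i])
    (hf : Sym f /\ entire f) (hg : Sym g /\ entire g)
    (hu : Sym u /\ entire u) (hv : Sym v /\ entire v) (hh : L2 h) :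
  let phi := fun z => f z + (g z)^* in
  let psi := fun z => u z + (v z)^* in
  toeplitz_prod_eq phi psi h <->
  {ae @lebesgueCn R n, forall z,
    h z = u z * (g z)^* + f z * u z + (g z)^* * (v z)^* + shift_star v f z}.
Proof.
move=> phi psi.
have tame_of (F : 'rV[R[i]]_n -> R[i]) : Sym F /\ entire F -> tame F by move=> [SF eF]; exact: tame_entire.
have tf := tame_of _ hf; have tv := tame_of _ hv.
have -> := propext (toeplitz_prod_eqP tf (tame_of _ hg) (tame_of _ hu) tv hh).
by split; apply: filterS => z ->; rewrite /product_symbol shift_starE.
Qed.
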